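(* Let $\sigma$ be a discrete set of nonzero reals with $\sum_{\lambda\in\sigma}\frac{1}{|\lambda|}<\infty$ and let $W(z)=\prod_{\lambda\in\sigma}\left(1-\frac{z}{\lambda}\right)$. For every $k\in\mathbb{N}$, let $\eta_k\in\hat{\mathbb{R}}^\sigma$ be such that the coupling problem with data $\eta_k$ is symmetric and has a solution $(\Phi_{k,-},\Phi_{k,+})$. If there is a partition $\sigma_0 \cup \{\lambda_0\} \cup \sigma_\infty$ of $\sigma\cap(0,\infty)$ such that, as $k\to\infty$, $$ \eta_{k}(\lambda) \rightarrow \begin{cases} 0, & \text{for all }\lambda\in\sigma_0, \\ \infty, & \text{for all }\lambda\in\sigma_\infty, \end{cases} $$ then one has the asymptotics $$ \frac{\Phi_{k,-}(z)\Phi_{k,+}(z)}{W(z)} = 1 + \frac{z^2}{\lambda_0^2-z^2}\, \frac{1}{\cosh^2\left(\frac{1}{2}\log|\hat{\eta}_k|\right)} + o(1) $$ as $k\to\infty$, locally uniformly for all $z\in\mathbb{C}\setminus\sigma$, where the $\hat{\eta}_k\in\hat{\mathbb{R}}$ are given by $$ \hat{\eta}_{k} = \eta_{k}(\lambda_0) \prod_{\lambda\in\sigma_0} \frac{\lambda + \lambda_0}{\lambda - \lambda_0} \prod_{\lambda\in\sigma_\infty} \frac{\lambda - \lambda_0}{\lambda + \lambda_0} $$ when $\eta_k(\lambda_0)$ is finite and by $\hat{\eta}_k = \infty$ otherwise.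
   Context: $\hat{\mathbb{R}}=\mathbb{R}\cup\{\infty\}$ is the one-point compactification of $\mathbb{R}$; convergence of the $\eta_k(\lambda)$ is understood in $\hat{\mathbb{R}}$. The expression $\frac{1}{\cosh^2(\frac12\log|\eta|)}$ is interpreted as a function of $\eta$ extended continuously to $\hat{\mathbb{R}}$, so it is equal to zero when $\eta\in\{0,\infty\}$. Coupling problem. For $\sigma$ and $W$ as in the statement and $\eta\in\hat{\mathbb{R}}^\sigma$ (the data), a solution of the coupling problem with data $\eta$ is a pair $(\Phi_-,\Phi_+)$ of real entire functions of exponential type zero such that: (C) for each $\lambda\in\sigma$, $\Phi_-(\lambda)=\eta(\lambda)\Phi_+(\lambda)$ (to be read as $\Phi_+(\lambda)=0$ when $\eta(\lambda)=\infty$); (G) for every $z\in\mathbb{C}$ with $\mathrm{Im}\,z>0$, $\mathrm{Im}\left(\frac{z\Phi_-(z)\Phi_+(z)}{W(z)}\right)\geq 0$; (N) $\Phi_-(0)=\Phi_+(0)=1$. It is known that a coupling problem has at most one solution. The coupling problem is called symmetric if $\sigma=-\sigma$ and $\eta(-\lambda)=\eta(\lambda)^{-1}$ for each $\lambda\in\sigma$, where $0^{-1}=\infty$ and $\infty^{-1}=0$. *)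

(* Defs.v *)
(* MathComp-Analysis, over an arbitrary [R : realType]; complex numbers are
   the type [R[i]] of mathcomp-real-closed. *)
From HB Require Import structures.
From mathcomp Require Import all_boot all_order all_algebra.
From mathcomp Require Import finmap complex.
From mathcomp Require Import all_classical all_reals all_analysis.
From mathcomp Require Import showcase.summability.

Set Implicit Arguments.
Unset Strict Implicit.
Unset Printing Implicit Defensive.

Import Order.TTheory GRing.Theory Num.Theory.
Import numFieldNormedType.Exports.

Local Open Scope classical_set_scope.
Local Open Scope ring_scope.
Local Open Scope complex_scope.

(* [R[i]] as an abstract numFieldType: the library attaches the norm topology to
   numFieldTypes, not to [R[i]] itself. *)
Definition Cplx (R : realType) : numFieldType := R[i].

(* Unconditional product over [A]: the limit of the finite partial products
   along the finite sets ordered by inclusion. *)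
Definition infprod (K : numFieldType) (T : choiceType) (A : set T)
    (f : T -> K) : K :=
  lim ((fun F : {fset T} => \prod_(x <- F | x \in A) f x) @ totally).

Section coupling.
Variable R : realType.
Local Notation C := (Cplx R).

(* [None] is the point at infinity. *)
Definition Rhat := one_point_compactification R.

Definition Rhat_inv (x : Rhat) : Rhat :=
  if x is Some r then (if r == 0 then None else Some r^-1) else Some 0.

Definition cosh (x : R) : R := (expR x + expR (- x)) / 2.

Definition sech2_half_log (x : Rhat) : R :=
  if x is Some r then
    (if r == 0 then 0 else 1 / cosh (2^-1 * ln `|r|) ^+ 2)
  else 0.

Definition entire (f : C -> C) : Prop := forall z, derivable f z 1.

Definition exp_type_zero (f : C -> C) : Prop :=
  forall e : R, 0 < e -> exists M : R, forall z : C,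
    Normc.normc (f z) <= M * expR (e * Normc.normc z).

Definition real_on_real (f : C -> C) : Prop :=
  forall x : R, complex.Im (f x%:C) = 0.

Definition W (sigma : set R) (z : C) : C :=
  infprod sigma (fun l => 1 - z / l%:C).

(* Data are total functions on [R]; only their values on [sigma] are used. *)
Record coupling_solution (sigma : set R) (eta : R -> Rhat)
    (Phim Phip : C -> C) : Prop := CouplingSolution {
  coupling_entire_m : [/\ entire Phim, exp_type_zero Phim & real_on_real Phim];
  coupling_entire_p : [/\ entire Phip, exp_type_zero Phip & real_on_real Phip];
  coupling_C : forall l, sigma l ->
    if eta l is Some r then Phim l%:C = (r%:C : C) * Phip l%:C else Phip l%:C = 0;
  coupling_G : forall z : C, 0 < complex.Im z ->
    0 <= complex.Im (z * Phim z * Phip z / W sigma z);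
  coupling_N : Phim 0 = 1 /\ Phip 0 = 1 }.

Definition coupling_symmetric (sigma : set R) (eta : R -> Rhat) : Prop :=
  [set - l | l in sigma] = sigma /\
  forall l, sigma l -> eta (- l) = Rhat_inv (eta l).

Definition hat_eta (eta : R -> Rhat) (l0 : R) (sigma0 sigmaoo : set R) : Rhat :=
  if eta l0 is Some r then
    Some (r * infprod sigma0 (fun l => (l + l0) / (l - l0))
            * infprod sigmaoo (fun l => (l - l0) / (l + l0)))
  else None.

Definition locally_uniform_cvg (D : set C) (f : nat -> C -> C)
    (g : C -> C) : Prop :=
  forall z, D z -> exists2 U, nbhs z U & {uniform U `&` D, f @ \oo --> g}.

End coupling.

(* Main.v *)
(* Write p = Phi_- Phi_+ / W. Condition (G) says that z p is a Herglotz function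
   with simple poles in sigma, and a Harnack estimate on large circles gives
   p = 1 + sum_l g_l z / (l - z) with g_l >= 0 and sum_l g_l <= 1. In particular the
   zeros of Phi_- and Phi_+ are real, and both functions are dominated by
   prod_l (1 + |z| / |l|), uniformly in k. The convergence of the data then forces
   g_l -> 0 for every l other than l0 and - l0, so only g_{l0} and g_{- l0} matter.

   Along an ultrafilter Phi_- and Phi_+ converge to functions f and h of exponential
   type zero with f h = A(z) A(- z) q(z / l0), where A has the prescribed zeros of f
   and q is a real quadratic polynomial determined by the limits of g_{l0} and
   g_{- l0}. A function of type zero is determined in modulus by its zeros, so f and h
   are A(z) and A(- z) times a distribution of the two factors of q. Inspecting the
   four distributions at l0 and - l0, together with the symmetry relation
   f(l0) f(- l0) = h(l0) h(- l0), shows that the two limits agree, and that their sum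
   is the limit of 1 / cosh^2 (log |hat eta_k| / 2) = 4 u v / (u + v)^2, where
   |hat eta_k| = u / v, u = |Phi_-(l0) / A(l0)| and v = |Phi_+(l0) / A(- l0)|. *)
Require Import Defs.
From HB Require Import structures.
From mathcomp Require Import all_boot all_order all_algebra.
From mathcomp Require Import finmap complex.
From mathcomp Require Import all_classical all_reals all_analysis.
From mathcomp Require Import cyclic separable cyclotomic.
From mathcomp Require Import zify ring lra.
From mathcomp Require Import showcase.summability.

Set Implicit Arguments.
Unset Strict Implicit.
Unset Printing Implicit Defensive.

Import Order.TTheory GRing.Theory Num.Theory.
Import numFieldNormedType.Exports.

Local Open Scope classical_set_scope.
Local Open Scope ring_scope.
Local Open Scope complex_scope.

(** * The modulus, real part and imaginary part on [R[i]] *)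

Section normc_theory.
Variable R : realType.
Local Notation C := R[i].
Local Notation N := (@Normc.normc R).
Implicit Types z w : C.

(** Function theory is carried by quantitative Taylor expansions: a function is compared with its
    partial sums up to a geometric error, so limits of power series become finite sums, and means
    over circles become means over roots of unity.

    The obstacle is to bound [Phi_-] and [Phi_+] separately, since (G) only controls their product.
    On the imaginary axis a real-rooted function of type zero with value 1 at 0 has modulus at least
    1, and there the expansion of p, with its nonnegative weights, gives [|Phi_- Phi_+| <= |W|].
    Each factor is thus dominated by [W] on that axis, and a Phragmen-Lindelof argument in the right
    half plane carries the bound over to the positive half line.

    Hadamard factorization enters only through moduli: once the zeros in a large disc are divided
    out, what remains has modulus close to 1 at any given point. This is enough because only
    [|hat eta_k|] occurs in the asymptotics.

    Ultrafilters provide limits of all bounded quantities at once; a sequence tends to 0 as soon as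
    it does so along every ultrafilter finer than [\oo]. *)

Lemma normcE z : N z = Num.sqrt (complex.Re z ^+ 2 + complex.Im z ^+ 2).
Proof. by case: z. Qed.

Lemma normc_ge0 z : 0 <= N z.
Proof. by rewrite normcE sqrtr_ge0. Qed.
Hint Resolve normc_ge0 : core.

Lemma sqr_normcE z : N z ^+ 2 = complex.Re z ^+ 2 + complex.Im z ^+ 2.
Proof. by rewrite normcE sqr_sqrtr// addr_ge0// sqr_ge0. Qed.

Lemma normc_eq0 z : (N z == 0) = (z == 0).
Proof.
apply/eqP/eqP => [/Normc.eq0_normc //|->]; exact: Normc.normc0.
Qed.

Lemma normc_gt0 z : (0 < N z) = (z != 0).
Proof. by rewrite lt_def normc_eq0 normc_ge0 andbT. Qed.

Lemma normcB z w : N (z - w) = N (w - z).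
Proof. by rewrite -normcN opprB. Qed.

Lemma ler_normcB z w : N (z - w) <= N z + N w.
Proof. by rewrite -(normcN w); apply: le_normcD. Qed.

Lemma ler_normc_sub z w : N z - N w <= N (z - w).
Proof. by rewrite lerBlDr; have := le_normcD (z - w) w; rewrite subrK. Qed.

Lemma ler_normc_dist z w : `|N z - N w| <= N (z - w).
Proof.
rewrite ler_norml ler_normc_sub andbT lerNl opprB normcB.
exact: ler_normc_sub.
Qed.

Lemma normcX z n : N (z ^+ n) = N z ^+ n.
Proof.
elim: n => [|n IH]; first by rewrite !expr0 Normc.normc1.
by rewrite !exprS Normc.normcM IH.
Qed.

Lemma normcf_div z w : N (z / w) = N z / N w.
Proof. by rewrite Normc.normcM Normc.normcV. Qed.

Lemma normc_real (x : R) : N x%:C = `|x|.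
Proof. by rewrite normcE /= expr0n addr0 sqrtr_sqr. Qed.

Lemma normc_natr n : N n%:R = n%:R.
Proof. by rewrite -(rmorph_nat (real_complex R)) normc_real normr_nat. Qed.

Lemma normc_i : N 'i = 1.
Proof. by rewrite normcE /= expr0n expr1n add0r sqrtr1. Qed.

Lemma normc_conj z : N z^* = N z.
Proof. by rewrite !normcE; case: z => a b /=; rewrite sqrrN. Qed.

Lemma mul_conjc z : z * z^* = (N z ^+ 2)%:C.
Proof.
rewrite sqr_normcE; case: z => a b /=; apply/eqP; rewrite eq_complex /=.
by apply/andP; split; apply/eqP; ring.
Qed.

Lemma normc_ge_Re z : `|complex.Re z| <= N z.
Proof.
by rewrite normcE -sqrtr_sqr ler_sqrt ?lerDl ?sqr_ge0// addr_ge0 ?sqr_ge0.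
Qed.

Lemma normc_ge_Im z : `|complex.Im z| <= N z.
Proof.
by rewrite normcE -sqrtr_sqr ler_sqrt ?lerDr ?sqr_ge0// addr_ge0 ?sqr_ge0.
Qed.

Lemma normc_le_ReIm z : N z <= `|complex.Re z| + `|complex.Im z|.
Proof.
rewrite normcE -[leRHS]ger0_norm ?addr_ge0// -sqrtr_sqr ler_sqrt ?sqr_ge0//.
have := mulr_ge0 (normr_ge0 (complex.Re z)) (normr_ge0 (complex.Im z)).
by rewrite -(real_normK (num_real (complex.Re z)))
  -(real_normK (num_real (complex.Im z))); nra.
Qed.

Lemma normc_sum (I : Type) (r : seq I) (P : pred I) (F : I -> C) :
  N (\sum_(i <- r | P i) F i) <= \sum_(i <- r | P i) N (F i).
Proof.
elim/big_ind2 : _ => [|x1 x2 y1 y2 h1 h2|//]; first by rewrite Normc.normc0.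
exact: le_trans (le_normcD _ _) (lerD h1 h2).
Qed.

Lemma normc_prod (I : Type) (r : seq I) (P : pred I) (F : I -> C) :
  N (\prod_(i <- r | P i) F i) = \prod_(i <- r | P i) N (F i).
Proof.
elim/big_rec2 : _ => [|i x y _ <-]; first by rewrite Normc.normc1.
by rewrite Normc.normcM.
Qed.

Lemma ReD z w : complex.Re (z + w) = complex.Re z + complex.Re w.
Proof. by case: z w => ? ? [? ?]. Qed.
Lemma ImD z w : complex.Im (z + w) = complex.Im z + complex.Im w.
Proof. by case: z w => ? ? [? ?]. Qed.
Lemma ReN z : complex.Re (- z) = - complex.Re z.
Proof. by case: z. Qed.
Lemma ImN z : complex.Im (- z) = - complex.Im z.
Proof. by case: z. Qed.
Lemma ReM z w : complex.Re (z * w) =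
  complex.Re z * complex.Re w - complex.Im z * complex.Im w.
Proof. by case: z w => ? ? [? ?]. Qed.
Lemma ImM z w : complex.Im (z * w) =
  complex.Re z * complex.Im w + complex.Im z * complex.Re w.
Proof. by case: z w => ? ? [? ?]. Qed.
Lemma Re_sum (I : Type) (r : seq I) (P : pred I) (F : I -> C) :
  complex.Re (\sum_(i <- r | P i) F i) = \sum_(i <- r | P i) complex.Re (F i).
Proof. by elim/big_rec2 : _ => // i x y _ <-; rewrite ReD. Qed.
Lemma Im_sum (I : Type) (r : seq I) (P : pred I) (F : I -> C) :
  complex.Im (\sum_(i <- r | P i) F i) = \sum_(i <- r | P i) complex.Im (F i).
Proof. by elim/big_rec2 : _ => // i x y _ <-; rewrite ImD. Qed.

Lemma complex_eqP z w :
  complex.Re z = complex.Re w -> complex.Im z = complex.Im w -> z = w.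
Proof. by case: z w => ? ? [? ?] /= -> ->. Qed.

Lemma real_of_Im0 z : complex.Im z = 0 -> z = (complex.Re z)%:C.
Proof. by move=> h; apply: complex_eqP. Qed.

End normc_theory.
#[global] Hint Resolve normc_ge0 : core.

(* Limits of complex families are taken componentwise, since [R[i]] carries no
   topology over [R]. *)
Section complex_limits.
Variable R : realType.
Local Notation C := R[i].
Local Notation N := (@Normc.normc R).

Definition cvgc (T : Type) (U : set_system T) (u : T -> C) (l : C) : Prop :=
  (fun t => complex.Re (u t)) @ U --> complex.Re l /\
  (fun t => complex.Im (u t)) @ U --> complex.Im l.

Section filter.
Variables (T : Type) (U : set_system T).
Context {FU : ProperFilter U}.

Lemma cvgcP (u : T -> C) (l : C) :
  cvgc U u l <-> forall e : R, 0 < e -> U [set t | N (u t - l) < e].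
Proof.
split=> [[/cvgrPdist_lt hr /cvgrPdist_lt hi] e e0|h].
  have e20 : 0 < e / 2 by lra.
  apply: filterS2 (hr _ e20) (hi _ e20) => t /= h1 h2.
  apply: le_lt_trans (normc_le_ReIm _) _.
  by rewrite ReD ImD ReN ImN distrC [X in _ + X]distrC (splitr e) ltrD.
split; apply/cvgrPdist_lt => e /h; apply: filterS => t /=; apply: le_lt_trans;
  rewrite distrC.
- by rewrite -ReN -ReD normc_ge_Re.
- by rewrite -ImN -ImD normc_ge_Im.
Qed.

Lemma cvgc_unique u l l' : cvgc U u l -> cvgc U u l' -> l = l'.
Proof.
move=> [r i] [r' i']; apply: complex_eqP.
- exact: (@cvg_unique _ _ (fmap (fun t => complex.Re (u t)) U) _ _ _ r r').
- exact: (@cvg_unique _ _ (fmap (fun t => complex.Im (u t)) U) _ _ _ i i').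
Qed.

Lemma cvgc_cst l : cvgc U (fun=> l) l.
Proof. by split; exact: cvg_cst. Qed.

Lemma cvgcD u v l m : cvgc U u l -> cvgc U v m ->
  cvgc U (fun t => u t + v t) (l + m).
Proof.
move=> [ur ui] [vr vi]; split; rewrite (ReD, ImD).
- by under eq_fun do rewrite ReD; exact: cvgD.
- by under eq_fun do rewrite ImD; exact: cvgD.
Qed.

Lemma cvgcN u l : cvgc U u l -> cvgc U (fun t => - u t) (- l).
Proof.
move=> [ur ui]; split; rewrite (ReN, ImN).
- by under eq_fun do rewrite ReN; exact: cvgN.
- by under eq_fun do rewrite ImN; exact: cvgN.
Qed.

Lemma cvgcB u v l m : cvgc U u l -> cvgc U v m ->
  cvgc U (fun t => u t - v t) (l - m).
Proof. by move=> hu hv; apply: cvgcD => //; exact: cvgcN. Qed.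

Lemma cvgcM u v l m : cvgc U u l -> cvgc U v m ->
  cvgc U (fun t => u t * v t) (l * m).
Proof.
move=> [ur ui] [vr vi]; split; rewrite (ReM, ImM).
- by under eq_fun do rewrite ReM; apply: cvgB; exact: cvgM.
- by under eq_fun do rewrite ImM; apply: cvgD; exact: cvgM.
Qed.

Lemma cvgc_norm u l : cvgc U u l -> (fun t => N (u t)) @ U --> N l.
Proof.
move=> /cvgcP h; apply/cvgrPdist_lt => e /h; apply: filterS => t /=.
by apply: le_lt_trans; rewrite distrC; exact: ler_normc_dist.
Qed.

Lemma cvgc_real (u : T -> R) (l : R) : u @ U --> l -> cvgc U (fun t => (u t)%:C) l%:C.
Proof. by move=> h; split=> //=; exact: cvg_cst. Qed.

Lemma cvgcV u l : l != 0 -> cvgc U u l -> cvgc U (fun t => (u t)^-1) l^-1.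
Proof.
move=> l0 hu; have [ur ui] := hu.
have n0 : N l ^+ 2 != 0 by rewrite expf_neq0// normc_eq0.
have hn : (fun t => (N (u t) ^+ 2)^-1) @ U --> (N l ^+ 2)^-1.
  apply: cvgV => //; rewrite expr2; under eq_fun do rewrite expr2.
  by apply: cvgM; exact: cvgc_norm.
have ReV z : complex.Re z^-1 = complex.Re z * (N z ^+ 2)^-1.
  by rewrite sqr_normcE; case: z.
have ImV z : complex.Im z^-1 = - complex.Im z * (N z ^+ 2)^-1.
  by rewrite sqr_normcE; case: z => a b /=; rewrite mulNr.
split; rewrite (ReV, ImV).
- by under eq_fun do rewrite ReV; exact: cvgM.
- by under eq_fun do rewrite ImV; apply: cvgM => //; exact: cvgN.
Qed.

Lemma cvgc_le u l (b : R) : cvgc U u l -> (U [set t | N (u t) <= b]) -> N l <= b.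
Proof.
move=> /cvgc_norm h hb.
exact: cvgr_to_le h hb.
Qed.

Lemma cvgc_sum (I : Type) (r : seq I) (u : I -> T -> C) (l : I -> C) :
  (forall i, cvgc U (u i) (l i)) ->
  cvgc U (fun t => \sum_(i <- r) u i t) (\sum_(i <- r) l i).
Proof.
move=> h; elim: r => [|i r IH].
  by rewrite big_nil; under eq_fun do rewrite big_nil; exact: cvgc_cst.
by rewrite big_cons; under eq_fun do rewrite big_cons; exact: cvgcD.
Qed.

Lemma cvgc_squeeze u l (b : T -> R) : b @ U --> (0 : R) ->
  U [set t | N (u t - l) <= b t] -> cvgc U u l.
Proof.
move=> /cvgrPdist_lt hb hu; apply/cvgcP => e /hb h.
apply: filterS2 h hu => t /=; rewrite sub0r normrN => h1 h2.
exact: le_lt_trans h2 (le_lt_trans (ler_norm _) h1).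
Qed.

End filter.

(** The image of an ultrafilter is an ultrafilter, and [[- B, B]] is compact. Bounded families thus
    get limits without passing to subsequences, all of them along the same [U]. *)
Lemma ultra_cvg (T : Type) (U : set_system T) (u : T -> R) (B : R) :
  UltraFilter U -> U [set t | `|u t| <= B] -> exists l : R, u @ U --> l.
Proof.
move=> UU hB; apply/not_existsP => h.
have cpt : compact `[- B, B]%classic by exact: segment_compact.
have PF : ProperFilter (u @ U) by exact: fmap_proper_filter.
have UF : UltraFilter (u @ U).
  split; first exact: PF.
  move=> G PG FG; rewrite eqEsubset; split=> [A GA|]; last exact: FG.
  have [//|UA] := in_ultra_setVsetC (u @^-1` A) UU.
  have GA' : G (~` A) by exact: FG.
  have : G (A `&` ~` A) by exact: filterI.
  by rewrite setICr => /filter_ex[].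
move: cpt; rewrite compact_ultra => /(_ (u @ U) UF) []; last by move=> l [_ /h].
rewrite /= ; apply: filterS hB => t /=.
by rewrite in_itv /= ler_norml.
Qed.

Lemma ultra_cvgc (T : Type) (U : set_system T) (u : T -> C) (B : R) :
  UltraFilter U -> U [set t | N (u t) <= B] -> exists l : C, cvgc U u l.
Proof.
move=> UU hB.
have [a ha] : exists a : R, (fun t => complex.Re (u t)) @ U --> a.
  apply: (@ultra_cvg _ _ _ B) => //; apply: filterS hB => t /=.
  by apply: le_trans; exact: normc_ge_Re.
have [b hb] : exists a : R, (fun t => complex.Im (u t)) @ U --> a.
  apply: (@ultra_cvg _ _ _ B) => //; apply: filterS hB => t /=.
  by apply: le_trans; exact: normc_ge_Im.
by exists (a +i* b).
Qed.

End complex_limits.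

(** * Complex differentiability and line integrals *)

Section complex_derivative.
Variable R : realType.
Local Notation C := R[i].
Local Notation N := (@Normc.normc R).
Implicit Types (f g : C -> C) (z w : C).

Definition nbhsc z : set_system C :=
  filter_from [set e : R | 0 < e] (fun e => [set w | N (w - z) < e]).

Global Instance nbhsc_filter z : ProperFilter (nbhsc z).
Proof.
apply: filter_from_proper.
  apply: filter_from_filter; first by exists 1 => /=.
  move=> e1 e2 /= h1 h2; exists (Num.min e1 e2); first by rewrite /= lt_min h1.
  by move=> w /=; rewrite lt_min => /andP[].
by move=> e /= e0; exists z => /=; rewrite subrr Normc.normc0.
Qed.

Definition ccont f z := cvgc (nbhsc z) f (f z).

Lemma ccontP f z : ccont f z <-> forall e : R, 0 < e ->
  exists2 d : R, 0 < d & forall w, N (w - z) < d -> N (f w - f z) < e.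
Proof.
split=> [/cvgcP h e /h[d /= d0 hd]|h].
  by exists d => // w; exact: hd.
by apply/cvgcP => e /h[d d0 hd]; exists d.
Qed.

Lemma ccont_cst c z : ccont (fun=> c) z. Proof. exact: cvgc_cst. Qed.

Lemma ccont_id z : ccont id z.
Proof. by apply/ccontP => e e0; exists e. Qed.

Lemma ccontD f g z : ccont f z -> ccont g z -> ccont (fun w => f w + g w) z.
Proof. exact: cvgcD. Qed.

Lemma ccontB f g z : ccont f z -> ccont g z -> ccont (fun w => f w - g w) z.
Proof. exact: cvgcB. Qed.

Lemma ccontM f g z : ccont f z -> ccont g z -> ccont (fun w => f w * g w) z.
Proof. exact: cvgcM. Qed.

Lemma ccontV f z : f z != 0 -> ccont f z -> ccont (fun w => (f w)^-1) z.
Proof. exact: cvgcV. Qed.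

Definition cderiv f z d := forall e : R, 0 < e -> exists2 r : R, 0 < r &
  forall h, N h < r -> N (f (z + h) - f z - d * h) <= e * N h.

Definition cdiff f z := exists d, cderiv f z d.

(** Caratheodory's form of differentiability: the increment is [q h * h] with [q] continuous at 0.
    The rules for products and inverses then reduce to algebra on slopes. *)
Lemma cderiv_slopeP f z d : cderiv f z d <->
  exists2 q : C -> C, (forall h, f (z + h) = f z + q h * h) &
    q 0 = d /\ ccont q 0.
Proof.
split=> [hd|[q fq [q0 /ccontP qc]] e /qc[r r0 hr]]; last first.
  exists r => // h hh; rewrite fq -q0.
  rewrite (_ : _ - _ - _ = (q h - q 0) * h); last by ring.
  rewrite Normc.normcM ler_wpM2r// ltW// hr// subr0//.
exists (fun h => if h == 0 then d else (f (z + h) - f z) / h).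
  by move=> h; case: eqP => [->|/eqP h0]; [rewrite addr0 mulr0 addr0|rewrite divfK// [RHS]addrC subrK].
split; rewrite ?eqxx//; apply/ccontP => e e0.
have e20 : 0 < e / 2 by lra.
have [r r0 hr] := hd _ e20; exists r => // h; rewrite subr0 eqxx => hh.
case: eqP => [_|/eqP h0]; first by rewrite subrr Normc.normc0.
rewrite (_ : _ - _ = (f (z + h) - f z - d * h) / h); last by field.
rewrite normcf_div ltr_pdivrMr ?normc_gt0//; apply: le_lt_trans (hr _ hh) _.
by rewrite ltr_pM2r ?normc_gt0//; lra.
Qed.

Lemma cdiff_slope f z :
  (exists2 q : C -> C, (forall h, f (z + h) = f z + q h * h) & ccont q 0) ->
  cdiff f z.
Proof. by move=> [q h1 h2]; exists (q 0); apply/cderiv_slopeP; exists q. Qed.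

Lemma ccont_shift f z : ccont (fun h => f (z + h)) 0 <-> ccont f z.
Proof.
split=> /ccontP h; apply/ccontP => e /h[d d0 hd]; exists d => // w hw.
  by have := hd (w - z); rewrite subr0 addr0 [z + _]addrC subrK; apply.
by rewrite addr0; apply: hd; rewrite addrAC subrr add0r -[w]subr0.
Qed.

Lemma cdiff_cont f z : cdiff f z -> ccont f z.
Proof.
move=> [d /cderiv_slopeP[q fq [_ qc]]]; apply/ccont_shift.
rewrite (_ : (fun h => _) = fun h => f z + q h * h); last exact/funext.
apply: (@ccontD (fun=> f z)); first exact: ccont_cst.
by apply: ccontM => //; exact: ccont_id.
Qed.

Lemma cdiff_cst c z : cdiff (fun=> c) z.
Proof.
apply: cdiff_slope; exists (fun=> 0) => [h|]; first by rewrite mul0r addr0.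
exact: ccont_cst.
Qed.

Lemma cdiff_id z : cdiff id z.
Proof.
apply: cdiff_slope; exists (fun=> 1) => [h|]; first by rewrite mul1r.
exact: ccont_cst.
Qed.

Lemma cdiffD f g z : cdiff f z -> cdiff g z -> cdiff (fun w => f w + g w) z.
Proof.
move=> [a /cderiv_slopeP[p fp [_ pc]]] [b /cderiv_slopeP[q gq [_ qc]]].
apply: cdiff_slope; exists (fun h => p h + q h); last exact: ccontD.
by move=> h; rewrite fp gq; ring.
Qed.

Lemma cdiffM f g z : cdiff f z -> cdiff g z -> cdiff (fun w => f w * g w) z.
Proof.
move=> df dg; have cg := cdiff_cont dg; move: df dg.
move=> [a /cderiv_slopeP[p fp [_ pc]]] [b /cderiv_slopeP[q gq [_ qc]]].
apply: cdiff_slope; exists (fun h => p h * g (z + h) + f z * q h).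
  by move=> h; rewrite mulrDl gq fp; ring.
apply: ccontD; apply: ccontM => //; last exact: ccont_cst.
exact/ccont_shift.
Qed.

Lemma cdiffN f z : cdiff f z -> cdiff (fun w => - f w) z.
Proof.
move=> h; rewrite (_ : (fun w => _) = fun w => (-1) * f w); last first.
  by apply/funext => w; rewrite mulN1r.
by apply: cdiffM => //; exact: cdiff_cst.
Qed.

Lemma cdiffB f g z : cdiff f z -> cdiff g z -> cdiff (fun w => f w - g w) z.
Proof. by move=> h1 h2; apply: cdiffD => //; exact: cdiffN. Qed.

Lemma cdiffX f n z : cdiff f z -> cdiff (fun w => f w ^+ n) z.
Proof.
move=> hf; elim: n => [|n IH].
  by under eq_fun do rewrite expr0; exact: cdiff_cst.
by under eq_fun do rewrite exprS; exact: cdiffM.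
Qed.

Lemma cdiffV f z : f z != 0 -> cdiff f z -> cdiff (fun w => (f w)^-1) z.
Proof.
move=> fz hf; have /ccontP fc := cdiff_cont hf.
have nz : 0 < N (f z) by rewrite normc_gt0.
have [r r0 hr] := fc _ nz.
have nzr w : N (w - z) < r -> f w != 0.
  move=> /hr; apply: contraTneq => ->.
  by rewrite sub0r normcN ltxx.
have [d /cderiv_slopeP[q fq [q0 qc]]] := hf.
exists (- d * (f z)^-1 ^+ 2); apply/cderiv_slopeP.
(* The closed form of the slope is valid where [f (z + h)] is nonzero. Outside that disc only the
   increment identity matters, and [h = 0] never falls there. *)
exists (fun h => if N h < r then - q h * (f z)^-1 * (f (z + h))^-1
                 else if h == 0 then 0 else ((f (z + h))^-1 - (f z)^-1) / h).
  move=> h; case: ifPn => hh.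
    have nh : f (z + h) != 0 by apply: nzr; rewrite addrAC subrr add0r.
    have e : q h * h = f (z + h) - f z by rewrite fq; ring.
    rewrite (_ : _ * h = - (q h * h) * (f z)^-1 * (f (z + h))^-1); last by ring.
    by rewrite e; field; rewrite nh fz.
  case: eqP => [h0|/eqP h0]; first by rewrite h0 Normc.normc0 r0 in hh.
  by rewrite divfK// [RHS]addrC subrK.
rewrite Normc.normc0 r0 addr0 q0; split; first by ring.
have c : ccont (fun h => - q h * (f z)^-1 * (f (z + h))^-1) 0.
  apply: ccontM; last first.
    by apply: ccontV; [rewrite addr0|apply/ccont_shift; exact/ccontP].
  apply: ccontM; last exact: ccont_cst.
  exact: cvgcN.
apply/ccontP => e e0; move/ccontP : c => /(_ _ e0)[s s0 hs].
exists (Num.min r s); first by rewrite lt_min r0.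
move=> h; rewrite lt_min subr0 => /andP[h1 h2]; rewrite h1 Normc.normc0 r0.
by apply: hs; rewrite subr0.
Qed.

Lemma cdiff_sum (I : Type) (s : seq I) (P : pred I) (F : I -> C -> C) z :
  (forall i, P i -> cdiff (F i) z) -> cdiff (fun w => \sum_(i <- s | P i) F i w) z.
Proof.
move=> h; elim: s => [|i s IH].
  rewrite (_ : (fun w => _) = fun=> 0); first exact: cdiff_cst.
  by apply/funext => w; rewrite big_nil.
have [Pi|/negbTE Pi] := boolP (P i); last first.
  rewrite (_ : (fun w => _) = fun w => \sum_(j <- s | P j) F j w) //.
  by apply/funext => w; rewrite big_cons Pi.
rewrite (_ : (fun w => _) = fun w => F i w + \sum_(j <- s | P j) F j w).
  by apply: cdiffD => //; exact: h.
by apply/funext => w; rewrite big_cons Pi.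
Qed.

Lemma cdiff_prod (I : Type) (s : seq I) (P : pred I) (F : I -> C -> C) z :
  (forall i, P i -> cdiff (F i) z) -> cdiff (fun w => \prod_(i <- s | P i) F i w) z.
Proof.
move=> h; elim: s => [|i s IH].
  rewrite (_ : (fun w => _) = fun=> 1); first exact: cdiff_cst.
  by apply/funext => w; rewrite big_nil.
have [Pi|/negbTE Pi] := boolP (P i); last first.
  rewrite (_ : (fun w => _) = fun w => \prod_(j <- s | P j) F j w) //.
  by apply/funext => w; rewrite big_cons Pi.
rewrite (_ : (fun w => _) = fun w => F i w * \prod_(j <- s | P j) F j w).
  by apply: cdiffM => //; exact: h.
by apply/funext => w; rewrite big_cons Pi.
Qed.

Lemma cdiff_shift f a z : cdiff f (a + z) -> cdiff (fun w => f (a + w)) z.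
Proof.
move=> [d hd]; exists d => e /hd[r r0 hr]; exists r => // h /hr.
by rewrite addrA.
Qed.

End complex_derivative.

(** * Integrals of complex functions over real intervals *)

Section complex_integral.
Variable R : realType.
Local Notation C := R[i].
Local Notation N := (@Normc.normc R).
Local Notation mu := (@lebesgue_measure R).
Implicit Types (f g : R -> C) (a b c : R).

Definition pcont f (x : R) := cvgc (nbhs x) f (f x).

Definition pcont_on a b f := forall x, a <= x <= b -> pcont f x.

Lemma pcont_path (F : C -> C) (p q : C) x :
  ccont F (p + q * x%:C) -> pcont (fun t => F (p + q * t%:C)) x.
Proof.
move=> /ccontP h; apply/cvgcP => e /h[d d0 hd].
have n0 : 0 < N q + 1 by rewrite ltr_wpDl.
near=> y; apply: hd.
rewrite (_ : _ - _ = q * (y - x)%:C); last by rewrite rmorphB; ring.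
rewrite Normc.normcM normc_real; apply: (@le_lt_trans _ _ ((N q + 1) * `|y - x|)).
  apply: ler_wpM2r; [exact: normr_ge0|by rewrite lerDl].
rewrite mulrC -ltr_pdivlMr// distrC; near: y.
apply: nbhsx_ballx; rewrite divr_gt0//.
Unshelve. all: by end_near. Qed.

Lemma pcont_onB a b f g : pcont_on a b f -> pcont_on a b g ->
  pcont_on a b (fun t => f t - g t).
Proof. by move=> hf hg x xab; apply: cvgcB; [exact: hf|exact: hg]. Qed.

Definition cint a b f : C :=
  (Rintegral mu `[a, b]%classic (fun t => complex.Re (f t))) +i*
  (Rintegral mu `[a, b]%classic (fun t => complex.Im (f t))).

Lemma pcont_on_integrable a b f : pcont_on a b f ->
  mu.-integrable `[a, b]%classic (EFin \o (fun t => complex.Re (f t))) /\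
  mu.-integrable `[a, b]%classic (EFin \o (fun t => complex.Im (f t))).
Proof.
move=> hf; split; apply: continuous_compact_integrable;
  try exact: segment_compact;
  apply: continuous_in_subspaceT => x; rewrite inE/= in_itv/= => /hf[hr hi] //.
Qed.

Lemma cintD a b f g : pcont_on a b f -> pcont_on a b g ->
  cint a b (fun t => f t + g t) = cint a b f + cint a b g.
Proof.
move=> /pcont_on_integrable[fr fi] /pcont_on_integrable[gr gi].
apply: complex_eqP; rewrite ?ReD ?ImD /cint /=.
- by rewrite -RintegralD//; apply: eq_Rintegral => x _; rewrite ReD.
- by rewrite -RintegralD//; apply: eq_Rintegral => x _; rewrite ImD.
Qed.

Lemma cintZ a b k f : pcont_on a b f ->
  cint a b (fun t => k * f t) = k * cint a b f.
Proof.
move=> /pcont_on_integrable[fr fi].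
have Z (r : R) (h : R -> R) : mu.-integrable `[a, b]%classic (EFin \o h) ->
    mu.-integrable `[a, b]%classic (EFin \o (fun t => r * h t)).
  by move=> hh; exact: (@integrableZl _ _ _ mu `[a, b]%classic (measurable_itv _) r _ hh).
have RZ (r : R) (h : R -> R) : mu.-integrable `[a, b]%classic (EFin \o h) ->
    r * Rintegral mu `[a, b]%classic h = Rintegral mu `[a, b]%classic (fun t => r * h t).
  by move=> hh; rewrite (@RintegralZl _ _ _ mu `[a, b]%classic h r (measurable_itv _) hh).
apply: complex_eqP.
- rewrite ReM /cint /= !RZ// -RintegralB//; [|exact: Z..].
  by apply: eq_Rintegral => x _; rewrite ReM.
- rewrite ImM /cint /= !RZ// -RintegralD//; [|exact: Z..].
  by apply: eq_Rintegral => x _; rewrite ImM.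
Qed.

Lemma eq_cint a b f g : (forall x, a <= x <= b -> f x = g x) ->
  cint a b f = cint a b g.
Proof.
move=> fg; apply: complex_eqP; rewrite /cint /=;
  by apply: eq_Rintegral => x; rewrite inE/= in_itv/= => /fg ->.
Qed.

Lemma Rint_cst a b (k : R) : a <= b ->
  Rintegral mu `[a, b]%classic (fun=> k) = k * (b - a).
Proof.
move=> ab; have e : fine (mu `[a, b]%classic) = b - a.
  rewrite [mu _](lebesgue_measure_itv `[a, b])/= lte_fin.
  by case: ltgtP ab => //= [-> _]; rewrite subrr.
by rewrite (@Rintegral_cst _ _ _ mu _ (measurable_itv _)) e.
Qed.

Lemma cint_cst a b k : a <= b -> cint a b (fun=> k) = k * (b - a)%:C.
Proof.
move=> ab; apply: complex_eqP; rewrite /cint/= Rint_cst//.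
- by rewrite ReM /= mulr0 subr0.
- by rewrite ImM /= mulr0 add0r.
Qed.

(** The factor 2 comes from bounding the real and imaginary parts separately; only the order of
    magnitude matters later. *)
Lemma cint_bound a b f (M : R) : a <= b -> pcont_on a b f ->
  (forall x, a <= x <= b -> N (f x) <= M) -> N (cint a b f) <= 2 * M * (b - a).
Proof.
move=> ab /pcont_on_integrable[fr fi] hM.
apply: le_trans (normc_le_ReIm _) _.
have B (h : R -> R) : mu.-integrable `[a, b]%classic (EFin \o h) ->
    (forall x, a <= x <= b -> `|h x| <= M) ->
    `|Rintegral mu `[a, b]%classic h| <= M * (b - a).
  move=> ih hh; apply: le_trans (le_normr_Rintegral _ _) _ => //.
  rewrite -Rint_cst//; apply: le_Rintegral => //.
  - exact: (@integrable_norm _ _ _ mu _ h).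
  - have /pcont_on_integrable[] : pcont_on a b (fun=> M%:C).
      by move=> x _; exact: cvgc_cst.
    by [].
rewrite (_ : 2 * M * (b - a) = M * (b - a) + M * (b - a)); last by ring.
apply: lerD; apply: B => // x /hM; apply: le_trans.
- exact: normc_ge_Re.
- exact: normc_ge_Im.
Qed.

Lemma cint_split a b c f : a <= c -> c <= b -> pcont_on a b f ->
  cint a b f = cint a c f + cint c b f.
Proof.
move=> ac cb hf; have [fr fi] := pcont_on_integrable hf.
have S (h : R -> R) : mu.-integrable `[a, b]%classic (EFin \o h) ->
    Rintegral mu `[a, b]%classic h =
    Rintegral mu `[a, c]%classic h + Rintegral mu `[c, b]%classic h.
  move=> ih; have := @Rintegral_itvB _ h (BLeft a) (BRight b) c ih.
  rewrite !bnd_simp => /(_ ac cb) e.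
  rewrite -(@Rintegral_itv_obnd_cbnd _ c (BRight b)) -?e; first by ring.
  apply: integrableS ih => //; apply: subset_itvr; rewrite bnd_simp //.
by apply: complex_eqP; rewrite ?ReD ?ImD /cint/= S.
Qed.

End complex_integral.

(** * Goursat's theorem *)

Section rectangle_integral.
Variable R : realType.
Local Notation C := R[i].
Local Notation N := (@Normc.normc R).
Implicit Types (f g : C -> C) (z w : C).

(** The counterclockwise boundary integral: bottom minus top, plus ['i] times right minus left. *)
Definition rint (x0 x1 y0 y1 : R) f : C :=
  cint x0 x1 (fun t => f (t +i* y0) - f (t +i* y1)) +
  'i * cint y0 y1 (fun t => f (x1 +i* t) - f (x0 +i* t)).

Definition inrect (x0 x1 y0 y1 : R) w :=
  x0 <= complex.Re w <= x1 /\ y0 <= complex.Im w <= y1.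

Definition onrect (x0 x1 y0 y1 : R) w := inrect x0 x1 y0 y1 w /\
  [\/ complex.Re w = x0, complex.Re w = x1, complex.Im w = y0 | complex.Im w = y1].

Definition bcont (x0 x1 y0 y1 : R) f := forall w, onrect x0 x1 y0 y1 w -> ccont f w.

Lemma onrect_sides (x0 x1 y0 y1 : R) : x0 <= x1 -> y0 <= y1 ->
  (forall t, x0 <= t <= x1 -> onrect x0 x1 y0 y1 (t +i* y0) /\
                              onrect x0 x1 y0 y1 (t +i* y1)) /\
  (forall t, y0 <= t <= y1 -> onrect x0 x1 y0 y1 (x0 +i* t) /\
                              onrect x0 x1 y0 y1 (x1 +i* t)).
Proof.
move=> hx hy; split=> t ht; split; split; rewrite /inrect /= ?ht ?lexx ?hx ?hy//.
- by constructor 3.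
- by constructor 4.
- by constructor 1.
- by constructor 2.
Qed.

Lemma pcont_h f (x y : R) : ccont f (x +i* y) -> pcont (fun t => f (t +i* y)) x.
Proof.
have e (t : R) : t +i* y = (0 +i* y) + 1 * t%:C.
  by apply: complex_eqP => /=; ring.
rewrite e => /pcont_path; congr (pcont _ _).
by apply/funext => t; rewrite -e.
Qed.

Lemma pcont_v f (x y : R) : ccont f (x +i* y) -> pcont (fun t => f (x +i* t)) y.
Proof.
have e (t : R) : x +i* t = (x +i* 0) + 'i * t%:C.
  by apply: complex_eqP => /=; ring.
rewrite e => /pcont_path; congr (pcont _ _).
by apply/funext => t; rewrite -e.
Qed.

Lemma bcont_sides x0 x1 y0 y1 f : x0 <= x1 -> y0 <= y1 -> bcont x0 x1 y0 y1 f ->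
  [/\ pcont_on x0 x1 (fun t => f (t +i* y0)),
      pcont_on x0 x1 (fun t => f (t +i* y1)),
      pcont_on y0 y1 (fun t => f (x0 +i* t)) &
      pcont_on y0 y1 (fun t => f (x1 +i* t))].
Proof.
move=> hx hy hf; have [h v] := onrect_sides hx hy.
by split=> t ht; (apply: pcont_h || apply: pcont_v); apply: hf;
  by [case: (h t ht)|case: (v t ht)].
Qed.

Lemma eq_rint x0 x1 y0 y1 f g : x0 <= x1 -> y0 <= y1 ->
  (forall w, onrect x0 x1 y0 y1 w -> f w = g w) ->
  rint x0 x1 y0 y1 f = rint x0 x1 y0 y1 g.
Proof.
move=> hx hy fg; have [h v] := onrect_sides hx hy.
congr (_ + _ * _); apply: eq_cint => t ht; congr (_ - _); apply: fg;
  by [case: (h t ht)|case: (v t ht)].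
Qed.

Section fixed.
Variables x0 x1 y0 y1 : R.
Hypotheses (hx : x0 <= x1) (hy : y0 <= y1).
Local Notation bc := (bcont x0 x1 y0 y1).
Local Notation I := (rint x0 x1 y0 y1).

Lemma rintD f g : bc f -> bc g -> I (fun w => f w + g w) = I f + I g.
Proof.
move=> /(bcont_sides hx hy)[f1 f2 f3 f4] /(bcont_sides hx hy)[g1 g2 g3 g4].
transitivity (cint x0 x1 (fun t => (f (t +i* y0) - f (t +i* y1)) +
    (g (t +i* y0) - g (t +i* y1))) + 'i * cint y0 y1 (fun t =>
    (f (x1 +i* t) - f (x0 +i* t)) + (g (x1 +i* t) - g (x0 +i* t)))).
  by congr (_ + _ * _); apply: eq_cint => t _; ring.
by rewrite (cintD (pcont_onB f1 f2) (pcont_onB g1 g2))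
  (cintD (pcont_onB f4 f3) (pcont_onB g4 g3)) /rint; ring.
Qed.

Lemma rintZ k f : bc f -> I (fun w => k * f w) = k * I f.
Proof.
move=> /(bcont_sides hx hy)[f1 f2 f3 f4].
transitivity (cint x0 x1 (fun t => k * (f (t +i* y0) - f (t +i* y1))) +
    'i * cint y0 y1 (fun t => k * (f (x1 +i* t) - f (x0 +i* t)))).
  by congr (_ + _ * _); apply: eq_cint => t _; ring.
by rewrite (cintZ k (pcont_onB f1 f2)) (cintZ k (pcont_onB f4 f3)) /rint; ring.
Qed.

Lemma rintB f g : bc f -> bc g -> I (fun w => f w - g w) = I f - I g.
Proof.
move=> hf hg; rewrite -mulN1r -rintZ// -rintD//.
  by apply: eq_rint => // w _; rewrite mulN1r.
by move=> w hw; apply: ccontM; [exact: ccont_cst|exact: hg].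
Qed.

Lemma rint_sum (J : eqType) (s : seq J) (F : J -> C -> C) :
  (forall j, bc (F j)) -> I (fun w => \sum_(j <- s) F j w) = \sum_(j <- s) I (F j).
Proof.
move=> hF; elim: s => [|j s IH].
  rewrite big_nil (@eq_rint _ _ _ _ _ (fun=> 0 * 0))//; last first.
    by move=> w _; rewrite big_nil mul0r.
  by rewrite (rintZ 0 (f := fun=> 0)) ?mul0r// => w _; exact: ccont_cst.
rewrite big_cons -IH -rintD//; last first.
  by move=> w wb; apply: cvgc_sum => k; exact: hF.
by apply: eq_rint => // w _; rewrite big_cons.
Qed.

Lemma rint_affine k l : I (fun w => k + l * w) = 0.
Proof.
rewrite /rint.
rewrite (@eq_cint _ x0 x1 _ (fun=> l * (0 +i* (y0 - y1)))); last first.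
  by move=> t _; apply: complex_eqP => /=; case: k l => [? ?] [? ?] /=; ring.
rewrite (@eq_cint _ y0 y1 _ (fun=> l * (x1 - x0)%:C)); last first.
  by move=> t _; apply: complex_eqP => /=; case: k l => [? ?] [? ?] /=; ring.
rewrite !cint_cst//; case: l => a b.
by apply: complex_eqP => /=; ring.
Qed.

Lemma rint_bound f (M : R) : bc f ->
  (forall w, onrect x0 x1 y0 y1 w -> N (f w) <= M) ->
  N (I f) <= 4 * M * ((x1 - x0) + (y1 - y0)).
Proof.
move=> /(bcont_sides hx hy)[f1 f2 f3 f4] hM; have [h v] := onrect_sides hx hy.
have h1 : N (cint x0 x1 (fun t => f (t +i* y0) - f (t +i* y1))) <=
    2 * (M + M) * (x1 - x0).
  apply: cint_bound => //; first exact: pcont_onB.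
  move=> t ht; apply: le_trans (ler_normcB _ _) _.
  by apply: lerD; apply: hM; case: (h t ht).
have h2 : N (cint y0 y1 (fun t => f (x1 +i* t) - f (x0 +i* t))) <=
    2 * (M + M) * (y1 - y0).
  apply: cint_bound => //; first exact: pcont_onB.
  move=> t ht; apply: le_trans (ler_normcB _ _) _.
  by apply: lerD; apply: hM; case: (v t ht).
apply: le_trans (le_normcD _ _) _; rewrite Normc.normcM normc_i mul1r.
by apply: le_trans (lerD h1 h2) _; lra.
Qed.

End fixed.

Lemma bcont_in x0 x1 y0 y1 a b c d f : x0 <= a -> b <= x1 -> y0 <= c -> d <= y1 ->
  (forall w, inrect x0 x1 y0 y1 w -> ccont f w) -> bcont a b c d f.
Proof.
move=> h1 h2 h3 h4 hf w [[/andP[a1 a2] /andP[a3 a4]] _]; apply: hf.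
by split; apply/andP; split; lra.
Qed.

Lemma rint_splitv x0 xm x1 y0 y1 f : x0 <= xm -> xm <= x1 -> y0 <= y1 ->
  bcont x0 x1 y0 y1 f -> pcont_on y0 y1 (fun t => f (xm +i* t)) ->
  rint x0 x1 y0 y1 f = rint x0 xm y0 y1 f + rint xm x1 y0 y1 f.
Proof.
move=> h1 h2 hy /(bcont_sides (le_trans h1 h2) hy)[f1 f2 f3 f4] fm.
transitivity (cint x0 x1 (fun t => f (t +i* y0) - f (t +i* y1)) +
    'i * cint y0 y1 (fun t => (f (xm +i* t) - f (x0 +i* t)) +
                              (f (x1 +i* t) - f (xm +i* t)))).
  by congr (_ + _ * _); apply: eq_cint => t _; ring.
rewrite (cint_split h1 h2); last exact: pcont_onB.
by rewrite (cintD (pcont_onB fm f3) (pcont_onB f4 fm)) /rint; ring.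
Qed.

Lemma rint_splith x0 x1 y0 ym y1 f : x0 <= x1 -> y0 <= ym -> ym <= y1 ->
  bcont x0 x1 y0 y1 f -> pcont_on x0 x1 (fun t => f (t +i* ym)) ->
  rint x0 x1 y0 y1 f = rint x0 x1 y0 ym f + rint x0 x1 ym y1 f.
Proof.
move=> hx h1 h2 /(bcont_sides hx (le_trans h1 h2))[f1 f2 f3 f4] fm.
transitivity (cint x0 x1 (fun t => (f (t +i* y0) - f (t +i* ym)) +
                                  (f (t +i* ym) - f (t +i* y1))) +
    'i * cint y0 y1 (fun t => f (x1 +i* t) - f (x0 +i* t))).
  by congr (_ + _ * _); apply: eq_cint => t _; ring.
rewrite (cint_split h1 h2); last exact: pcont_onB.
by rewrite (cintD (pcont_onB f1 fm) (pcont_onB fm f2)) /rint; ring.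
Qed.

(** Meant for the corners of successively bisected rectangles: the moves telescope, so [u m] stays
    in [[u n, u n + a / 2 ^ n]] for [m >= n], and so does a limit along an ultrafilter. *)
Lemma dyadic_limit (u : nat -> R) (a : R) : 0 <= a ->
  (forall n, u n <= u n.+1 <= u n + a * 2^-1 ^+ n.+1) ->
  exists l, forall n, u n <= l <= u n + a * 2^-1 ^+ n.
Proof.
move=> a0 hu.
have H n m : (n <= m)%N -> u n <= u m <= u n + a * (2^-1 ^+ n - 2^-1 ^+ m).
  elim: m => [|m IH]; first by rewrite leqn0 => /eqP ->; rewrite lexx subrr mulr0 addr0 lexx.
  rewrite leq_eqVlt => /predU1P[->|]; first by rewrite lexx subrr mulr0 addr0 lexx.
  rewrite ltnS => /IH /andP[h1 h2]; have /andP[h3 h4] := hu m.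
  rewrite (le_trans h1 h3)/=; apply: le_trans h4 _.
  by apply: le_trans (lerD h2 (lexx _)) _; rewrite exprS; lra.
have [U [UU FU]] := @ultraFilterLemma _ \oo (eventually_filter).
have p n : 0 <= a * 2^-1 ^+ n by rewrite mulr_ge0// exprn_ge0.
have H' n : U [set m | u n <= u m <= u n + a * 2^-1 ^+ n].
  apply: FU; exists n => // m /= /H/andP[-> h]; apply: le_trans h _.
  by have := p m; lra.
have [l hl] : exists l : R, u @ U --> l.
  apply: (@ultra_cvg _ _ _ _ (`|u 0%N| + a)); apply: filterS (H' 0%N) => m /=.
  rewrite expr0 mulr1 => /andP[h1 h2]; rewrite ler_norml; apply/andP; split.
    by have := ler_norm (- u 0%N); rewrite normrN; lra.
  by have := ler_norm (u 0%N); lra.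
exists l => n; apply/andP; split.
- by apply: (cvgr_to_ge hl); apply: filterS (H' n) => m /= /andP[].
- by apply: (cvgr_to_le hl); apply: filterS (H' n) => m /= /andP[].
Qed.

Lemma normc_sum4_lt (z1 z2 z3 z4 : C) (a : R) :
  N z1 < a -> N z2 < a -> N z3 < a -> N z4 < a ->
  N ((z1 + z2) + (z3 + z4)) < 4 * a.
Proof.
move=> h1 h2 h3 h4; have t := le_normcD (z1 + z2) (z3 + z4).
by have t1 := le_normcD z1 z2; have t2 := le_normcD z3 z4; lra.
Qed.

(** Bisection: one of the four quarters carries at least a quarter of the integral, so the [n]-th
    rectangle carries at least [E / 4 ^ n]. At the common point [c] the affine part of [f]
    integrates to 0, and the remainder contributes at most a small multiple of the squared size,
    which is also of order [1 / 4 ^ n]. *)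
Lemma goursat x0 x1 y0 y1 f : x0 <= x1 -> y0 <= y1 ->
  (forall w, inrect x0 x1 y0 y1 w -> cdiff f w) -> rint x0 x1 y0 y1 f = 0.
Proof.
move=> hx hy hf; have hc w : inrect x0 x1 y0 y1 w -> ccont f w.
  by move/hf; exact: cdiff_cont.
set a := x1 - x0; set b := y1 - y0.
have a0 : 0 <= a by rewrite subr_ge0.
have b0 : 0 <= b by rewrite subr_ge0.
pose s n : R := 2^-1 ^+ n.
have s0 n : 0 <= s n by rewrite exprn_ge0.
have sS n : s n.+1 = s n / 2 by rewrite /s exprS mulrC.
set E := N (rint x0 x1 y0 y1 f).
(* A state is the lower left corner with the generation [n]; the sides are [a / 2 ^ n] and
   [b / 2 ^ n]. *)
pose P (p : (R * R) * nat) := let: ((x, y), n) := p in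
  [/\ x0 <= x, x + a * s n <= x1, y0 <= y, y + b * s n <= y1 &
   E * 4^-1 ^+ n <= N (rint x (x + a * s n) y (y + b * s n) f)].
(* The invariant stands as a premise inside the sigma type because dependent choice needs a step
   defined on all states. *)
have step (p : (R * R) * nat) : {q : (R * R) * nat | P p ->
    [/\ P q, q.2 = p.2.+1, p.1.1 <= q.1.1 <= p.1.1 + a * s p.2.+1 &
     p.1.2 <= q.1.2 <= p.1.2 + b * s p.2.+1]}.
  apply: cid; case: p => [[x y] n] /=.
  have [Pp|] := pselect (P ((x, y), n)); last by exists ((x, y), n).
  have [p1 p2 p3 p4 p5] := Pp.
  pose c := a * s n.+1; pose d := b * s n.+1.
  have c0 : 0 <= c by rewrite mulr_ge0.
  have d0 : 0 <= d by rewrite mulr_ge0.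
  have ec : a * s n = c + c by rewrite /c sS; lra.
  have ed : b * s n = d + d by rewrite /d sS; lra.
  have key : exists x' y', [/\ x' = x \/ x' = x + c, y' = y \/ y' = y + d &
      E * 4^-1 ^+ n.+1 <= N (rint x' (x' + c) y' (y' + d) f)].
    apply: contrapT => h.
    have h' x' y' : x' = x \/ x' = x + c -> y' = y \/ y' = y + d ->
        N (rint x' (x' + c) y' (y' + d) f) < E * 4^-1 ^+ n.+1.
      move=> hx' hy'; rewrite ltNge; apply/negP => hE; apply: h.
      by exists x', y'.
    have fin x' y' : x <= x' <= x + a * s n -> y <= y' <= y + b * s n ->
        ccont f (x' +i* y').
      move=> /andP[q1 q2] /andP[q3 q4]; apply: hc.
      by split => /=; apply/andP; split; lra.
    move: p5; rewrite (@rint_splitv x (x + c)); first last.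
    - by move=> t ht; apply: pcont_v; apply: fin => //; apply/andP; split; lra.
    - by apply: (@bcont_in x0 x1 y0 y1) => //.
    - by lra.
    - by lra.
    - by lra.
    rewrite (@rint_splith x (x + c) y (y + d)); first last.
    - by move=> t /andP[t1 t2]; apply: pcont_h; apply: fin => //; apply/andP; split; lra.
    - by apply: (@bcont_in x0 x1 y0 y1) => //; lra.
    - by lra.
    - by lra.
    - by lra.
    rewrite (@rint_splith (x + c) (x + a * s n) y (y + d)); first last.
    - by move=> t /andP[t1 t2]; apply: pcont_h; apply: fin => //; apply/andP; split; lra.
    - by apply: (@bcont_in x0 x1 y0 y1) => //; lra.
    - by lra.
    - by lra.
    - by lra.
    have eE : E * 4^-1 ^+ n = 4 * (E * 4^-1 ^+ n.+1) by rewrite exprS; lra.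
    rewrite ec ed (addrA x) (addrA y) eE; apply/negP; rewrite -ltNge.
    by apply: normc_sum4_lt; apply: h'; by [left|right].
  have [x' [y' [hx' hy' hE]]] := key; exists ((x', y'), n.+1) => _ /=.
  have cc : a * s n.+1 = c by [].
  have dd : b * s n.+1 = d by [].
  have [hx1 hx2] : x <= x' /\ x' <= x + c by case: hx' => ->; split; lra.
  have [hy1 hy2] : y <= y' /\ y' <= y + d by case: hy' => ->; split; lra.
  rewrite cc dd hx1 hx2 hy1 hy2; split=> //; rewrite /P ?cc ?dd.
  by rewrite ec in p2; rewrite ed in p4; split=> //; lra.
have [q [q0 qS]] := dependent_choice step ((x0, y0), 0%N).
have Pq n : P (q n) /\ (q n).2 = n.
  elim: n => [|n [Pn en]].
    rewrite q0; split=> //; rewrite /P /s !expr0 !mulr1 /a /b.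
    by split; rewrite // ?[_ + (_ - _)]addrC ?subrK.
  by have [h1 h2 _ _] := qS n Pn; rewrite h2 en.
have [cx hcx] : exists l, forall n, (q n).1.1 <= l <= (q n).1.1 + a * s n.
  apply: dyadic_limit => // n; have [Pn en] := Pq n.
  by have [_ _ + _] := qS n Pn; rewrite en.
have [cy hcy] : exists l, forall n, (q n).1.2 <= l <= (q n).1.2 + b * s n.
  apply: dyadic_limit => // n; have [Pn en] := Pq n.
  by have [_ _ _ +] := qS n Pn; rewrite en.
set c := cx +i* cy.
have inc : inrect x0 x1 y0 y1 c.
  have [Pn en] := Pq 0%N; move: Pn (hcx 0%N) (hcy 0%N).
  case: (q 0%N) en => [[x y] n] /= -> [? ? ? ? _] /andP[? ?] /andP[? ?].
  by split; apply/andP; split => /=; lra.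
have [d hd] := hf c inc.
suff : E <= 0 by rewrite le_eqVlt ltNge normc_ge0 orbF normc_eq0 => /eqP.
apply/ler_addgt0Pl => e e0; rewrite addr0.
set L := a + b.
have L0 : 0 <= L by rewrite addr_ge0.
(* [rint_bound] turns a derivative error [x] into [4 * x * L ^+ 2 / 4 ^ n]; the added 1 covers
   [L = 0]. *)
have e1 : 0 < e / (4 * L ^+ 2 + 1).
  by rewrite divr_gt0// ltr_wpDl// mulr_ge0// sqr_ge0.
have [r r0 hr] := hd _ e1.
have [n hn] : exists n, L * s n < r.
  have : (fun n => L * s n) @ \oo --> (L * 0 : R).
    by apply: cvgM; [exact: cvg_cst|apply: cvg_expr; rewrite ger0_norm//; lra].
  rewrite mulr0 => /cvgrPdist_lt /(_ _ r0)[n _ /(_ n (leqnn n))/=].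
  by rewrite sub0r normrN => h; exists n; apply: le_lt_trans h; exact: ler_norm.
have [Pn en] := Pq n; move: Pn (hcx n) (hcy n).
case: (q n) en => [[x y] m] /= -> [p1 p2 p3 p4 p5] /andP[p6 p7] /andP[p8 p9].
have as0 : 0 <= a * s n by rewrite mulr_ge0.
have bs0 : 0 <= b * s n by rewrite mulr_ge0.
have hx' : x <= x + a * s n by lra.
have hy' : y <= y + b * s n by lra.
have fb : bcont x (x + a * s n) y (y + b * s n) f.
  by apply: (@bcont_in x0 x1 y0 y1).
have ab : bcont x (x + a * s n) y (y + b * s n) (fun w => (f c - d * c) + d * w).
  move=> w _; apply: ccontD; first exact: ccont_cst.
  by apply: ccontM; [exact: ccont_cst|exact: ccont_id].
have eI : rint x (x + a * s n) y (y + b * s n) f =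
    rint x (x + a * s n) y (y + b * s n) (fun w => f w - ((f c - d * c) + d * w)).
  by rewrite rintB// rint_affine// subr0.
have dist w : inrect x (x + a * s n) y (y + b * s n) w -> N (w - c) <= L * s n.
  move=> [/andP[w1 w2] /andP[w3 w4]]; apply: le_trans (normc_le_ReIm _) _.
  rewrite ReD ImD ReN ImN /L mulrDl; apply: lerD; rewrite ler_norml /=.
    by apply/andP; split; lra.
  by apply/andP; split; lra.
have bound : N (rint x (x + a * s n) y (y + b * s n) f) <=
    4 * (e / (4 * L ^+ 2 + 1) * (L * s n)) * (L * s n).
  rewrite eI; apply: le_trans (rint_bound _ _ _ _) _ => //.
  - by move=> w hw; apply: ccontB; [exact: fb|exact: ab].
  - move=> w [hw _]; have h := dist _ hw.
    have := hr (w - c) (le_lt_trans h hn); rewrite [c + _]addrC subrK => h'.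
    rewrite (_ : _ - _ = f w - f c - d * (w - c)); last by ring.
    by apply: le_trans h' _; apply: ler_wpM2l; [exact: ltW|exact: h].
  - by rewrite /L; lra.
have ss : s n * s n = 4^-1 ^+ n.
  by rewrite /s -exprMn -invfM; congr (_^-1 ^+ _); ring.
have p4n : 0 < (4^-1 : R) ^+ n by rewrite exprn_gt0.
have := le_trans p5 bound.
rewrite (_ : 4 * _ * _ = (e / (4 * L ^+ 2 + 1) * (4 * L ^+ 2)) * 4^-1 ^+ n); last first.
  by rewrite -ss; ring.
rewrite ler_pM2r// => h; apply: le_trans h _.
rewrite mulrAC ler_pdivrMr; last by rewrite ltr_wpDl// mulr_ge0// sqr_ge0.
by rewrite ler_pM2l//; lra.
Qed.

End rectangle_integral.

(** * Cauchy's formula and Taylor expansions *)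

Section cauchy.
Variable R : realType.
Local Notation C := R[i].
Local Notation N := (@Normc.normc R).
Local Notation mu := (@lebesgue_measure R).
Implicit Types (f g : C -> C) (z w : C).

(** The region between the rectangles is cut into four rectangles, left, right, below and above the
    inner one, and Goursat's theorem applies to each. *)
Lemma rint_shrink (x0 x1 y0 y1 a b c d : R) g :
  x0 <= a -> a <= b -> b <= x1 -> y0 <= c -> c <= d -> d <= y1 ->
  (forall w, inrect x0 x1 y0 y1 w ->
     ~~ [&& a < complex.Re w, complex.Re w < b,
            c < complex.Im w & complex.Im w < d] -> cdiff g w) ->
  rint x0 x1 y0 y1 g = rint a b c d g.
Proof.
move=> xa ab bx yc cd dy hg.
have hc w : inrect x0 x1 y0 y1 w ->
     [\/ complex.Re w <= a, b <= complex.Re w,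
         complex.Im w <= c | d <= complex.Im w] -> cdiff g w.
  move=> hw h; apply: hg => //; apply/negP => /and4P[p1 p2 p3 p4].
  by case: h => h; [move: p1|move: p2|move: p3|move: p4]; rewrite ltNge h.
have ax1 := le_trans ab bx; have x0b := le_trans xa ab.
have cy1 := le_trans cd dy; have y0d := le_trans yc cd.
have x01 := le_trans xa ax1; have y01 := le_trans yc cy1.
have V x : x0 <= x -> x <= x1 -> x <= a \/ b <= x -> forall e1 e2, y0 <= e1 -> e2 <= y1 ->
    pcont_on e1 e2 (fun t => g (x +i* t)).
  move=> h1 h2 h e1 e2 he1 he2 t /andP[t1 t2].
  apply/pcont_v/cdiff_cont/hc.
    by split => /=; rewrite ?h1 ?h2 ?(le_trans he1 t1) ?(le_trans t2 he2).
  by case: h; [constructor 1|constructor 2].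
have H y : y0 <= y -> y <= y1 -> y <= c \/ d <= y -> forall e1 e2, x0 <= e1 -> e2 <= x1 ->
    pcont_on e1 e2 (fun t => g (t +i* y)).
  move=> h1 h2 h e1 e2 he1 he2 t /andP[t1 t2].
  apply/pcont_h/cdiff_cont/hc.
    by split => /=; rewrite ?h1 ?h2 ?(le_trans he1 t1) ?(le_trans t2 he2).
  by case: h; [constructor 3|constructor 4].
have B e1 e2 e3 e4 : x0 <= e1 -> e2 <= x1 -> y0 <= e3 -> e4 <= y1 ->
    e1 <= a \/ b <= e1 -> e2 <= a \/ b <= e2 -> e3 <= c \/ d <= e3 ->
    e4 <= c \/ d <= e4 -> bcont e1 e2 e3 e4 g.
  move=> h1 h2 h3 h4 k1 k2 k3 k4 w [[/andP[w1 w2] /andP[w3 w4]] hw].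
  apply/cdiff_cont/hc.
    by split; rewrite ?(le_trans h1 w1) ?(le_trans h3 w3) ?(le_trans w2 h2) ?(le_trans w4 h4).
  case: hw => ->; [case: k1|case: k2|case: k3|case: k4];
    by [constructor 1|constructor 2|constructor 3|constructor 4].
have G e1 e2 e3 e4 : x0 <= e1 -> e1 <= e2 -> e2 <= x1 -> y0 <= e3 -> e3 <= e4 -> e4 <= y1 ->
    [\/ e2 <= a, b <= e1, e4 <= c | d <= e3] -> rint e1 e2 e3 e4 g = 0.
  move=> h1 h12 h2 h3 h34 h4 h; apply: goursat => // w [/andP[w1 w2] /andP[w3 w4]].
  apply: hc.
    by split; rewrite ?(le_trans h1 w1) ?(le_trans h3 w3) ?(le_trans w2 h2) ?(le_trans w4 h4).
  case: h => h; [constructor 1|constructor 2|constructor 3|constructor 4];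
    by [exact: le_trans w2 h|exact: le_trans h w1|exact: le_trans w4 h|exact: le_trans h w3].
have L : forall (P : Prop), P -> P \/ False by left.
rewrite (@rint_splitv _ x0 a) //; last 2 first.
- by apply: B => //; auto.
- by apply: V => //; auto.
rewrite G//; last by constructor 1.
rewrite add0r (@rint_splitv _ a b) //; last 2 first.
- by apply: B => //; auto.
- by apply: V => //; auto.
rewrite (G b)//; last by constructor 2.
rewrite addr0 (@rint_splith _ a b y0 c) //; last 2 first.
- by apply: B => //; auto.
- by apply: H => //; auto.
rewrite (G a b y0 c)//; last by constructor 3.
rewrite add0r (@rint_splith _ a b c d) //; last 2 first.
- by apply: B => //; auto.
- by apply: H => //; auto.
by rewrite (G a b d)// ?addr0//; constructor 4.
Qed.

Lemma cint_poisson (c d : R) : 0 < d ->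
  cint (c - d) (c + d) (fun t => (d / ((t - c) ^+ 2 + d ^+ 2))%:C) = (pi / 2)%:C.
Proof.
move=> d0; have dn0 : d != 0 by rewrite gt_eqF.
pose h (t : R) := d / ((t - c) ^+ 2 + d ^+ 2).
pose F (t : R) := atan ((t - c) / d).
have den t : 0 < (t - c) ^+ 2 + d ^+ 2 by rewrite ltr_wpDl ?sqr_ge0// exprn_gt0.
have dF (t : R) : is_derive t 1 F (h t).
  rewrite (_ : F = atan \o (fun u => (u - c) * d^-1)) //.
  have d1 : is_derive t 1 (fun u : R => (u - c) * d^-1) d^-1.
    by apply: trigger_derive; rewrite /GRing.scale /=; ring.
  apply: trigger_derive; rewrite /GRing.scale /= /h.
  have := den t; have : 1 + ((t - c) * d^-1) ^+ 2 = ((t - c) ^+ 2 + d ^+ 2) / d ^+ 2 by field.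
  by move=> -> n; field; rewrite dn0 gt_eqF.
apply: complex_eqP; rewrite /cint /=; last first.
  by rewrite Rint_cst ?mul0r//; lra.
rewrite -/h.
have cF : continuous F.
  by move=> t; apply: differentiable_continuous; apply/derivable1_diffP; have := dF t; case.
have ch : {within `[c - d, c + d], continuous h}.
  apply: continuous_subspaceT => t; apply: cvgM; first exact: cvg_cst.
  apply: cvgV; first by rewrite gt_eqF.
  apply: cvgD; last exact: cvg_cst.
  have c1 : (fun u : R => u - c) @ t --> t - c.
    by apply: cvgB; [exact: cvg_id|exact: cvg_cst].
  exact: (cvgM c1 c1).
have F1 : F (c + d) = pi / 4.
  by rewrite /F addrAC subrr add0r divff// atan1.
have F2 : F (c - d) = - (pi / 4).
  by rewrite /F addrAC subrr add0r mulNr divff// atanN atan1.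
have lt : c - d < c + d by lra.
rewrite /Rintegral (@continuous_FTC2 _ h F) //=.
- by rewrite F1 F2; lra.
- split; first by move=> t _; have := dF t; case.
  + by apply: cvg_at_right_filter; exact: cF.
  + by apply: cvg_at_left_filter; exact: cF.
- by move=> t _; rewrite derive1E; apply: derive_val.
Qed.

(** Opposite sides are paired by [A^-1 - B^-1 = (B - A) / (A * B)], where [A * B] is real on a
    square centred at [c]. Each pair becomes a multiple of the kernel of [cint_poisson], whose
    primitive is an arctangent; horizontal and vertical sides contribute [pi * 'i] each. *)
Lemma rint_kernel (c : C) (d : R) : 0 < d ->
  let x := complex.Re c in let y := complex.Im c in
  rint (x - d) (x + d) (y - d) (y + d) (fun w => (w - c)^-1) = (2 * pi)%:C * 'i.
Proof.
move=> d0 x y; have dn0 : d != 0 by rewrite gt_eqF.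
have den (t e : R) : (t - e) ^+ 2 + d ^+ 2 != 0.
  by rewrite gt_eqF// ltr_wpDl ?sqr_ge0// exprn_gt0.
have pc (e : R) : pcont_on (e - d) (e + d) (fun t => (d / ((t - e) ^+ 2 + d ^+ 2))%:C).
  move=> t _; apply: cvgc_real; apply: cvgM; first exact: cvg_cst.
  apply: cvgV => //; apply: cvgD; last exact: cvg_cst.
  have c1 : (fun u : R => u - e) @ t --> t - e.
    by apply: cvgB; [exact: cvg_id|exact: cvg_cst].
  exact: (cvgM c1 c1).
have ec : c = x +i* y by rewrite /x /y; case: (c).
have inv_sub (A B D : C) (n : R) : n != 0 -> A * B = n%:C -> B - A = D ->
    A^-1 - B^-1 = D * (n^-1)%:C.
  move=> n0 hn hD.
  have nC : n%:C != 0 :> C by rewrite (fmorph_eq0 (real_complex R)).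
  have A0 : A != 0 by apply: contraNneq nC => A0; rewrite -hn A0 mul0r.
  have B0 : B != 0 by apply: contraNneq nC => B0; rewrite -hn B0 mulr0.
  by rewrite fmorphV /= -[real_complex_def _ _]hn -hD; field; rewrite A0 B0.
rewrite /rint (@eq_cint _ _ _ _ (fun t => (2 * 'i) *
    (d / ((t - x) ^+ 2 + d ^+ 2))%:C)); last first.
  move=> t _; rewrite (@inv_sub _ _ (2 * 'i * d%:C) ((t - x) ^+ 2 + d ^+ 2)) //.
  - by rewrite rmorphM /= mulrA.
  - by rewrite ec; apply: complex_eqP => /=; ring.
  - by rewrite ec; apply: complex_eqP => /=; ring.
rewrite [X in _ + 'i * X](@eq_cint _ _ _ _ (fun t => 2 *
    (d / ((t - y) ^+ 2 + d ^+ 2))%:C)); last first.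
  move=> t _; rewrite (@inv_sub _ _ (- (2 * d%:C)) (- ((t - y) ^+ 2 + d ^+ 2))) //.
  - by rewrite invrN rmorphN mulrNN rmorphM /= mulrA.
  - by rewrite oppr_eq0.
  - by rewrite ec; apply: complex_eqP => /=; ring.
  - by rewrite ec; apply: complex_eqP => /=; ring.
rewrite !cintZ// !cint_poisson//.
have e1 : (pi / 2 : R)%:C = pi%:C * (2^-1)%:C := rmorphM _ _ _.
have e2 : (2 * pi : R)%:C = 2 * pi%:C.
  by rewrite -(rmorph_nat (real_complex R) 2) -rmorphM.
rewrite e1 e2.
have h2 : (2^-1 : R)%:C + (2^-1 : R)%:C = 1.
  by rewrite -rmorphD /= (_ : 2^-1 + 2^-1 = 1 :> R) //; lra.
rewrite (_ : _ + _ = 2 * 'i * pi%:C * ((2^-1)%:C + (2^-1)%:C)); last by ring.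
by rewrite h2; ring.
Qed.

Lemma pcont_bounded (a b : R) (f : R -> C) : a <= b -> pcont_on a b f ->
  exists2 M : R, 0 <= M & forall x, a <= x <= b -> N (f x) <= M.
Proof.
move=> ab hf; have cf : {within `[a, b], continuous (fun t => N (f t))}.
  apply: continuous_in_subspaceT => x; rewrite inE/= in_itv/= => /hf.
  exact: cvgc_norm.
have [c _ hc] := EVT_max ab cf; exists (N (f c)); first exact: normc_ge0.
move=> x hx.
by apply: hc; rewrite in_itv.
Qed.

Lemma bcont_bounded (x0 x1 y0 y1 : R) f : x0 <= x1 -> y0 <= y1 ->
  bcont x0 x1 y0 y1 f -> exists2 M : R, 0 <= M &
    forall w, onrect x0 x1 y0 y1 w -> N (f w) <= M.
Proof.
move=> hx hy /(bcont_sides hx hy)[f1 f2 f3 f4].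
have [M1 p1 h1] := pcont_bounded hx f1; have [M2 p2 h2] := pcont_bounded hx f2.
have [M3 p3 h3] := pcont_bounded hy f3; have [M4 p4 h4] := pcont_bounded hy f4.
exists (M1 + M2 + M3 + M4); first by rewrite !addr_ge0.
case=> x y [[/= hx' hy'] [] /= e]; rewrite e in hx' hy' *.
- by have := h3 _ hy'; lra.
- by have := h4 _ hy'; lra.
- by have := h1 _ hx'; lra.
- by have := h2 _ hx'; lra.
Qed.

Lemma rint_near0 f z d : cderiv f z d -> forall e : R, 0 < e ->
  exists2 r : R, 0 < r & forall s : R, 0 < s -> s < r ->
  let x := complex.Re z in let y := complex.Im z in
  bcont (x - s) (x + s) (y - s) (y + s) f ->
  N (rint (x - s) (x + s) (y - s) (y + s) (fun w => (f w - f z) / (w - z))) <= e.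
Proof.
move=> hd e e0; have [r r0 hr] := hd 1 ltr01.
have nd : 0 < N d + 1 by rewrite ltr_wpDl.
(* The constant 16 is the 4 of [rint_bound] times the half perimeter [4 * s] over [s]; the
   difference quotient is at most [N d + 1] near [z]. *)
exists (Num.min (r / 2) (e / (16 * (N d + 1)))).
  by rewrite lt_min !divr_gt0// mulr_gt0.
move=> s s0; rewrite lt_min => /andP[sr se] x y bf.
have ons w : onrect (x - s) (x + s) (y - s) (y + s) w -> 0 < N (w - z) < r.
  move=> [[/andP[w1 w2] /andP[w3 w4]] hw]; apply/andP; split.
    have := normc_ge_Re (w - z); have := normc_ge_Im (w - z).
    rewrite ReD ImD ReN ImN -/x -/y; case: hw => ->.
    - by rewrite (_ : x - s - x = - s) ?normrN ?(gtr0_norm s0) => *; lra.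
    - by rewrite (_ : x + s - x = s) ?(gtr0_norm s0) => *; lra.
    - by rewrite (_ : y - s - y = - s) ?normrN ?(gtr0_norm s0) => *; lra.
    - by rewrite (_ : y + s - y = s) ?(gtr0_norm s0) => *; lra.
  apply: le_lt_trans (normc_le_ReIm _) _; rewrite ReD ImD ReN ImN -/x -/y.
  apply: (@le_lt_trans _ _ (s + s)); last by lra.
  by apply: lerD; rewrite ler_norml; apply/andP; split; lra.
have xs : x - s <= x + s by lra.
have ys : y - s <= y + s by lra.
apply: le_trans (rint_bound (M := N d + 1) _ _ _ _) _ => //.
- move=> w hw; apply: ccontM.
    by apply: ccontB; [exact: bf|exact: ccont_cst].
  apply: ccontV; first by rewrite -normc_eq0 gt_eqF//; case/andP: (ons _ hw).
  by apply: ccontB; [exact: ccont_id|exact: ccont_cst].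
- move=> w /ons /andP[n0 nr]; rewrite normcf_div ler_pdivrMr//.
  have := hr _ nr; rewrite [z + _]addrC subrK mul1r => h.
  have := le_normcD (f w - f z - d * (w - z)) (d * (w - z)).
  by rewrite subrK Normc.normcM; lra.
- rewrite (_ : _ * (_ + _) = 16 * (N d + 1) * s); last by ring.
  by rewrite mulrC -ler_pdivlMr ?mulr_gt0// ltW.
Qed.

(** The contour is shrunk to a small square around [z], where [f w = (f w - f z) + f z]: the first
    part gives an integral as small as desired, the second is [f z] times the kernel integral. *)
Lemma cauchy_formula (s : R) f z :
  (forall w, inrect (- s) s (- s) s w -> cdiff f w) ->
  `|complex.Re z| < s -> `|complex.Im z| < s ->
  rint (- s) s (- s) s (fun w => f w / (w - z)) = (2 * pi)%:C * 'i * f z.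
Proof.
move=> hf; rewrite !ltr_norml => /andP[z1 z2] /andP[z3 z4].
set x := complex.Re z in z1 z2; set y := complex.Im z in z3 z4.
have inz : inrect (- s) s (- s) s z by split; apply/andP; split; exact: ltW.
have [d hd] := hf _ inz.
have zw w : w != z -> ccont (fun w => (w - z)^-1) w /\ cdiff (fun w => (w - z)^-1) w.
  move=> wz; have h : cdiff (fun w => (w - z)^-1) w.
    apply: cdiffV; first by rewrite subr_eq0.
    by apply: cdiffB; [exact: cdiff_id|exact: cdiff_cst].
  by split=> //; exact: cdiff_cont.
apply/eqP; rewrite -subr_eq0 -normc_eq0 -[_ == 0]negbK; apply/negP => n0.
have e0 : 0 < N (rint (- s) s (- s) s (fun w => f w / (w - z)) -
    (2 * pi)%:C * 'i * f z) / 2 by rewrite divr_gt0// lt_def n0 normc_ge0.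
have [r r0 hr] := rint_near0 hd e0.
pose t := Num.min (r / 2) (Num.min (Num.min (x + s) (s - x)) (Num.min (y + s) (s - y))).
have t0 : 0 < t by rewrite !lt_min; apply/andP; split; [lra|apply/andP; split; apply/andP; split; lra].
have [t1 t2 t3 t4 t5] : [/\ t <= r / 2, t <= x + s, t <= s - x, t <= y + s & t <= s - y].
  by split; rewrite /t !ge_min lexx ?orbT.
have tr : t < r by lra.
have inw w : inrect (x - t) (x + t) (y - t) (y + t) w -> inrect (- s) s (- s) s w.
  by move=> [/andP[w1 w2] /andP[w3 w4]]; split; apply/andP; split; lra.
have onz w : onrect (x - t) (x + t) (y - t) (y + t) w -> w != z.
  move=> [_ h]; apply/eqP => wz; move: h; rewrite wz -/x -/y.
  by case; lra.
have bf : bcont (x - t) (x + t) (y - t) (y + t) f.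
  by move=> w [hw _]; apply/cdiff_cont/hf/inw.
have bz : bcont (x - t) (x + t) (y - t) (y + t) (fun w => (w - z)^-1).
  by move=> w /onz /zw[].
have [a1 a2 a3] : [/\ - s <= x - t, x - t <= x + t & x + t <= s] by split; lra.
have [b1 b2 b3] : [/\ - s <= y - t, y - t <= y + t & y + t <= s] by split; lra.
have e : rint (- s) s (- s) s (fun w => f w / (w - z)) =
    rint (x - t) (x + t) (y - t) (y + t) (fun w => (f w - f z) / (w - z)) +
    (2 * pi)%:C * 'i * f z.
  rewrite (@rint_shrink _ _ _ _ (x - t) (x + t) (y - t) (y + t)) //; last first.
    move=> w hw nw; apply: cdiffM; first exact: hf.
    apply: (zw _ _).2; apply: contraNneq nw => ->; rewrite -/x -/y.
    by apply/and4P; split; lra.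
  rewrite -(rint_kernel z t0) -/x -/y mulrC -rintZ//.
  rewrite -rintD//.
  - by apply: eq_rint => // w /onz wz; field; rewrite subr_eq0.
  - move=> w hw; apply: ccontM; last exact: bz.
    by apply: ccontB; [exact: bf|exact: ccont_cst].
  - by move=> w hw; apply: ccontM; [exact: ccont_cst|exact: bz].
have := hr t t0 tr bf; rewrite e addrK => h.
move: e0 h; rewrite e addrK; set q := N _ => e0 h; lra.
Qed.

Definition psum (a : nat -> C) (n : nat) (z : C) : C := \sum_(k < n) a k * z ^+ k.

(** The remainder is quantified instead of a series being summed, so every later use handles finite
    sums plus a geometric error. The restriction to half the radius keeps the ratio [N z / s] at
    most 1/2. *)
Definition taylor f (a : nat -> C) (s K : R) := forall n z, N z <= s / 2 ->
  N (f z - psum a n z) <= K * (N z / s) ^+ n.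

(** Cauchy's formula with the finite geometric expansion of [(w - z)^-1], whose exact remainder is
    [z ^+ n * w^-1 ^+ n * (w - z)^-1]. On the boundary [N w >= s], hence [N (w - z) >= s / 2]. *)
Lemma cauchy_taylor (s : R) f : 0 < s ->
  (forall w, inrect (- s) s (- s) s w -> cdiff f w) -> exists a K, taylor f a s K.
Proof.
move=> s0 hf; have ss : - s <= s by lra.
have bf : bcont (- s) s (- s) s f by move=> w [hw _]; apply/cdiff_cont/hf.
have [M M0 hM] := bcont_bounded ss ss bf.
have ons w : onrect (- s) s (- s) s w -> s <= N w.
  move=> [_ h]; have := normc_ge_Re w; have := normc_ge_Im w.
  by case: h => ->; rewrite ?normrN (gtr0_norm s0) => *.
have c0 : (2 * pi)%:C * 'i != 0 :> C.
  rewrite -normc_eq0 Normc.normcM normc_i mulr1 normc_real normr_eq0.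
  by rewrite mulf_neq0// gt_eqF// pi_gt0.
pose c : C := (2 * pi)%:C * 'i.
pose a k := c^-1 * rint (- s) s (- s) s (fun w => f w * (w^-1) ^+ k.+1).
have bV z : N z < s -> bcont (- s) s (- s) s (fun w => (w - z)^-1).
  move=> hz w hw; apply: ccontV.
    rewrite subr_eq0; apply: contraTneq hz => <-; rewrite -leNgt; exact: ons.
  by apply: ccontB; [exact: ccont_id|exact: ccont_cst].
have bX k : bcont (- s) s (- s) s (fun w => w^-1 ^+ k).
  elim: k => [|k IH] w hw; first by under eq_fun do rewrite expr0; exact: ccont_cst.
  under eq_fun do rewrite exprS; apply: ccontM; last exact: IH.
  have := bV 0; rewrite Normc.normc0 => /(_ s0) /(_ _ hw).
  by under eq_fun do rewrite subr0.
exists a, (N c^-1 * (4 * (M * (2 / s)) * (s + s + (s + s)))) => n z hz.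
have zs : N z < s by lra.
have -> : f z - psum a n z = c^-1 * rint (- s) s (- s) s
    (fun w => f w * (z ^+ n * w^-1 ^+ n * (w - z)^-1)).
  have -> : f z = c^-1 * rint (- s) s (- s) s (fun w => f w / (w - z)).
    rewrite cauchy_formula//; first by rewrite -/c mulKf.
    - exact: le_lt_trans (normc_ge_Re _) zs.
    - exact: le_lt_trans (normc_ge_Im _) zs.
  have -> : psum a n z = c^-1 * rint (- s) s (- s) s
      (fun w => \sum_(k < n) z ^+ k * (f w * w^-1 ^+ k.+1)).
    rewrite rint_sum//; last first.
      move=> k w hw; apply: ccontM; first exact: ccont_cst.
      by apply: ccontM; [exact: bf|exact: bX].
    rewrite mulr_sumr; apply: eq_bigr => k _; rewrite rintZ//.
      by rewrite /a; ring.
    by move=> w hw; apply: ccontM; [exact: bf|exact: bX].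
  rewrite -mulrBr -rintB//; first last.
  - move=> w hw; apply: cvgc_sum => k; apply: ccontM; first exact: ccont_cst.
    by apply: ccontM; [exact: bf|exact: bX].
  - by move=> w hw; apply: ccontM; [exact: bf|exact: bV].
  congr (_ * _); apply: eq_rint => // w hw.
  have w0 : w != 0 by rewrite -normc_gt0; apply: lt_le_trans s0 (ons _ hw).
  have wz : w - z != 0.
    rewrite subr_eq0; apply: contraTneq zs => <-; rewrite -leNgt; exact: ons.
  elim: n {hz} => [|n IH]; first by rewrite big_ord0 !expr0; field.
  rewrite big_ord_recr /= opprD addrA IH !exprS; field.
  by rewrite w0 wz.
rewrite Normc.normcM -[leRHS]mulrA; apply: ler_wpM2l; first exact: normc_ge0.
apply: le_trans (rint_bound (M := M * ((N z / s) ^+ n * (2 / s))) ss ss _ _) _.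
- move=> w hw; apply: ccontM; first exact: bf.
  apply: ccontM; last exact: bV.
  by apply: ccontM; [exact: ccont_cst|exact: bX].
- move=> w hw; rewrite Normc.normcM; apply: ler_pM; try exact: normc_ge0.
    exact: hM.
  have sw := ons _ hw; have w0 : 0 < N w by apply: lt_le_trans sw.
  rewrite !Normc.normcM !normcX !Normc.normcV.
  apply: ler_pM; rewrite ?mulr_ge0 ?exprn_ge0 ?invr_ge0 ?normc_ge0//.
    rewrite -exprMn; apply: lerXn2r; rewrite ?nnegrE ?mulr_ge0 ?invr_ge0 ?normc_ge0//.
      exact: ltW.
    by apply: ler_wpM2l; [exact: normc_ge0|rewrite lef_pV2 ?posrE].
  rewrite -[2 / s]invrK invf_div lef_pV2 ?posrE ?divr_gt0//.
    by have := ler_normc_sub w z; lra.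
  by have := ler_normc_sub w z; lra.
- by rewrite opprK; lra.
Qed.


End cauchy.

(** * Averages over roots of unity *)

Section root_averages.
Variable R : realType.
Local Notation C := R[i].
Local Notation N := (@Normc.normc R).
Implicit Types (f g : C -> C) (z w : C) (a b : nat -> C) (r q K : R).

Lemma geo_le (x y K q : R) : 0 <= q < 1 -> (forall n, x <= y + K * q ^+ n) -> x <= y.
Proof.
move=> /andP[q0 q1] h.
have hl : (fun n => y + K * q ^+ n) @ \oo --> y + K * 0.
  apply: cvgD; first exact: cvg_cst.
  by apply: cvgM; [exact: cvg_cst|apply: cvg_expr; rewrite ger0_norm].
rewrite mulr0 addr0 in hl.
by apply: (cvgr_to_ge hl); exact: nearW.
Qed.

Lemma geo_sum_le (t : R) n : 0 <= t <= 1 / 2 -> \sum_(k < n) t ^+ k <= 2.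
Proof.
move=> /andP[t0 t1]; elim: n => [|n IH]; first by rewrite big_ord0.
rewrite big_ord_recl expr0.
under eq_bigr do rewrite lift0 exprS.
rewrite -mulr_sumr; have : t * \sum_(k < n) t ^+ k <= 1 / 2 * 2.
  by apply: ler_pM => //; apply: sumr_ge0 => k _; exact: exprn_ge0.
lra.
Qed.

(** ['X^n - 1] splits with [n] distinct roots over an algebraically closed field of characteristic
    0, and [n] distinct [n]-th roots of unity include a primitive one. *)
Lemma prim_root_exists (n : nat) : (0 < n)%N -> exists z : C, n.-primitive_root z.
Proof.
pose p : {poly C} := 'X^n - 1; have [r Dp] := closed_field_poly_normal p.
move=> n0; rewrite (monicP _) ?monicXnsubC // scale1r in Dp.
have rn1 : all n.-unity_root r by apply/allP=> z; rewrite -root_prod_XsubC -Dp.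
have sz_r : (n < (size r).+1)%N.
  by rewrite -(size_prod_XsubC r id) -Dp size_XnsubC.
have [|z] := hasP (has_prim_root n0 rn1 _ sz_r); last by exists z.
by rewrite -separable_prod_XsubC -Dp separable_Xn_sub_1 // pnatr_eq0 -lt0n.
Qed.

Lemma normc_unity_root n z : (0 < n)%N -> z ^+ n = 1 -> N z = 1.
Proof.
move=> n0 /(congr1 N); rewrite normcX Normc.normc1 => /eqP.
by rewrite pexpr_eq1 ?normc_ge0// => /eqP.
Qed.

Lemma sum_prim_root n z k m : n.-primitive_root z -> (k < n)%N -> (m < n)%N ->
  \sum_(j < n) (z ^+ j) ^+ k * (z ^+ j)^-1 ^+ m = if k == m then n%:R else 0.
Proof.
move=> zn kn mn; have n0 : (0 < n)%N by exact: leq_ltn_trans kn.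
have z0 : z != 0 by rewrite (prim_root_eq0 zn) -lt0n.
case: eqP => [->|/eqP km].
  rewrite (eq_bigr (fun=> 1)) ?sumr_const ?card_ord// => j _.
  by rewrite exprVn divff// !expf_neq0.
pose u := z ^+ (k + (n - m)).
have u1 : u != 1.
  rewrite -(prim_order_dvd zn); apply/negP => /dvdnP[c hc].
  move: km; case: c hc => [|[|c]] hc; first by lia.
    by move/eqP; apply; lia.
  by nia.
have un : u ^+ n = 1 by rewrite /u exprAC (prim_expr_order zn) expr1n.
rewrite (eq_bigr (fun j : 'I_n => u ^+ j)); last first.
  move=> j _; rewrite /u exprVn -!exprM mulnDl exprD [(k * j)%N]mulnC.
  congr (_ * _); rewrite [in RHS]mulnBl expfB_cond.
    by rewrite [z ^+ (n * j)]exprM (prim_expr_order zn) expr1n mul1r [(m * j)%N]mulnC.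
  by rewrite (negbTE z0) add0n leq_mul2r ltnW ?orbT.
apply/eqP; have := subrX1 u n; rewrite un subrr => /esym/eqP.
by rewrite mulf_eq0 subr_eq0 (negbTE u1).
Qed.

(** Unlike in [taylor], the ratio [q] is the same on the whole disc. This suits averages over the
    circle of radius [r] and sums of functions with different ratios. *)
Definition pser f a r q K := forall n z, N z <= r ->
  N (f z - psum a n z) <= K * q ^+ n.

Lemma pser_coef f a r q K m : 0 < r -> 0 <= q < 1 -> pser f a r q K ->
  N (a m) * r ^+ m <= 2 * K * q ^+ m.
Proof.
move=> r0 /andP[q0 q1] hf.
have nr : N r%:C = r by rewrite normc_real gtr0_norm.
have h1 := hf m r%:C; have h2 := hf m.+1 r%:C; rewrite nr lexx in h1 h2.
have K0 : 0 <= K * q ^+ m by apply: le_trans (h1 isT); exact: normc_ge0.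
have : N (a m * r%:C ^+ m) <= K * q ^+ m + K * q ^+ m.+1.
  rewrite (_ : _ * _ = (f r%:C - psum a m r%:C) - (f r%:C - psum a m.+1 r%:C)).
    by apply: le_trans (ler_normcB _ _) _; apply: lerD; [exact: h1|exact: h2].
  by rewrite /psum big_ord_recr /=; ring.
rewrite Normc.normcM normcX nr exprS => /le_trans; apply.
by rewrite mulrCA; nra.
Qed.

Definition ravg (n : nat) (z : C) (F : C -> C) := n%:R^-1 * \sum_(j < n) F (z ^+ j).

(** On polynomials of degree below [n] the average extracts a coefficient exactly, by orthogonality
    of the powers of a primitive root; only the Taylor remainder contributes an error. *)
Lemma ravg_pser f a r q K n z m : 0 < r -> pser f a r q K ->
  n.-primitive_root z -> (m < n)%N ->
  N (ravg n z (fun w => f (r%:C * w) * w^-1 ^+ m) - a m * r%:C ^+ m) <= K * q ^+ n.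
Proof.
move=> r0 hf zn mn; have n0 : (0 < n)%N by exact: leq_ltn_trans mn.
have nC : n%:R != 0 :> C by rewrite pnatr_eq0 -lt0n.
have nz j : N (z ^+ j) = 1.
  by rewrite normcX (normc_unity_root n0 (prim_expr_order zn)) expr1n.
have -> : a m * r%:C ^+ m =
    ravg n z (fun w => psum a n (r%:C * w) * w^-1 ^+ m).
  rewrite /ravg /psum.
  under eq_bigr do rewrite mulr_suml.
  rewrite exchange_big /=.
  rewrite (eq_bigr (fun k : 'I_n => a k * r%:C ^+ k *
      (if k == m :> nat then n%:R else 0))); last first.
    move=> k _; rewrite -(sum_prim_root zn (ltn_ord k) mn) mulr_sumr.
    by apply: eq_bigr => j _; rewrite exprMn; ring.
  rewrite (bigD1 (Ordinal mn)) //= eqxx big1 ?addr0.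
    by rewrite mulrCA mulVf// mulr1.
  by move=> k; rewrite -val_eqE /= => /negbTE ->; rewrite mulr0.
rewrite -mulrBr -sumrB Normc.normcM Normc.normcV normc_natr.
rewrite ler_pdivrMl ?ltr0n//; apply: le_trans (normc_sum _ _ _) _.
rewrite -[n%:R]/(n%:R) mulr_natl -[X in _ *+ X]card_ord -sumr_const.
apply: ler_sum => j _; rewrite -mulrBl Normc.normcM normcX Normc.normcV nz invr1.
rewrite expr1n mulr1; apply: hf.
by rewrite Normc.normcM nz mulr1 normc_real gtr0_norm.
Qed.

Lemma ravg_le n z (F : C -> C) (B : R) : (0 < n)%N ->
  (forall j, N (F (z ^+ j)) <= B) -> N (ravg n z F) <= B.
Proof.
move=> n0 h; rewrite /ravg Normc.normcM Normc.normcV normc_natr.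
rewrite ler_pdivrMl ?ltr0n//; apply: le_trans (normc_sum _ _ _) _.
by rewrite mulr_natl -[X in _ *+ X]card_ord -sumr_const; apply: ler_sum.
Qed.

(** Cauchy's inequality. Each average over roots of unity is at most [B], and it tends to the scaled
    coefficient as the number of roots grows. *)
Lemma pser_coef_le f a r q K (B : R) m : 0 < r -> 0 <= q < 1 -> pser f a r q K ->
  (forall z, N z = r -> N (f z) <= B) -> N (a m) * r ^+ m <= B.
Proof.
move=> r0 q01 hf hB; have /andP[q0 q1] := q01.
have K0 : 0 <= K.
  have := hf 0%N 0; rewrite Normc.normc0 expr0 mulr1 => /(_ (ltW r0)).
  by apply: le_trans; exact: normc_ge0.
apply: (@geo_le _ _ (K * 1) q) => // n; rewrite mulr1.
have [z zn] := @prim_root_exists (n + m.+1) (ltn_addl _ (ltn0Sn _)).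
have mn : (m < n + m.+1)%N by lia.
have := ravg_pser r0 hf zn mn; set A := ravg _ _ _ => hA.
have hA' : N A <= B.
  apply: ravg_le; first by lia.
  move=> j; have nz : N (z ^+ j) = 1.
    rewrite normcX (normc_unity_root _ (prim_expr_order zn)) ?expr1n//; lia.
  rewrite Normc.normcM normcX Normc.normcV nz invr1 expr1n mulr1.
  by apply: hB; rewrite Normc.normcM nz mulr1 normc_real gtr0_norm.
have e : N (a m) * r ^+ m = N (a m * r%:C ^+ m).
  by rewrite Normc.normcM normcX normc_real gtr0_norm.
rewrite e; have := ler_normcB A (A - a m * r%:C ^+ m).
rewrite opprB addrC subrK => /le_trans; apply; apply: lerD => //.
apply: le_trans hA _; apply: ler_wpM2l => //.
by rewrite exprD ler_piMr ?exprn_ge0// exprn_ile1// ltW.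
Qed.

Lemma pser_unique f a b r q q' K K' : 0 < r -> 0 <= q < 1 -> 0 <= q' < 1 ->
  pser f a r q K -> pser f b r q' K' -> a =1 b.
Proof.
move=> r0 q01 q01' ha hb m.
have K0 (p : R) L c : pser f c r p L -> 0 <= L.
  move=> hc; have := hc 0%N 0; rewrite Normc.normc0 expr0 mulr1 => /(_ (ltW r0)).
  by apply: le_trans; exact: normc_ge0.
pose p := Num.max q q'.
have p01 : 0 <= p < 1.
  by rewrite le_max gt_max; case/andP: q01 => -> ->; case/andP: q01' => _ ->.
have mono (p' L : R) n : 0 <= p' -> p' <= p -> 0 <= L -> L * p' ^+ n <= L * p ^+ n.
  by move=> h1 h2 h3; apply: ler_wpM2l => //; apply: lerXn2r; rewrite ?nnegrE// (le_trans h1).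
have h0 : N ((a m - b m) * r%:C ^+ m) <= 0.
  apply: (@geo_le _ _ ((K + K') * 1) p) => // n; rewrite mulr1 add0r.
  have [z zn] := @prim_root_exists (n + m.+1) (ltn_addl _ (ltn0Sn _)).
  have mn : (m < n + m.+1)%N by lia.
  have h1 := ravg_pser r0 ha zn mn; have h2 := ravg_pser r0 hb zn mn.
  move: h1 h2; set A := ravg _ _ _ => h1 h2.
  rewrite (_ : _ * _ = (A - b m * r%:C ^+ m) - (A - a m * r%:C ^+ m)); last by ring.
  apply: le_trans (ler_normcB _ _) _; rewrite mulrDl addrC.
  have pn : p ^+ (n + m.+1) <= p ^+ n.
    case/andP: p01 => p0 p1.
    by rewrite exprD ler_piMr ?exprn_ge0// exprn_ile1// ltW.
  apply: lerD; [apply: le_trans h1 _|apply: le_trans h2 _].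
    apply: le_trans (mono _ _ _ _ _ _) _; rewrite ?le_max ?lexx ?(K0 _ _ _ ha)//.
      by case/andP: q01.
    by apply: ler_wpM2l => //; exact: K0 ha.
  apply: le_trans (mono _ _ _ _ _ _) _; rewrite ?le_max ?lexx ?orbT ?(K0 _ _ _ hb)//.
    by case/andP: q01'.
  by apply: ler_wpM2l => //; exact: K0 hb.
apply/eqP; rewrite -subr_eq0 -normc_eq0.
have : N ((a m - b m) * r%:C ^+ m) == 0 by rewrite eq_le h0 normc_ge0.
rewrite normc_eq0 mulf_eq0 expf_eq0 (fmorph_eq0 (real_complex R)) (gt_eqF r0) andbF orbF.
by rewrite normc_eq0.
Qed.

Lemma pser0 f a r q K : 0 <= r -> 0 <= q < 1 -> pser f a r q K -> f 0 = a 0%N.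
Proof.
move=> r0 q01 hf; apply/eqP; rewrite -subr_eq0 -normc_eq0 eq_le normc_ge0 andbT.
apply: (@geo_le _ _ (K * q) q) => // n; rewrite add0r -mulrA -exprS.
have := hf n.+1 0; rewrite Normc.normc0 => /(_ r0).
rewrite /psum big_ord_recl expr0 mulr1 big1 ?addr0// => k _.
by rewrite exprS mul0r mulr0.
Qed.

(* Caratheodory's coefficient inequality, by averaging [f] against the
   nonnegative weights [2 + 2 Re (u / w ^ m)] over roots of unity. *)
Lemma pser_caratheodory f a r q K m : 0 < r -> 0 <= q < 1 -> pser f a r q K ->
  (forall z, N z = r -> 0 <= complex.Re (f z)) -> (0 < m)%N ->
  N (a m) * r ^+ m <= 2 * complex.Re (a 0%N).
Proof.
move=> r0 q01 hf hre m0; have /andP[q0 q1] := q01.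
have K0 : 0 <= K.
  have := hf 0%N 0; rewrite Normc.normc0 expr0 mulr1 => /(_ (ltW r0)).
  by apply: le_trans; exact: normc_ge0.
pose c := a m * r%:C ^+ m.
have ec : N c = N (a m) * r ^+ m.
  by rewrite Normc.normcM normcX normc_real gtr0_norm.
(* The unimodular number with [u * c = - N c], which makes the inequality sharp; any value would do
   when [c = 0]. *)
pose u : C := if c == 0 then 1 else - c^* / (N c)%:C.
have Nu : N u = 1.
  rewrite /u; case: eqP => [_|/eqP c0]; first by rewrite Normc.normc1.
  rewrite normcf_div normcN normc_conj normc_real ger0_norm ?normc_ge0//.
  by rewrite divff// normc_eq0.
have uc : complex.Re (u * c) = - N c.
  rewrite /u; case: eqP => [->|/eqP c0]; first by rewrite mulr0 Normc.normc0 oppr0.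
  have nc0 : N c != 0 by rewrite normc_eq0.
  rewrite mulrAC mulNr [_^* * _]mulrC mul_conjc -fmorphV -rmorphN -rmorphM /=.
  by field.
have key n : 0 <= 2 * complex.Re (a 0%N) - N c + (6 * K) * q ^+ n.
  (* Large enough that [m] and [M - m] lie below [M] and that every error term is at most a multiple
     of [q ^+ n]. *)
  set M := (n + m + m.+1)%N.
  have M0 : (0 < M)%N by rewrite /M; lia.
  have mM : (m < M)%N by rewrite /M; lia.
  have mM' : (M - m < M)%N by rewrite /M; lia.
  have [z zn] := prim_root_exists M0.
  have nz j : N (z ^+ j) = 1.
    by rewrite normcX (normc_unity_root M0 (prim_expr_order zn)) expr1n.
  have z0 j : z ^+ j != 0 by rewrite -normc_eq0 nz oner_eq0.
  pose T w := 2 + u * w^-1 ^+ m + u^* * w ^+ m.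
  have TE j : T (z ^+ j) = (2 + 2 * complex.Re (u * (z ^+ j)^-1 ^+ m))%:C.
    have cz : ((z ^+ j)^-1) = (z ^+ j)^*.
      apply: (mulfI (z0 j)); rewrite mul_conjc nz expr1n divff// z0.
    rewrite /T cz -(conjcK (z ^+ j)) conjcK -[in X in _ + _ * X](conjcK (z ^+ j)).
    rewrite -[(_ ^* ^* ) ^+ m]rmorphXn -rmorphM -addrA addcJ.
    by rewrite rmorphD rmorphM /= (rmorph_nat (real_complex R) 2).
  have T0 j : 0 <= complex.Re (T (z ^+ j)).
    rewrite TE /=; have := normc_ge_Re (u * (z ^+ j)^-1 ^+ m).
    rewrite Normc.normcM normcX Normc.normcV nz Nu invr1 expr1n mulr1.
    by rewrite ler_norml => /andP[? _]; lra.
  have pos : 0 <= complex.Re (ravg M z (fun w => f (r%:C * w) * T w)).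
    rewrite /ravg -(rmorph_nat (real_complex R)) -fmorphV ReM /= mul0r subr0.
    rewrite mulr_ge0 ?invr_ge0// Re_sum sumr_ge0// => j _.
    rewrite ReM (_ : complex.Im (T _) = 0) ?TE//= mulr0 subr0 -[2 + _]/(complex.Re (_%:C)) -TE.
    apply: mulr_ge0 => //; apply: hre.
    by rewrite Normc.normcM nz mulr1 normc_real gtr0_norm.
  (* On [M]-th roots of unity [w ^+ m] equals [w^-1 ^+ (M - m)], so the conjugate term extracts the
     coefficient of index [M - m], which is geometrically small. *)
  have split : ravg M z (fun w => f (r%:C * w) * T w) =
      2 * ravg M z (fun w => f (r%:C * w) * w^-1 ^+ 0) +
      u * ravg M z (fun w => f (r%:C * w) * w^-1 ^+ m) +
      u^* * ravg M z (fun w => f (r%:C * w) * w^-1 ^+ (M - m)).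
    rewrite /ravg !(mulrCA _ (M%:R^-1)) -!mulrDr; congr (_ * _).
    rewrite !mulr_sumr -!big_split /=; apply: eq_bigr => j _.
    rewrite (_ : (z ^+ j)^-1 ^+ (M - m) = (z ^+ j) ^+ m); first by rewrite /T expr0; ring.
    apply: (mulfI (_ : (z ^+ j)^-1 ^+ m != 0)); first by rewrite expf_neq0 ?invr_eq0.
    rewrite -exprD subnKC ?(ltnW mM)// -exprMn mulVf// expr1n exprVn -exprM mulnC exprM.
    by rewrite (prim_expr_order zn) expr1n invr1.
  have h0 := ravg_pser r0 hf zn M0; have h1 := ravg_pser r0 hf zn mM.
  have h2 := ravg_pser r0 hf zn mM'.
  have h3 := pser_coef (M - m) r0 q01 hf.
  have qM : q ^+ M <= q ^+ n.
    by rewrite /M -addnA exprD ler_piMr ?exprn_ge0// exprn_ile1// ltW.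
  have qMm : q ^+ (M - m) <= q ^+ n.
    rewrite (_ : (M - m = n + m.+1)%N); last by rewrite /M -addnA (addnC m) addnA addnK.
    by rewrite exprD ler_piMr ?exprn_ge0// exprn_ile1// ltW.
  move: pos; rewrite split.
  set A0 := ravg _ _ _ in h0 *; set A1 := ravg _ _ _ in h1 *.
  set A2 := ravg _ _ _ in h2 * => pos.
  have e : 2 * A0 + u * A1 + u^* * A2 = (2 * a 0%N + u * c) +
     (2 * (A0 - a 0%N * r%:C ^+ 0) + u * (A1 - c) + u^* * A2).
    by rewrite expr0; ring.
  rewrite e ReD in pos.
  have re2 (x : C) : complex.Re (2 * x) = 2 * complex.Re x.
    by rewrite -(rmorph_nat (real_complex R) 2) ReM /= mul0r subr0.
  have n2 (x : C) : N (2 * x) = 2 * N x by rewrite Normc.normcM (normc_natr R 2).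
  have hA2 : N A2 <= K * q ^+ M + 2 * K * q ^+ (M - m).
    have := le_normcD (A2 - a (M - m)%N * r%:C ^+ (M - m)) (a (M - m)%N * r%:C ^+ (M - m)).
    rewrite subrK => /le_trans; apply; apply: lerD => //.
    by rewrite Normc.normcM normcX normc_real gtr0_norm.
  have hrest : N (2 * (A0 - a 0%N * r%:C ^+ 0) + u * (A1 - c) + u^* * A2) <=
      6 * K * q ^+ n.
    apply: le_trans (le_normcD _ _) _.
    apply: le_trans (lerD (le_normcD _ _) (lexx _)) _.
    rewrite n2 (Normc.normcM u) (Normc.normcM u^*) normc_conj Nu !mul1r.
    rewrite -/c in h1.
    have k1 := ler_wpM2l K0 qM; have k2 := ler_wpM2l K0 qMm. lra.
  rewrite ReD re2 uc in pos.
  have := le_trans (normc_ge_Re _) hrest; rewrite ler_norml => /andP[_ h].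
  by lra.
rewrite -ec; apply: (@geo_le _ _ (6 * K) q) => // n.
by have := key n; lra.
Qed.

(** Caratheodory's inequality bounds the series of [f z - f 0] by [2 * Re (f 0)] times the sum of
    the positive powers of [t = N z / r], which is at most [2 * t] for [t <= 1 / 2]. *)
Lemma pser_harnack f a r q K : 0 < r -> 0 <= q < 1 -> pser f a r q K ->
  (forall z, N z = r -> 0 <= complex.Re (f z)) ->
  0 <= complex.Re (f 0) /\
  forall z, N z <= r / 2 -> N (f z - f 0) <= 4 * complex.Re (f 0) * (N z / r).
Proof.
move=> r0 q01 hf hre; rewrite (pser0 (ltW r0) q01 hf).
have hC m := pser_caratheodory r0 q01 hf hre (ltn0Sn m).
have a0 : 0 <= complex.Re (a 0%N).
  by have := hC 0%N; have := mulr_ge0 (normc_ge0 (a 1%N)) (ltW r0); rewrite expr1; lra.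
split=> // z hz; set t := N z / r.
have t0 : 0 <= t by rewrite divr_ge0 ?normc_ge0 ?ltW.
have t1 : t <= 1 / 2 by rewrite ler_pdivrMr//; lra.
apply: (@geo_le _ _ (K * q) q) => // n.
have zr : N z <= r by lra.
have := hf n.+1 z zr; rewrite /psum big_ord_recl expr0 mulr1 exprS mulrA => h.
move: h; set S := \sum_(i < n) _ => h.
apply: (@le_trans _ _ (N S + K * q * q ^+ n)).
  have := le_normcD (f z - (a 0%N + S)) S.
  by rewrite [X in N X <= _](_ : _ = f z - a 0%N); [lra|ring].
rewrite /S lerD2r; apply: le_trans (normc_sum _ _ _) _.
apply: (@le_trans _ _ (\sum_(i < n) 2 * complex.Re (a 0%N) * t * t ^+ i)).
  apply: ler_sum => i _; rewrite lift0 Normc.normcM normcX.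
  rewrite -mulrA -exprS /t exprMn exprVn mulrA.
  rewrite ler_pdivlMr ?exprn_gt0// mulrAC; apply: ler_wpM2r => //.
  by apply: exprn_ge0; exact: normc_ge0.
rewrite -mulr_sumr; have := geo_sum_le n (_ : 0 <= t <= 1 / 2).
rewrite t0 t1 => /(_ isT) hs.
have p : 0 <= 2 * complex.Re (a 0%N) * t by apply: mulr_ge0 => //; apply: mulr_ge0.
by have := ler_wpM2l p hs; lra.
Qed.

End root_averages.

(** * Entire functions *)

Section entire_functions.
Variable R : realType.
Local Notation C := R[i].
Local Notation N := (@Normc.normc R).
Implicit Types (f g : C -> C) (z w : C) (a b : nat -> C) (r q K s : R).

Definition centire f := forall z, cdiff f z.

Lemma half01 : 0 <= (2^-1 : R) < 1.
Proof. by apply/andP; split; lra. Qed.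

Lemma taylor_ge0 f a s K : 0 < s -> taylor f a s K -> 0 <= K.
Proof.
move=> s0 h; have := h 0%N 0; rewrite Normc.normc0 expr0 mulr1 => h0.
by apply: le_trans (h0 _); [exact: normc_ge0|rewrite divr_ge0// ltW].
Qed.

Lemma taylor_pser f a s K r : 0 < s -> r <= s / 2 -> taylor f a s K ->
  pser f a r 2^-1 K.
Proof.
move=> s0 rs hf n z zr; have zs := le_trans zr rs.
apply: le_trans (hf n z zs) _; apply: ler_wpM2l; first exact: taylor_ge0 hf.
have t0 : 0 <= N z / s by rewrite divr_ge0 ?normc_ge0 ?ltW.
apply: lerXn2r; rewrite ?nnegrE ?invr_ge0//.
by rewrite ler_pdivrMr//; lra.
Qed.

Lemma taylor_coef f a s K n : 0 < s -> taylor f a s K -> N (a n) * s ^+ n <= 2 * K.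
Proof.
move=> s0 hf; have s20 : 0 < s / 2 by lra.
have p : 0 < (2^-1 : R) ^+ n by rewrite exprn_gt0// invr_gt0.
have := pser_coef n s20 half01 (taylor_pser s0 (lexx _) hf).
by rewrite exprMn mulrA (ler_pM2r p).
Qed.

Lemma psum_dist a s (M : R) n m z : 0 < s -> (forall k, N (a k) * s ^+ k <= M) ->
  N z <= s / 2 -> (n <= m)%N ->
  N (psum a m z - psum a n z) <= 2 * M * (N z / s) ^+ n.
Proof.
move=> s0 hM zs nm; set t := N z / s.
have t0 : 0 <= t by apply: divr_ge0; [exact: normc_ge0|exact: ltW].
have t1 : t <= 1 / 2 by rewrite /t ler_pdivrMr//; lra.
have M0 : 0 <= M.
  by have := hM 0%N; rewrite expr0 mulr1; apply: le_trans; exact: normc_ge0.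
rewrite -(subnKC nm); move: (m - n)%N => p.
rewrite /psum big_split_ord /= addrAC subrr add0r.
apply: le_trans (normc_sum _ _ _) _.
apply: (@le_trans _ _ (\sum_(i < p) M * t ^+ n * t ^+ i)).
  apply: ler_sum => i _; rewrite Normc.normcM normcX -mulrA -exprD.
  rewrite /t exprMn exprVn mulrA ler_pdivlMr ?exprn_gt0// mulrAC.
  by apply: ler_wpM2r; [apply: exprn_ge0; exact: normc_ge0|exact: hM].
rewrite -mulr_sumr; have h := @geo_sum_le R t p.
have Mt : 0 <= M * t ^+ n by rewrite mulr_ge0// exprn_ge0.
have := ler_wpM2l Mt (h _); rewrite t0 t1 => /(_ isT); lra.
Qed.

Lemma psum_limit a s (M : R) z : 0 < s -> (forall k, N (a k) * s ^+ k <= M) ->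
  N z <= s / 2 -> exists v, forall n, N (v - psum a n z) <= 2 * M * (N z / s) ^+ n.
Proof.
move=> s0 hM zs.
have [U [UU FU]] := @ultraFilterLemma _ \oo (eventually_filter).
have [v hv] : exists v, cvgc U (fun m => psum a m z) v.
  apply: (@ultra_cvgc _ _ _ _ (2 * M)); apply: FU; exists 0%N => // m _ /=.
  have := psum_dist s0 hM zs (leq0n m).
  by rewrite /psum big_ord0 subr0 expr0 mulr1.
exists v => n; apply: (@cvgc_le _ _ U _ (fun m => psum a m z - psum a n z)).
  by apply: cvgcB => //; exact: cvgc_cst.
apply: FU; exists n => // m /= nm; exact: psum_dist.
Qed.

Lemma geo_zero (z : C) (K q : R) : 0 <= q < 1 -> (forall n, N z <= K * q ^+ n) -> z = 0.
Proof.
move=> q01 h; apply/eqP; rewrite -normc_eq0 eq_le normc_ge0 andbT.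
by apply: (@geo_le _ _ _ K q) => // n; rewrite add0r.
Qed.

Lemma ratio_half s z : 0 < s -> N z <= s / 2 -> 0 <= N z / s < 1.
Proof.
move=> s0 zs; apply/andP; split.
  by apply: divr_ge0; [exact: normc_ge0|exact: ltW].
by rewrite ltr_pdivrMr//; lra.
Qed.

(** The value at [z] is the limit of the partial sums at a radius chosen from [z]; the limits
    obtained from other radii agree with it, so the estimate holds at every radius for one and the
    same function. *)
Lemma coef_function a :
  (forall s, 0 < s -> exists M : R, forall k, N (a k) * s ^+ k <= M) ->
  exists f, forall s (M : R), 0 < s -> (forall k, N (a k) * s ^+ k <= M) ->
    taylor f a s (2 * M).
Proof.
move=> hd; have M0 s (M : R) : (forall k, N (a k) * s ^+ k <= M) -> 0 <= 2 * M.
  by move=> hM; have := hM 0%N; rewrite expr0 mulr1; have := normc_ge0 (a 0%N); lra.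
have lim z : exists v, forall n s (M : R), 0 < s -> N z <= s / 2 ->
    (forall k, N (a k) * s ^+ k <= M) ->
    N (v - psum a n z) <= 2 * M * (N z / s) ^+ n.
  have s0 : 0 < 2 * N z + 2 by have := normc_ge0 z; lra.
  have zs : N z <= (2 * N z + 2) / 2 by lra.
  have [M hM] := hd _ s0; have [v hv] := psum_limit s0 hM zs.
  exists v => n s L s1 zs1 hL; have [v' hv'] := psum_limit s1 hL zs1.
  suff -> : v = v' by exact: hv'.
  apply/eqP; rewrite -subr_eq0; apply/eqP.
  pose q := Num.max (N z / (2 * N z + 2)) (N z / s).
  have /andP[q1 q1'] := ratio_half s0 zs; have /andP[q2 q2'] := ratio_half s1 zs1.
  have q01 : 0 <= q < 1 by rewrite le_max q1 gt_max q1' q2'.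
  apply: (@geo_zero _ (2 * M + 2 * L) q q01) => m.
  rewrite (_ : v - v' = (v - psum a m z) - (v' - psum a m z)); last by ring.
  apply: le_trans (ler_normcB _ _) _; rewrite mulrDl.
  have /andP[q0 _] := q01.
  apply: lerD; [apply: le_trans (hv m) _|apply: le_trans (hv' m) _];
    (apply: ler_wpM2l; first exact: M0);
    by apply: lerXn2r; rewrite ?nnegrE// /q le_max lexx ?orbT.
have [f hf] := choice lim.
by exists f => s M s0 hM n z zs; exact: hf.
Qed.

(** The unknown constant of some expansion is replaced by one that depends only on the coefficient
    bound. Limits of families need this uniformity. *)
Lemma taylor_of_coef f a s (M : R) : 0 < s -> (forall k, N (a k) * s ^+ k <= M) ->
  (exists L, taylor f a s L) -> taylor f a s (2 * M).
Proof.
move=> s0 hM [L hL] n z zs; have [v hv] := psum_limit s0 hM zs.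
suff -> : f z = v by exact: hv.
apply/eqP; rewrite -subr_eq0; apply/eqP.
apply: (@geo_zero _ (L + 2 * M) _ (ratio_half s0 zs)) => m.
rewrite (_ : f z - v = (f z - psum a m z) - (v - psum a m z)); last by ring.
by apply: le_trans (ler_normcB _ _) _; rewrite mulrDl; apply: lerD; [exact: hL|exact: hv].
Qed.

(** Expansions at different radii have the same coefficients, by uniqueness on a common small disc,
    so one sequence serves all radii. *)
Lemma centire_taylor f : centire f -> exists a, forall s, 0 < s -> exists K, taylor f a s K.
Proof.
move=> hf; have H s : 0 < s -> exists a K, taylor f a s K.
  by move=> s0; apply: cauchy_taylor.
have [a [K ha]] := H 1 ltr01; exists a => s s0.
have [b [L hb]] := H s s0; exists L.
have -> : a = b; last by [].
apply/funext; pose r := Num.min (1 / 2) (s / 2).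
have r0 : 0 < r by rewrite lt_min; apply/andP; split; lra.
apply: (pser_unique r0 half01 half01 (f := f)).
- by apply: taylor_pser ha => //; rewrite ge_min lexx.
- by apply: taylor_pser hb => //; rewrite ge_min lexx orbT.
Qed.

Lemma taylor_coef_le f a (s B : R) n : 0 < s ->
  (forall r, 0 < r -> exists K, taylor f a r K) ->
  (forall z, N z = s -> N (f z) <= B) -> N (a n) * s ^+ n <= B.
Proof.
move=> s0 hf hB; have s20 : 0 < 2 * s by lra.
have [K hK] := hf _ s20.
by apply: (pser_coef_le n s0 half01 _ hB); apply: taylor_pser hK; lra.
Qed.

Lemma taylor_bounded f a (s B : R) : 0 < s ->
  (forall r, 0 < r -> exists K, taylor f a r K) ->
  (forall z, N z = s -> N (f z) <= B) -> taylor f a s (2 * B).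
Proof.
move=> s0 hf hB; apply: (taylor_of_coef s0 _ (hf s s0)) => k.
by apply: (taylor_coef_le (f := f)).
Qed.

(** A maximum principle that loses a factor 2 and half the radius: Cauchy's inequality bounds the
    coefficients and a geometric series the sum. Every use absorbs the loss. *)
Lemma centire_max f (s B : R) : centire f -> 0 < s ->
  (forall z, N z = s -> N (f z) <= B) -> forall z, N z <= s / 2 -> N (f z) <= 2 * B.
Proof.
move=> /centire_taylor[a ha] s0 hB z zs.
have h := taylor_bounded s0 ha hB; have := h 0%N z zs.
by rewrite /psum big_ord0 subr0 expr0 mulr1.
Qed.

Definition dcoef a (k : nat) : C := k.+1%:R * a k.+1.

Lemma dcoef_bound a s (M : R) : 0 < s ->
  (forall k, N (a k) * (2 * s) ^+ k <= M) -> forall k, N (dcoef a k) * s ^+ k <= M / s.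
Proof.
move=> s0 h k; rewrite ler_pdivlMr// -mulrA -exprSr /dcoef Normc.normcM normc_natr.
apply: le_trans (h k.+1); rewrite exprMn mulrA.
apply: ler_wpM2r; first by rewrite exprn_ge0// ltW.
rewrite mulrC; apply: ler_wpM2l; first exact: normc_ge0.
by rewrite -natrX ler_nat ltnW// ltn_expl.
Qed.

(** Multiplying by [rho ^+ 2] avoids a division. The crude ratio [4 * rho] still sums geometrically
    against coefficients controlled at radius [8 * rho]. *)
Lemma taylor_remainder z h (rho : R) k : 0 <= rho -> N z <= rho -> N h <= rho ->
  rho ^+ 2 * N ((z + h) ^+ k.+1 - z ^+ k.+1 - h * (k.+1%:R * z ^+ k)) <=
  N h ^+ 2 * (4 * rho) ^+ k.+1.
Proof.
move=> r0 zr hr; elim: k => [|k IH].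
  rewrite !expr1 expr0 mulr1 mulr1 (_ : _ - _ - _ = 0); last by ring.
  by rewrite Normc.normc0 mulr0 mulr_ge0 ?sqr_ge0 ?mulr_ge0.
rewrite (_ : _ - _ - _ = (z + h) * ((z + h) ^+ k.+1 - z ^+ k.+1 - h * (k.+1%:R * z ^+ k))
   + h ^+ 2 * (k.+1%:R * z ^+ k)); last by rewrite !exprS -[k.+2]addn1 natrD; ring.
set D := _ - _ - _ in IH *.
have zh : N (z + h) <= 2 * rho by have := le_normcD z h; lra.
have k1 : rho ^+ 2 * (k.+1%:R * N z ^+ k) <= 2 * rho * (4 * rho) ^+ k.+1.
  have e1 : N z ^+ k <= rho ^+ k by apply: lerXn2r; rewrite ?nnegrE ?normc_ge0.
  have e2 : (k.+1%:R : R) <= 2 * 4 ^+ k.+1.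
    apply: (@le_trans _ _ (4 ^+ k.+1)); last by rewrite ler_peMl ?exprn_ge0//; lra.
    by rewrite -natrX ler_nat ltnW// (leq_trans (ltn_expl k.+1 (isT : 1 < 4)%N)).
  rewrite (_ : 2 * rho * _ = rho ^+ 2 * ((2 * 4 ^+ k.+1) * rho ^+ k)); last first.
    by rewrite exprMn [rho ^+ k.+1]exprS; ring.
  apply: ler_wpM2l; first exact: sqr_ge0.
  by apply: ler_pM => //; apply: exprn_ge0; exact: normc_ge0.
have h0 : 0 <= N h ^+ 2 by rewrite sqr_ge0.
have D0 : 0 <= rho ^+ 2 * N D by rewrite mulr_ge0 ?sqr_ge0 ?normc_ge0.
have h1 := ler_pM (normc_ge0 _) D0 zh IH; have h2 := ler_wpM2l h0 k1.
have h3 : N ((z + h) * D + h ^+ 2 * (k.+1%:R * z ^+ k)) <=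
    N (z + h) * N D + N h ^+ 2 * (k.+1%:R * N z ^+ k).
  apply: le_trans (le_normcD _ _) _.
  rewrite (Normc.normcM (z + h)) (Normc.normcM (h ^+ 2)) (Normc.normcM k.+1%:R).
  by rewrite (normcX h) (normcX z) normc_natr.
apply: le_trans (ler_wpM2l (sqr_ge0 rho) h3) _.
rewrite mulrDr mulrCA [X in _ + X]mulrCA.
apply: le_trans (lerD h1 h2) _.
by rewrite [(4 * rho) ^+ k.+2]exprS le_eqVlt; apply/orP; left; apply/eqP; ring.
Qed.

Lemma taylor_deriv f f1 a s K L z : 0 < s -> taylor f a s K ->
  taylor f1 (dcoef a) s L -> N z <= s / 8 -> cderiv f z (f1 z).
Proof.
move=> s0 hf hf1 zs e e0; pose rho := s / 8.
have r0 : 0 < rho by rewrite /rho; lra.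
have sE : s = 8 * rho by rewrite /rho; lra.
have K0 := taylor_ge0 s0 hf.
have K1 : 0 < 4 * K + 1 by lra.
have r20 : 0 < rho ^+ 2 by rewrite exprn_gt0.
exists (Num.min rho (e * rho ^+ 2 / (4 * K + 1))).
  by rewrite lt_min r0 divr_gt0// mulr_gt0.
move=> h; rewrite lt_min => /andP[h1 he]; have hr := ltW h1.
have main n : rho ^+ 2 * N (psum a n.+1 (z + h) - psum a n.+1 z - h * psum (dcoef a) n z) <=
    4 * K * N h ^+ 2.
  have -> : psum a n.+1 (z + h) - psum a n.+1 z - h * psum (dcoef a) n z =
    \sum_(k < n) a k.+1 * ((z + h) ^+ k.+1 - z ^+ k.+1 - h * (k.+1%:R * z ^+ k)).
    rewrite /psum !big_ord_recl !expr0 mulr_sumr opprD addrACA subrr add0r.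
    rewrite -!sumrB; apply: eq_bigr => k _; rewrite lift0 /dcoef; ring.
  apply: le_trans (ler_wpM2l (sqr_ge0 rho) (normc_sum _ _ _)) _; rewrite mulr_sumr.
  apply: (@le_trans _ _ (\sum_(k < n) (2 * K * N h ^+ 2) * (2^-1) ^+ k)).
    apply: ler_sum => k _; rewrite Normc.normcM mulrCA.
    have c1 := taylor_remainder k (ltW r0) zs hr; have c2 := taylor_coef k.+1 s0 hf.
    apply: le_trans (ler_wpM2l (normc_ge0 _) c1) _.
    rewrite mulrCA [leRHS]mulrAC [leRHS]mulrC; apply: ler_wpM2l; first exact: sqr_ge0.
    rewrite (_ : 4 * rho = s * 2^-1); last by lra.
    rewrite exprMn mulrA; apply: le_trans (ler_wpM2r _ c2) _.
      by rewrite exprn_ge0// invr_ge0.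
    apply: ler_wpM2l; first by lra.
    rewrite exprS; have : 0 <= (2^-1 : R) ^+ k by rewrite exprn_ge0// invr_ge0.
    lra.
  rewrite -mulr_sumr; have := @geo_sum_le R 2^-1 n.
  have h12 : 0 <= (2^-1 : R) <= 1 / 2 by apply/andP; split; lra.
  move=> /(_ h12) hs; have p : 0 <= 2 * K * N h ^+ 2 by rewrite mulr_ge0 ?sqr_ge0//; lra.
  by have := ler_wpM2l p hs; lra.
have zs2 : N z <= s / 2 by lra.
have zhs : N (z + h) <= s / 2 by have := le_normcD z h; rewrite /rho in hr; lra.
have L0 := taylor_ge0 s0 hf1.
have lim2 : rho ^+ 2 * N (f (z + h) - f z - f1 z * h) <= 4 * K * N h ^+ 2.
  apply: (@geo_le _ _ _ (rho ^+ 2 * (K + K + N h * L)) 2^-1 half01) => n.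
  rewrite (_ : f _ - _ - _ = (psum a n.+1 (z + h) - psum a n.+1 z - h * psum (dcoef a) n z)
    + ((f (z + h) - psum a n.+1 (z + h)) - (f z - psum a n.+1 z) - h * (f1 z - psum (dcoef a) n z)));
    last by ring.
  apply: le_trans (ler_wpM2l (sqr_ge0 rho) (le_normcD _ _)) _; rewrite mulrDr.
  apply: lerD; first exact: main.
  rewrite -[leRHS]mulrA; apply: ler_wpM2l; first exact: sqr_ge0.
  apply: le_trans (ler_normcB _ _) _.
  apply: le_trans (lerD (ler_normcB _ _) (lexx _)) _.
  have pw (w : C) m : N w <= s / 2 -> (n <= m)%N -> (N w / s) ^+ m <= 2^-1 ^+ n.
    move=> hw nm; have /andP[q0 _] := ratio_half s0 hw.
    have q1 : N w / s <= 2^-1 by rewrite ler_pdivrMr//; lra.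
    apply: (@le_trans _ _ ((N w / s) ^+ n)).
      rewrite -(subnKC nm) exprD ler_piMr ?exprn_ge0// exprn_ile1//; lra.
    by apply: lerXn2r; rewrite ?nnegrE ?invr_ge0.
  rewrite 2!(mulrDl _ _ (2^-1 ^+ n)); apply: lerD; first apply: lerD.
  - apply: le_trans (hf _ _ zhs) _; apply: ler_wpM2l => //; exact: pw.
  - apply: le_trans (hf _ _ zs2) _; apply: ler_wpM2l => //; exact: pw.
  - rewrite Normc.normcM -[leRHS]mulrA; apply: ler_wpM2l; first exact: normc_ge0.
    apply: le_trans (hf1 _ _ zs2) _; apply: ler_wpM2l => //.
    exact: pw.
rewrite -(ler_pM2l r20); apply: le_trans lim2 _.
rewrite expr2 !mulrA; apply: ler_wpM2r; first exact: normc_ge0.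
move: he; rewrite ltr_pdivlMr// => he.
by have := normc_ge0 h; rewrite [rho ^+ 2 * e]mulrC; lra.
Qed.

Lemma centire_of_taylor f a : (forall s, 0 < s -> exists K, taylor f a s K) ->
  exists2 f1, (forall z, cderiv f z (f1 z)) &
    forall s, 0 < s -> exists K, taylor f1 (dcoef a) s K.
Proof.
move=> hf.
have hd s : 0 < s -> exists M : R, forall k, N (dcoef a k) * s ^+ k <= M.
  move=> s0; have s20 : 0 < 2 * s by lra.
  have [K hK] := hf _ s20; exists (2 * K / s) => k.
  by apply: dcoef_bound => // j; exact: taylor_coef hK.
have [f1 hf1] := coef_function hd.
have hT s : 0 < s -> exists K, taylor f1 (dcoef a) s K.
  by move=> s0; have [M hM] := hd _ s0; exists (2 * M); exact: hf1.
exists f1 => // z; have s0 : 0 < 8 * (N z + 1) by have := normc_ge0 z; lra.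
have [K hK] := hf _ s0; have [L hL] := hT _ s0.
by apply: (taylor_deriv s0 hK hL); lra.
Qed.

Lemma centire_derivative f : centire f ->
  exists2 f1, (forall z, cderiv f z (f1 z)) & centire f1.
Proof.
move=> /centire_taylor[a /centire_of_taylor[f1 h1 h2]]; exists f1 => //.
have [f2 h3 _] := centire_of_taylor h2.
by move=> z; exists (f2 z).
Qed.

Lemma taylor_centire f a : (forall s, 0 < s -> exists K, taylor f a s K) -> centire f.
Proof. by move=> /centire_of_taylor[f1 h1 _] z; exists (f1 z). Qed.

(** Montel and Weierstrass in one step: the coefficients are bounded, hence converge along [U], and
    the Taylor estimates, whose constants [2 * B s] do not depend on [t], pass to the limit. *)
Lemma centire_limit (T : Type) (U : set_system T) (F : T -> C -> C) (B : R -> R) f :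
  UltraFilter U -> (forall t, centire (F t)) ->
  (forall t z, N (F t z) <= B (N z)) ->
  (forall z, cvgc U (fun t => F t z) (f z)) -> centire f.
Proof.
move=> UU hF hB hlim.
have /choice[A hA] t := centire_taylor (hF t).
have cA n : exists l, cvgc U (fun t => A t n) l.
  apply: (@ultra_cvgc _ _ _ _ (B 1)); apply: (@nearW _ U) => t.
  have := taylor_coef_le n ltr01 (hA t) (B := B 1).
  by rewrite expr1n mulr1; apply => z hz; rewrite -hz; exact: hB.
have [a ha] := choice cA.
apply: (@taylor_centire _ a) => s s0; exists (2 * B s) => n z zs.
apply: (@cvgc_le _ _ U _ (fun t => F t z - psum (A t) n z)).
  apply: cvgcB => //; rewrite /psum; apply: cvgc_sum => k.
  by apply: cvgcM => //; exact: cvgc_cst.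
apply: (@nearW _ U) => t; apply: (taylor_bounded s0 (hA t)) => // w hw.
by rewrite -hw; exact: hB.
Qed.

Lemma centire_cst c : centire (fun=> c). Proof. by move=> z; exact: cdiff_cst. Qed.

Lemma centireM f g : centire f -> centire g -> centire (fun z => f z * g z).
Proof. by move=> h1 h2 z; exact: cdiffM. Qed.

Lemma centire_linear c : centire (fun z => 1 - z / c).
Proof.
move=> z; apply: cdiffB; first exact: cdiff_cst.
by apply: cdiffM; [exact: cdiff_id|exact: cdiff_cst].
Qed.

(** The quotient has coefficients [b n = psum a n.+1 m / m ^+ n]. Since [f m = 0], this partial sum
    is minus a Taylor remainder, which makes [b] decay at every geometric rate. *)
Lemma centire_div f (m : C) : centire f -> m != 0 -> f m = 0 ->
  exists2 g, centire g & forall z, f z = (1 - z / m) * g z.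
Proof.
move=> /centire_taylor[a ha] m0 fm.
have nm0 : 0 < N m by rewrite normc_gt0.
pose b n := psum a n.+1 m / m ^+ n.
have hb0 (s : R) : 2 * N m <= s -> exists M : R, forall n, N (b n) * s ^+ n <= M.
  move=> sm; have s0 : 0 < s by lra.
  have [K hK] := ha s s0; exists (K * (N m / s)) => n.
  have ms : N m <= s / 2 by lra.
  have := hK n.+1 m ms; rewrite fm sub0r normcN exprS mulrA => h.
  rewrite /b normcf_div normcX mulrAC ler_pdivrMr ?exprn_gt0//.
  rewrite -ler_pdivlMr ?exprn_gt0// -[leRHS]mulrA -exprVn -exprMn; exact: h.
have hb s : 0 < s -> exists M : R, forall n, N (b n) * s ^+ n <= M.
  move=> s0; have [M hM] := hb0 (s + 2 * N m) (ler_wpDl (ltW s0) (lexx _)).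
  exists M => n; apply: le_trans (hM n); apply: ler_wpM2l; first exact: normc_ge0.
  by apply: lerXn2r; rewrite ?nnegrE; lra.
have [g hg] := coef_function hb; exists g.
  apply: (@taylor_centire _ b) => s s0; have [M hM] := hb _ s0.
  by exists (2 * M); exact: hg.
move=> z; apply/eqP; rewrite -subr_eq0; apply/eqP.
pose s := 2 * (N z + N m) + 1.
have z0 := normc_ge0 z.
have s0 : 0 < s by rewrite /s; lra.
have zs : N z <= s / 2 by rewrite /s; lra.
have [M hM] := hb _ s0; have [K hK] := ha _ s0.
have K0 := taylor_ge0 s0 hK.
apply: (@geo_zero _ (K + N (1 - z / m) * (2 * M) + N (z / m) * M) _ (ratio_half s0 zs)) => n.
(* An exact identity between partial sums; its last term is an error bounded by the decay of [b]. *)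
have psE : psum a n.+1 z = (1 - z / m) * psum b n.+1 z + b n * z ^+ n.+1 / m.
  elim: n => [|n IH].
    by rewrite /psum /b !big_ord_recr !big_ord0 /= /psum big_ord_recr big_ord0 /=; field.
  rewrite /psum big_ord_recr [in RHS]big_ord_recr /= -/(psum a n.+1 z) -/(psum b n.+1 z) IH.
  have -> : b n.+1 = b n / m + a n.+1.
    rewrite /b /psum [in LHS]big_ord_recr /= mulrDl -/(psum a n.+1 m) mulfK ?expf_neq0//.
    by rewrite exprS invfM; ring.
  by rewrite !exprS; field.
have -> : f z - (1 - z / m) * g z = (f z - psum a n.+1 z) -
    (1 - z / m) * (g z - psum b n.+1 z) + (z / m) * (b n * z ^+ n).
  by rewrite psE exprS; field.
have /andP[q0 q1] := ratio_half s0 zs.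
have qn : 0 <= (N z / s) ^+ n by rewrite exprn_ge0.
have qS : (N z / s) ^+ n.+1 <= (N z / s) ^+ n by rewrite exprS ler_piMl// ltW.
rewrite 2!(mulrDl _ _ ((N z / s) ^+ n)); apply: le_trans (le_normcD _ _) _; apply: lerD; last first.
  rewrite Normc.normcM -[leRHS]mulrA; apply: ler_wpM2l; first exact: normc_ge0.
  rewrite Normc.normcM normcX exprMn exprVn mulrA ler_pdivlMr ?exprn_gt0//.
  by rewrite mulrAC; apply: ler_wpM2r; [rewrite exprn_ge0|exact: hM].
apply: le_trans (ler_normcB _ _) _; apply: lerD.
  by apply: le_trans (hK _ _ zs) _; exact: ler_wpM2l.
rewrite Normc.normcM -[leRHS]mulrA; apply: ler_wpM2l; first exact: normc_ge0.
apply: le_trans (hg _ _ s0 hM n.+1 z zs) _; apply: ler_wpM2l => //.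
by have := hM 0%N; rewrite expr0 mulr1; have := normc_ge0 (b 0%N); lra.
Qed.

End entire_functions.

(** * Hadamard factorization in exponential type zero *)

Section borel_caratheodory.
Variable R : realType.
Local Notation C := R[i].
Local Notation N := (@Normc.normc R).
Implicit Types (f g : C -> C) (z w : C) (a b : nat -> C) (r q K s : R).

Lemma cderiv_ray f z d (t : R) : cderiv f (t%:C * z) d ->
  is_derive t 1 (fun u : R => complex.Re (f (u%:C * z))) (complex.Re (d * z)) /\
  is_derive t 1 (fun u : R => complex.Im (f (u%:C * z))) (complex.Im (d * z)).
Proof.
move=> hd; have P (p : C -> R) : (forall x y, p (x - y) = p x - p y) ->
    (forall (k : R) x, p (k%:C * x) = k * p x) -> (forall x, `|p x| <= N x) ->
    is_derive t 1 (fun u : R => p (f (u%:C * z))) (p (d * z)).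
  move=> pB pZ pN; have h : (fun h : R => h^-1 *: (p (f ((h *: 1 + t)%:C * z)) -
      p (f (t%:C * z)))) @ 0^' --> p (d * z).
    apply/cvgrPdist_le => e e0.
    have nz : 0 < N z + 1 by rewrite ltr_wpDl// normc_ge0.
    have e1 : 0 < e / (N z + 1) by rewrite divr_gt0.
    have [r r0 hr] := hd _ e1.
    near=> h; have h0 : h != 0 by near: h; exact: nbhs_dnbhs_neq.
    have hn : 0 < `|h| by rewrite normr_gt0.
    have hh : N (h%:C * z) < r.
      rewrite Normc.normcM normc_real; apply: (@le_lt_trans _ _ (`|h| * (N z + 1))).
        by apply: ler_wpM2l => //; rewrite lerDl.
      rewrite -ltr_pdivlMr//; near: h; apply: dnbhs0_lt; rewrite divr_gt0//.
    have := hr _ hh; rewrite -mulrDl -rmorphD /=.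
    rewrite [h *: 1](_ : _ = h); last by rewrite /GRing.scale /= mulr1.
    rewrite [t + h]addrC => h1.
    rewrite /GRing.scale /= (_ : p (d * z) - _ = - (h^-1 *
      p (f ((h + t)%:C * z) - f (t%:C * z) - d * (h%:C * z)))); last first.
      by rewrite !pB mulrCA pZ; field.
    rewrite normrN normrM normfV ler_pdivrMl//; apply: le_trans (pN _) _.
    apply: le_trans h1 _; rewrite Normc.normcM normc_real.
    rewrite mulrCA; apply: ler_wpM2l => //.
    rewrite mulrAC ler_pdivrMr//; apply: ler_wpM2l; first exact: ltW.
    by rewrite lerDl.
  have dv : derivable (fun u : R => p (f (u%:C * z))) t 1.
    by apply/cvg_ex; exists (p (d * z)).
  by apply: DeriveDef => //; exact: cvg_lim.
split; apply: P.
- by move=> x y; rewrite ReD ReN.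
- by move=> k x; rewrite ReM /= mul0r subr0.
- exact: normc_ge_Re.
- by move=> x y; rewrite ImD ImN.
- by move=> k x; rewrite ImM /= mul0r addr0.
- exact: normc_ge_Im.
Unshelve. all: by end_near. Qed.

(* Along rays, [ln |f|] and the real part of a primitive [g] of [f' / f] have the
   same derivative. *)
Lemma ln_normc_primitive f f1 g g1 z :
  (forall t : R, 0 <= t <= 1 -> cderiv f (t%:C * z) (f1 (t%:C * z))) ->
  (forall t : R, 0 <= t <= 1 -> cderiv g (t%:C * z) (g1 (t%:C * z))) ->
  (forall t : R, 0 <= t <= 1 -> f (t%:C * z) != 0) ->
  (forall t : R, 0 <= t <= 1 -> g1 (t%:C * z) * f (t%:C * z) = f1 (t%:C * z)) ->
  ln (N (f z)) - complex.Re (g z) = ln (N (f 0)) - complex.Re (g 0).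
Proof.
move=> hf hg f0 hL.
pose u (t : R) := complex.Re (f (t%:C * z)); pose v (t : R) := complex.Im (f (t%:C * z)).
pose m (t : R) := u t ^+ 2 + v t ^+ 2.
pose ps (t : R) := ln (m t) - 2 * complex.Re (g (t%:C * z)).
have mE t : m t = N (f (t%:C * z)) ^+ 2 by rewrite sqr_normcE.
have m0 t : 0 <= t <= 1 -> 0 < m t.
  by move=> /f0 h; rewrite mE exprn_gt0// normc_gt0.
have dps (t : R) : 0 <= t <= 1 -> is_derive t 1 ps 0.
  move=> ht; have [du dv] := cderiv_ray (hf t ht); have [dg _] := cderiv_ray (hg t ht).
  set w := t%:C * z in du dv dg *.
  have dm : is_derive t 1 m (2 * (u t * complex.Re (f1 w * z) + v t * complex.Im (f1 w * z))).
    have du' : is_derive t 1 u (complex.Re (f1 w * z)) := du.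
    have dv' : is_derive t 1 v (complex.Im (f1 w * z)) := dv.
    have h := is_deriveD (is_deriveM du' du') (is_deriveM dv' dv').
    rewrite (_ : m = u * u + v * v); last first.
      by apply/funext => x; rewrite /m !expr2.
    apply: (@is_derive_eq _ _ _ _ _ _ _ _ h); rewrite /GRing.scale /=; ring.
  have dl : is_derive t 1 (fun t => ln (m t)) ((m t)^-1 * (2 * (u t * complex.Re (f1 w * z) + v t * complex.Im (f1 w * z)))).
    have h := is_derive1_ln (m0 t ht).
    exact: (is_derive1_comp (f := @ln R) (g := m) (x := t)).
  apply: trigger_derive; rewrite /GRing.scale /=.
  have mn : m t != 0 by rewrite gt_eqF// m0.
  rewrite -(hL t ht) -/w.
  have -> : u t = complex.Re (f w) by [].
  have -> : v t = complex.Im (f w) by [].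
  have e : complex.Re (f w) * complex.Re (g1 w * f w * z) +
      complex.Im (f w) * complex.Im (g1 w * f w * z) = m t * complex.Re (g1 w * z).
    rewrite /m /u /v -/w; case: (f w) (g1 w) (z) => [x1 x2] [y1 y2] [z1 z2] /=; ring.
  by rewrite e; field.
have : ps 1 = ps 0.
  have cps : {within `[0, 1], continuous ps}.
    apply: derivable_within_continuous => t; rewrite in_itv/= => /dps[]//.
  have dps' (t : R) : t \in `]0, 1[%R -> is_derive t 1 ps 0.
    by rewrite in_itv/= => /andP[h1 h2]; apply: dps; rewrite !ltW.
  have [c _] := MVT ltr01 dps' cps; rewrite mul0r => /eqP.
  by rewrite subr_eq0 => /eqP.
have e1 : 1%:C * z = z by rewrite mul1r.
have e0 : 0%:C * z = 0 by rewrite mul0r.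
have := m0 0; have := m0 1; rewrite !mE e1 e0 !lexx ler01 => /(_ isT) p1 /(_ isT) p0.
rewrite /ps !mE e1 e0.
have q1 : 0 < N (f z) by rewrite lt_def normc_ge0 andbT; apply: contraTneq p1 => ->; rewrite expr0n ltxx.
have q0 : 0 < N (f 0) by rewrite lt_def normc_ge0 andbT; apply: contraTneq p0 => ->; rewrite expr0n ltxx.
rewrite !expr2 !lnM ?posrE//; lra.
Qed.

(** Borel-Caratheodory: for the primitive [G] of [f' / f], the real part of [ln B - G] is
    [ln B - ln (N (f z))], which is nonnegative, and Harnack's inequality applies to it. The
    expansion of [f' / f] takes radius [r / 2], the primitive [r / 16], Harnack [r / 32]; the
    constant is [64 = 4 * 16]. *)
Lemma ln_normc_bound f (r B : R) : centire f -> f 0 = 1 -> 0 < r -> 1 <= B ->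
  (forall z, N z <= r -> f z != 0) -> (forall z, N z <= r -> N (f z) <= B) ->
  forall z, N z <= r / 32 -> `|ln (N (f z))| <= 64 * ln B * (N z / r).
Proof.
move=> hf f0 r0 B1 fn0 fB.
have [f1 df1 hf1] := centire_derivative hf.
pose s := r / 2; have s0 : 0 < s by rewrite /s; lra.
pose L w := f1 w / f w.
have hL w : inrect (- s) s (- s) s w -> cdiff L w.
  move=> [/andP[w1 w2] /andP[w3 w4]]; apply: cdiffM; first exact: hf1.
  apply: cdiffV; last exact: hf.
  apply: fn0; apply: le_trans (normc_le_ReIm _) _.
  have a1 : `|complex.Re w| <= s by rewrite ler_norml w1.
  have a2 : `|complex.Im w| <= s by rewrite ler_norml w3.
  by rewrite /s in a1 a2; lra.
have [l [K hK]] := cauchy_taylor s0 hL; have K0 := taylor_ge0 s0 hK.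
(* The termwise primitive of [f1 / f], vanishing at 0. *)
pose g (k : nat) : C := if k is k'.+1 then l k' / k'.+1%:R else 0.
have dg : dcoef g =1 l.
  by move=> k; rewrite /dcoef /g mulrC divfK// pnatr_eq0.
have hg k : N (g k) * s ^+ k <= 2 * K * s.
  case: k => [|k]; first by rewrite Normc.normc0 mul0r; rewrite !mulr_ge0// ltW.
  rewrite /g exprSr mulrA ler_pM2r//; apply: le_trans _ (taylor_coef k s0 hK).
  apply: ler_wpM2r; first by rewrite exprn_ge0// ltW.
  rewrite normcf_div normc_natr ler_pdivrMr//.
  by rewrite ler_peMr ?normc_ge0// ler1n.
have [G hG] : exists G, taylor G g s (2 * (2 * K * s)).
  have : forall z, exists v, N z <= s / 2 -> forall n, N (v - psum g n z) <= 2 * (2 * K * s) * (N z / s) ^+ n.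
    move=> z; have [zs|] := boolP (N z <= s / 2); last by move=> _; exists 0.
    by have [v hv] := psum_limit s0 hg zs; exists v.
  by move=> /choice[G hG]; exists G => n z zs; exact: hG.
have hK' : taylor L (dcoef g) s K.
  by rewrite (_ : dcoef g = l)//; apply/funext.
have G0 : G 0 = 0.
  have s20 : 0 <= s / 2 by lra.
  by rewrite (pser0 s20 (@half01 R) (taylor_pser s0 (lexx _) hG)).
have ReG z : N z <= s / 8 -> ln (N (f z)) = complex.Re (G z).
  move=> zs; have tz (t : R) : 0 <= t <= 1 -> N (t%:C * z) <= s / 8.
    move=> /andP[t0 t1]; rewrite Normc.normcM normc_real ger0_norm//.
    by apply: le_trans zs; rewrite ler_piMl ?normc_ge0.
  have := @ln_normc_primitive f f1 G L z; rewrite f0 G0 Normc.normc1 ln1 subrr.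
  have fz t : 0 <= t <= 1 -> f (t%:C * z) != 0.
    by move=> /tz h; apply: fn0; apply: le_trans h _; rewrite /s; lra.
  have h : forall x y : R, x - y = 0 -> x = y by move=> x y /eqP; rewrite subr_eq0 => /eqP.
  move=> H; apply: h; apply: H => t ht.
  - exact: df1.
  - by apply: (taylor_deriv s0 hG hK'); exact: tz.
  - exact: fz.
  - by rewrite /L divfK// fz.
pose A := ln B.
have rs : 0 < s / 8 by lra.
pose H z := A%:C - G z.
pose hc (k : nat) := (if k is 0%N then A%:C else 0) - g k.
have hH : pser H hc (s / 8) 2^-1 (`|A| + 2 * (2 * K * s)).
  move=> n z zs; have zs2 : N z <= s / 2 by lra.
  pose cA : C := if n is 0%N then 0 else A%:C.
  have psh : psum hc n z = cA - psum g n z.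
    rewrite /psum /hc; under eq_bigr do rewrite mulrBl; rewrite sumrB; congr (_ - _).
    rewrite /cA; case: n {cA} => [|n]; first by rewrite big_ord0.
    rewrite big_ord_recl /= expr0 mulr1 big1 ?addr0// => k _; rewrite ?mul0r//.
  have hG' := hG n z zs2.
  have t1 : (N z / s) ^+ n <= 2^-1 ^+ n.
    have /andP[q0 _] := ratio_half s0 zs2.
    by apply: lerXn2r; rewrite ?nnegrE ?invr_ge0// ler_pdivrMr//; lra.
  rewrite psh /H [X in N X](_ : _ = (A%:C - cA) - (G z - psum g n z)); last by ring.
  apply: le_trans (ler_normcB _ _) _; rewrite mulrDl; apply: lerD.
    rewrite /cA; case: n {psh hG' t1 cA} => [|n]; first by rewrite subr0 expr0 mulr1 normc_real.
    by rewrite subrr Normc.normc0 mulr_ge0// exprn_ge0// invr_ge0.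
  apply: le_trans hG' _; apply: ler_wpM2l => //.
  by rewrite !mulr_ge0// ltW.
have posH z : N z = s / 8 -> 0 <= complex.Re (H z).
  move=> zs; rewrite ReD ReN /= -ReG ?zs// subr_ge0.
  have zr : N z <= r by rewrite zs /s; lra.
  rewrite ler_ln ?posrE; first exact: fB.
    by rewrite normc_gt0 fn0.
  by lra.
have [A0 hb] := pser_harnack rs (half01 R) hH posH.
move=> z zr; have zs : N z <= s / 8 / 2 by rewrite /s; lra.
have := hb z zs; rewrite /H G0 subr0 /= addrAC subrr add0r normcN => hz.
rewrite ReG; last by lra.
apply: le_trans (normc_ge_Re _) _; apply: le_trans hz _.
rewrite /s /A le_eqVlt; apply/orP; left; apply/eqP; field.
by rewrite gt_eqF.
Qed.

Definition type_zero f := forall e : R, 0 < e -> exists M : R, forall z,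
  N (f z) <= M * expR (e * N z).

Definition zprod (s : seq C) z : C := \prod_(m <- s) (1 - z / m).

Lemma zprod_ge1 (s : seq C) (r : R) z : 0 < r ->
  (forall m, m \in s -> m != 0 /\ N m <= r) -> N z = 4 * r -> 1 <= N (zprod s z).
Proof.
move=> r0 hs hz; rewrite /zprod normc_prod big_seq.
apply: (big_ind (fun x : R => 1 <= x)) => // [x y hx hy|m /hs[m0 mr]].
  by rewrite -[1]mulr1; apply: ler_pM.
have nm : 0 < N m by rewrite normc_gt0.
have : N (z / m) - 1 <= N (1 - z / m).
  by have := ler_normc_sub (z / m) 1; rewrite normcB Normc.normc1.
apply: le_trans; rewrite normcf_div hz lerBrDr ler_pdivlMr//; lra.
Qed.

(** On the circle of radius [4 * r] every factor [1 - z / m] has modulus at least 3, so [g] is no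
    larger than [f] there; the bound then moves inside by [centire_max]. *)
Lemma zprod_factor_bound f g (s : seq C) (r B : R) : centire g -> 0 < r ->
  (forall m, m \in s -> m != 0 /\ N m <= r) ->
  (forall z, f z = zprod s z * g z) -> (forall z, N z = 4 * r -> N (f z) <= B) ->
  forall z, N z <= 2 * r -> N (g z) <= 2 * B.
Proof.
move=> hg r0 hs fg hB z zr; have r4 : 0 < 4 * r by lra.
apply: (centire_max hg r4); last by lra.
move=> w hw; apply: le_trans (hB w hw); rewrite fg Normc.normcM.
by rewrite ler_peMl ?normc_ge0//; exact: zprod_ge1 hs hw.
Qed.

Lemma seq_normc_bound (s : seq C) : exists2 r : R, 0 < r & forall m, m \in s -> N m <= r.
Proof.
elim: s => [|m s [r r0 hr]]; first by exists 1.
exists (r + N m); first by rewrite ltr_wpDr// normc_ge0.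
move=> w; rewrite inE => /predU1P[->|/hr h]; first by rewrite lerDr ltW.
by apply: le_trans h _; rewrite lerDl normc_ge0.
Qed.

(** With [r0] bounding the zeros, the previous lemma is used at the radius [r0 + N z / 2], adapted
    to [z]. This doubles the exponential rate, hence the start from [e / 2]. *)
Lemma type_zero_div f g (s : seq C) : centire g -> type_zero f ->
  (forall m, m \in s -> m != 0) -> (forall z, f z = zprod s z * g z) -> type_zero g.
Proof.
move=> hg hf hs fg e e0; have e2 : 0 < e / 2 by lra.
have [M hM] := hf _ e2; have [r0 r00 hr] := seq_normc_bound s.
have M0 : 0 <= M.
  by have := hM 0; rewrite Normc.normc0 mulr0 expR0 mulr1; apply: le_trans; exact: normc_ge0.
exists (2 * M * expR (2 * e * r0)) => z.
pose r := r0 + N z / 2; have z0 := normc_ge0 z.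
have rr : 0 < r by rewrite /r; lra.
apply: le_trans (_ : _ <= 2 * (M * expR (e / 2 * (4 * r)))) _.
  apply: (@zprod_factor_bound f g s r) => //.
  - by move=> m ms; split; [exact: hs|apply: le_trans (hr _ ms) _; rewrite /r; lra].
  - by move=> w <-; exact: hM.
  - by rewrite /r; lra.
rewrite -!mulrA -expRD !mulrA; apply: ler_wpM2l; first by rewrite mulr_ge0.
by rewrite ler_expR /r; lra.
Qed.

(** Once the zeros in the disc of radius [r] are removed, [ln] of the maximum of the quotient is at
    most [ln (2 * M) + 4 * e * r]. Borel-Caratheodory multiplies this by a constant times [N z / r];
    type zero makes [e] arbitrary and a large [r] kills the rest. The bound is uniform in [s] and
    [g], so no infinite factorization is required. *)
Lemma hadamard_core f z (d : R) : type_zero f -> f 0 = 1 -> 0 < d ->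
  exists2 r0 : R, 0 < r0 & forall r (s : seq C) g, r0 <= r -> centire g ->
    (forall m, m \in s -> m != 0 /\ N m <= r) ->
    (forall w, f w = zprod s w * g w) -> (forall w, N w <= r -> g w != 0) ->
    `|ln (N (g z))| <= d.
Proof.
move=> hf f0 d0; have z0 := normc_ge0 z.
pose Z := N z + 1; have Z0 : 0 < Z by rewrite /Z; lra.
(* The constant 512 is twice [64 * 4], so that the term from the exponential rate is at most
   [d / 2]. *)
pose e := d / (512 * Z); have Z5 : 0 < 512 * Z by lra.
have e0 : 0 < e by exact: divr_gt0.
have [M0 hM0] := hf _ e0; pose M := `|M0| + 1.
have M1 : 1 <= M by rewrite /M lerDr.
have hM w : N (f w) <= M * expR (e * N w).
  apply: le_trans (hM0 w) _; apply: ler_wpM2r; first exact: expR_ge0.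
  by have := ler_norm M0; rewrite /M; lra.
have lM : 0 <= ln (2 * M) by rewrite ln_ge0//; lra.
have q0 : 0 <= 128 * ln (2 * M) * Z / d.
  by apply: divr_ge0; [apply: mulr_ge0; [apply: mulr_ge0|]|]; rewrite // ltW.
(* The first summand puts [z] into the disc of radius [r / 32], the second makes the term with
   [ln (2 * M)] at most [d / 2]. *)
exists (32 * Z + 128 * ln (2 * M) * Z / d); first by lra.
move=> r s g hr hg hs fg g0.
have r0 : 0 < r by lra.
pose B := 2 * (M * expR (e * (4 * r))).
have gB w : N w <= r -> N (g w) <= B.
  move=> hw; apply: (@zprod_factor_bound f g s r) => //; last by lra.
  by move=> v <-; exact: hM.
have E1 : 1 <= expR (e * (4 * r)).
  by rewrite -expR0 ler_expR mulr_ge0 ?ltW// mulr_gt0.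
have B1 : 1 <= B by rewrite /B; nra.
have g00 : g 0 = 1.
  have := fg 0; rewrite f0 /zprod big1 ?mul1r// => m _.
  by rewrite mul0r subr0.
have Zr : 32 * Z <= r by lra.
have zr : N z <= r / 32 by move: Zr; rewrite /Z; lra.
apply: le_trans (ln_normc_bound hg g00 r0 B1 g0 gB zr) _.
have lnB : ln B = ln (2 * M) + e * (4 * r).
  rewrite /B mulrA lnM ?posrE ?expR_gt0 ?expRK//; lra.
rewrite lnB (_ : _ * (N z / r) = 64 * (ln (2 * M) + e * (4 * r)) * N z / r); last by ring.
rewrite ler_pdivrMr//.
have h1 : 64 * ln (2 * M) * N z <= d / 2 * r.
  have hq : 128 * ln (2 * M) * Z / d <= r by lra.
  rewrite ler_pdivrMr// in hq.
  have : ln (2 * M) * N z <= ln (2 * M) * Z by apply: ler_wpM2l => //; rewrite /Z; lra.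
  lra.
have h2 : 64 * (e * (4 * r)) * N z <= d / 2 * r.
  have eZ : e * Z = d / 512 by rewrite /e; field; rewrite gt_eqF.
  have : e * N z <= e * Z by apply: ler_wpM2l; [exact: ltW|rewrite /Z; lra].
  rewrite eZ => h3; have := ler_wpM2r (ltW r0) h3; lra.
lra.
Qed.

End borel_caratheodory.

(** * Real-rooted functions *)

Section real_rooted.
Variable R : realType.
Local Notation C := R[i].
Local Notation N := (@Normc.normc R).
Implicit Types (f g : C -> C) (z w : C) (r K : R).

Lemma zprod_cons m s z : zprod (m :: s) z = (1 - z / m) * zprod s z :> C.
Proof. by rewrite /zprod big_cons. Qed.

Lemma zprod_ge3 (s : seq C) r z : 0 < r ->
  (forall m, m \in s -> m != 0 /\ N m <= r) -> N z = 4 * r -> 3 ^+ size s <= N (zprod s z).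
Proof.
move=> r0 + hz; elim: s => [|m s IH] hs.
  by rewrite /zprod big_nil Normc.normc1 expr0.
rewrite zprod_cons Normc.normcM /= exprS; apply: ler_pM; rewrite ?exprn_ge0//.
  have [m0 mr] := hs m (mem_head _ _); have nm : 0 < N m by rewrite normc_gt0.
  have : N (z / m) - 1 <= N (1 - z / m).
    by have := ler_normc_sub (z / m) 1; rewrite normcB Normc.normc1.
  by apply: le_trans; rewrite normcf_div hz lerBrDr ler_pdivlMr//; lra.
by apply: IH => w ws; apply: hs; rewrite inE ws orbT.
Qed.

(** Extracting [n] zeros leaves a quotient with value 1 at 0 and modulus at most [K / 3 ^ n] on the
    circle of radius [4 * r], which is impossible for large [n]. The extraction therefore stops,
    multiplicities included. *)
Lemma zprod_exists f r : centire f -> f 0 = 1 -> 0 < r ->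
  exists s g, [/\ centire g, forall m, m \in s -> m != 0 /\ N m <= r,
    forall z, f z = zprod s z * g z & forall z, N z <= r -> g z != 0].
Proof.
move=> hf f0 r0; apply: contrapT => nex.
have r8 : 0 < 8 * r by lra.
have [a ha] := centire_taylor hf; have [K hK] := ha _ r8.
have fB z : N z = 4 * r -> N (f z) <= K.
  move=> hz; have := hK 0%N z; rewrite /psum big_ord0 subr0 expr0 mulr1; apply.
  by rewrite hz; lra.
have lists n : exists s g, [/\ size s = n, centire g,
    forall m, m \in s -> m != 0 /\ N m <= r & forall z, f z = zprod s z * g z].
  elim: n => [|n [s [g [sn hg hs fg]]]].
    by exists [::], f; split=> // z; rewrite /zprod big_nil mul1r.
  have [m mr gm] : exists2 m, N m <= r & g m = 0.
    apply: contrapT => h; apply: nex; exists s, g; split=> // z zr.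
    by apply/eqP => gz; apply: h; exists z.
  have m0 : m != 0.
    apply: contra_eq_neq gm => ->; have := fg 0.
    rewrite f0 /zprod big1 ?mul1r => [<-|w _]; first exact: oner_neq0.
    by rewrite mul0r subr0.
  have [h hh gh] := centire_div hg m0 gm.
  exists (m :: s), h; split=> //; first by rewrite /= sn.
    by move=> w; rewrite inE => /predU1P[->|/hs].
  by move=> z; rewrite zprod_cons fg gh; ring.
have K0 : 0 <= K.
  have r4 : N (4 * r)%:C = 4 * r by rewrite normc_real ger0_norm//; lra.
  by have := fB _ r4; apply: le_trans; exact: normc_ge0.
have [n hn] : exists n, 2 * K < 3 ^+ n.
  have K2 : 0 <= 2 * K by lra.
  exists (Num.bound (2 * K)); apply: lt_le_trans (archi_boundP K2) _.
  by rewrite -natrX ler_nat ltnW// ltn_expl.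
have [s [g [sn hg hs fg]]] := lists n.
have r4 : 0 < 4 * r by lra.
have := @centire_max R g _ (K / 3 ^+ n) hg r4.
have p3 : 0 < 3 ^+ n :> R by rewrite exprn_gt0.
have hb z : N z = 4 * r -> N (g z) <= K / 3 ^+ n.
  move=> hz; rewrite ler_pdivlMr// mulrC; apply: le_trans (fB z hz).
  rewrite fg Normc.normcM -sn; apply: ler_wpM2r; first exact: normc_ge0.
  exact: zprod_ge3 hs hz.
have r2 : N (0 : C) <= 4 * r / 2 by rewrite Normc.normc0; lra.
move=> /(_ hb 0 r2).
have g0 : g 0 = 1.
  have := fg 0; rewrite f0 /zprod big1 ?mul1r// => m _.
  by rewrite mul0r subr0.
rewrite g0 Normc.normc1 mulrA ler_pdivlMr// mul1r leNgt hn.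
by [].
Qed.

Definition imag (y : R) : C := 0 +i* y.

Lemma zprod_imag_ge1 (s : seq C) (y : R) : (forall m, m \in s -> complex.Im m = 0) ->
  1 <= N (zprod s (imag y)).
Proof.
elim: s => [|m s IH] hs; first by rewrite /zprod big_nil Normc.normc1.
rewrite zprod_cons Normc.normcM -[1]mulr1; apply: ler_pM => //; last first.
  by apply: IH => w ws; apply: hs; rewrite inE ws orbT.
have m_real := hs m (mem_head _ _).
apply: le_trans (normc_ge_Re _).
have -> : complex.Re (1 - imag y / m) = 1.
  by move: m_real; case: (m) => a b /= ->; rewrite /imag /= !(mul0r, oppr0, mulr0, subr0, addr0).
by rewrite normr1.
Qed.

(** For real [m] the factor [1 - imag y / m] has real part 1, hence modulus at least 1, and by
    [hadamard_core] the remaining factor has modulus arbitrarily close to 1. *)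
Lemma real_rooted_imag f (y : R) : centire f -> type_zero f -> f 0 = 1 ->
  (forall z, f z = 0 -> complex.Im z = 0) -> 1 <= N (f (imag y)).
Proof.
move=> hf tf f0 hr.
have fn0 : f (imag y) != 0.
  apply/eqP => h; have := hr _ h; rewrite /imag /= => y0.
  by move: h; rewrite y0 f0 => /eqP; rewrite oner_eq0.
have p : 0 < N (f (imag y)) by rewrite normc_gt0.
rewrite -ler_ln ?posrE// ln1; apply/ler_addgt0Pl => d d0.
have [r0 r00 hr0] := hadamard_core (imag y) tf f0 d0.
have [s [g [hg hs fg g0]]] := zprod_exists hf f0 r00.
have := hr0 _ _ _ (lexx _) hg hs fg g0.
have s_real m : m \in s -> complex.Im m = 0.
  move=> ms; apply: hr; rewrite fg /zprod (big_rem m)//= divff ?subrr ?mul0r//.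
  by have [] := hs m ms.
have z1 := zprod_imag_ge1 y s_real.
move: p; rewrite fg Normc.normcM => p.
have gp : 0 < N (g (imag y)) by move: p; rewrite pmulr_rgt0//; lra.
have zp : 0 < N (zprod s (imag y)) by lra.
rewrite lnM ?posrE// ler_norml => /andP[h _].
have := ln_ge0 z1; lra.
Qed.

(** The quotient by finitely many zeros is again real-rooted of type zero, so it too has modulus at
    least 1 on the imaginary axis; hence the last inequality. *)
Lemma real_rooted_zprod f r : centire f -> type_zero f -> f 0 = 1 ->
  (forall z, f z = 0 -> complex.Im z = 0) -> 0 < r ->
  exists s g, [/\ centire g,
    forall m, m \in s -> [/\ m != 0, N m <= r & complex.Im m = 0],
    forall z, f z = zprod s z * g z, forall z, N z <= r -> g z != 0 &
    forall y, N (zprod s (imag y)) <= N (f (imag y))].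
Proof.
move=> hf tf f0 hr r0; have [s [g [hg hs fg g0]]] := zprod_exists hf f0 r0.
have s_real m : m \in s -> complex.Im m = 0.
  move=> ms; apply: hr; rewrite fg /zprod (big_rem m)//= divff ?subrr ?mul0r//.
  by have [] := hs m ms.
exists s, g; split=> //; first by move=> m ms; have [? ?] := hs m ms; split=> //; exact: s_real.
move=> y; rewrite fg Normc.normcM ler_peMr ?normc_ge0//.
apply: real_rooted_imag => //.
- by apply: (type_zero_div hg tf _ fg) => m /hs[].
- have := fg 0; rewrite f0 /zprod big1 ?mul1r// => m _.
  by rewrite mul0r subr0.
- by move=> z gz; apply: hr; rewrite fg gz mulr0.
Qed.

(** The superlevel sets of [u] generate a filter; an ultrafilter finer than it converges to a
    maximizer. The last hypothesis combines closedness of [A] with continuity of [u] on [A]. *)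
Lemma complex_EVT (A : set C) (u : C -> R) (r : R) : A !=set0 ->
  (forall z, A z -> N z <= r) ->
  (forall (T : Type) (U : set_system T) (v : T -> C) l, ProperFilter U ->
     cvgc U v l -> (U [set t | A (v t)]) -> A l /\ (u \o v) @ U --> u l) ->
  exists2 z, A z & forall w, A w -> u w <= u z.
Proof.
move=> [z0 Az0] Ar hA.
pose B (z : C) := [set w | A w /\ u z <= u w].
have PF : ProperFilter (filter_from A B).
  apply: filter_from_proper; last by move=> z Az; exists z; split.
  apply: filter_from_filter; first by exists z0.
  move=> z w Az Aw; have [zw|/ltW wz] := leP (u z) (u w).
    by exists w => // x [Ax h]; split; split=> //; exact: le_trans h.
  by exists z => // x [Ax h]; split; split=> //; exact: le_trans h.
have [U [UU FU]] := @ultraFilterLemma _ _ PF.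
have UA : U A by apply: FU; exists z0 => // w [].
have [l hl] : exists l, cvgc U id l.
  by apply: (@ultra_cvgc _ _ _ _ r); apply: filterS UA => w; exact: Ar.
have [Al ul] := hA _ _ _ _ _ hl UA.
exists l => // w Aw; apply: (cvgr_to_ge ul); apply: FU; exists w => // x [_].
by [].
Qed.

(* At an interior maximum of [|F| ^ 2 + d |z| ^ 2], averaging over small regular
   polygons contradicts [d > 0]. *)
Lemma half_disc_max (F : C -> C) (r : R) : 0 < r ->
  (forall z, 0 <= complex.Re z -> cdiff F z) ->
  (forall z, complex.Re z = 0 -> N (F z) <= 1) ->
  (forall z, 0 <= complex.Re z -> N z = r -> N (F z) <= 1) ->
  forall z, 0 <= complex.Re z -> N z <= r -> N (F z) <= 1.
Proof.
move=> r0 dF hI hr z z0 zr.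
have p1 : 0 <= N (F z) by exact: normc_ge0.
rewrite -[N (F z) <= 1](ler_sqr) ?nnegrE// expr1n.
apply/ler_addgt0Pl => e e0.
(* Chosen so that [d * N w ^+ 2 <= e] on the half disc; the strict positivity of [d] produces the
   contradiction at an interior maximum. *)
pose d := e / r ^+ 2; have d0 : 0 < d by rewrite divr_gt0// exprn_gt0.
pose u w := N (F w) ^+ 2 + d * N w ^+ 2.
pose A := [set w : C | 0 <= complex.Re w /\ N w <= r].
have [m [m0 mr] hm] : exists2 m, A m & forall w, A w -> u w <= u m.
  apply: (@complex_EVT A u r); [by exists z|by move=> w []|].
  move=> T U v l UP vl hv.
  have Al : A l.
    split; last by apply: (cvgc_le vl); apply: filterS hv => t [].
    by apply: (cvgr_to_ge vl.1); apply: filterS hv => t [].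
  split=> //; have Fl : cvgc U (F \o v) (F l).
    apply/cvgcP => x x0; have /ccontP := cdiff_cont (dF l Al.1).
    move=> /(_ _ x0)[y y0 hy]; have /cvgcP /(_ _ y0) := vl.
    by apply: filterS => t /= h; exact: hy.
  have n1 := @cvgc_norm _ _ _ UP _ _ Fl; have n2 := @cvgc_norm _ _ _ UP _ _ vl.
  have hd : (fun _ : T => d) @ U --> d by exact: cvg_cst.
  have h := cvgD (cvgM n1 n1) (cvgM hd (cvgM n2 n2)).
  rewrite (_ : u l = N (F l) * N (F l) + d * (N l * N l)); last by rewrite /u !expr2.
  rewrite (_ : u \o v = fun t => N (F (v t)) * N (F (v t)) + d * (N (v t) * N (v t))) //.
  exact: h.
have um : u m <= 1 + e.
  have hb : N (F m) <= 1 -> u m <= 1 + e.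
    move=> h; apply: lerD; first by rewrite exprn_ile1// normc_ge0.
    rewrite /d mulrAC ler_pdivrMr ?exprn_gt0//; apply: ler_wpM2l; first exact: ltW.
    by apply: lerXn2r; rewrite ?nnegrE ?normc_ge0// ltW.
  have [mre|mre] := eqVneq (complex.Re m) 0; first by apply: hb; exact: hI.
  have [mnr|mnr] := eqVneq (N m) r; first by apply: hb; exact: hr.
  have mp : 0 < complex.Re m by rewrite lt_def m0 andbT.
  have mn : N m < r by rewrite lt_def mr andbT eq_sym.
  exfalso.
  pose s := Num.min (complex.Re m) ((r - N m) / 2) / 2.
  have s0 : 0 < s by rewrite divr_gt0// lt_min mp divr_gt0// subr_gt0.
  have s1 : 2 * s <= complex.Re m by rewrite /s mulrC divfK// ge_min lexx.
  have s2 : 4 * s <= r - N m.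
    have : 2 * s <= (r - N m) / 2 by rewrite /s mulrC divfK// ge_min lexx orbT.
    lra.
  have inA w : N w <= 2 * s -> A (m + w).
    move=> ws; split.
      by rewrite ReD; have := normc_ge_Re w; rewrite ler_norml => /andP[? _]; lra.
    by apply: le_trans (le_normcD _ _) _; lra.
  have dG w : inrect (- s) s (- s) s w -> cdiff (fun w => F (m + w)) w.
    move=> [/andP[w1 w2] /andP[w3 w4]]; apply: cdiff_shift; apply: dF.
    by rewrite ReD; lra.
  have [a [K hK]] := cauchy_taylor s0 dG.
  have s20 : 0 < s / 2 by lra.
  have hp := taylor_pser s0 (lexx _) hK.
  have a0 : F m = a 0%N by have := pser0 (ltW s20) (half01 R) hp; rewrite addr0.
  have key n : d * (s / 2) ^+ 2 <= 0 + (2 * N (F m) * K) * 2^-1 ^+ n.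
    rewrite add0r.
    (* At least two points, so that the roots of unity sum to 0 and the terms linear in the
       displacement average out. *)
    have n20 : (0 < n.+2)%N by [].
    have [x xn] := @prim_root_exists R _ n20.
    have nx j : N (x ^+ j) = 1.
      by rewrite normcX (normc_unity_root n20 (prim_expr_order xn)) expr1n.
    have := ravg_pser s20 hp xn n20; set V := ravg _ _ _; rewrite expr0 mulr1 -a0 => hV.
    have S1 : \sum_(j < n.+2) x ^+ j = 0.
      have := @sum_prim_root R _ _ 1 0 xn isT isT; rewrite /= => h.
      rewrite -[RHS]h.
      by apply: eq_bigr => j _; rewrite expr1 expr0 mulr1.
    (* The square [N y ^+ 2] is minorized by its linearization at [F m]; the result is linear in
       [y], so the average of [F] alone decides. *)
    have each (j : 'I_n.+2) : 2 * complex.Re ((F m)^* * F (m + (s / 2)%:C * x ^+ j)) - N (F m) ^+ 2 +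
        d * (N m ^+ 2 + (s / 2) ^+ 2 + 2 * complex.Re (m^* * ((s / 2)%:C * x ^+ j))) <= u m.
      have ux : N ((s / 2)%:C * x ^+ j) = s / 2.
        by rewrite Normc.normcM nx mulr1 normc_real gtr0_norm.
      have := hm (m + (s / 2)%:C * x ^+ j).
      have sq (p q : C) : N (p + q) ^+ 2 = N p ^+ 2 + N q ^+ 2 + 2 * complex.Re (p^* * q).
        by rewrite !sqr_normcE; case: p q => [p1' p2] [q1 q2] /=; ring.
      have /[swap]/[apply] : A (m + (s / 2)%:C * x ^+ j) by apply: inA; rewrite ux; lra.
      apply: le_trans; rewrite /u (sq m) ux lerD2r.
      set y := F (m + _); have := sqr_ge0 (N (y - F m)).
      have -> : N (y - F m) ^+ 2 = N y ^+ 2 + N (F m) ^+ 2 - 2 * complex.Re ((F m)^* * y).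
        by rewrite !sqr_normcE; case: y (F m) => [p1' p2] [q1 q2] /=; ring.
      lra.
    set k1 := N (F m) ^+ 2 in each; set k2 := N m ^+ 2 + (s / 2) ^+ 2 in each.
    have sumE : \sum_(j < n.+2) (2 * complex.Re ((F m)^* * F (m + (s / 2)%:C * x ^+ j)) - k1 +
        d * (k2 + 2 * complex.Re (m^* * ((s / 2)%:C * x ^+ j)))) =
        2 * complex.Re ((F m)^* * \sum_(j < n.+2) F (m + (s / 2)%:C * x ^+ j)) - k1 *+ n.+2 +
        d * (k2 *+ n.+2).
      rewrite big_split /= sumrB -!mulr_sumr big_split /= -!mulr_sumr -!Re_sum -!mulr_sumr.
      by rewrite S1 !mulr0 addr0 !sumr_const !card_ord /k1 expr2 mulrnAr.
    have sumle : \sum_(j < n.+2) (2 * complex.Re ((F m)^* * F (m + (s / 2)%:C * x ^+ j)) - k1 +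
        d * (k2 + 2 * complex.Re (m^* * ((s / 2)%:C * x ^+ j)))) <= u m *+ n.+2.
      rewrite (_ : u m *+ n.+2 = \sum_(j < n.+2) u m); last by rewrite sumr_const card_ord.
      by apply: ler_sum => j _; exact: each.
    have nC : n.+2%:R != 0 :> C by rewrite pnatr_eq0.
    have SV : \sum_(j < n.+2) F (m + (s / 2)%:C * x ^+ j) = n.+2%:R * V.
      rewrite /V /ravg mulrA mulfV// mul1r; apply: eq_bigr => j _.
      by rewrite expr0 mulr1.
    have M0 : (0 : R) < n.+2%:R by rewrite ltr0n.
    move: sumle; rewrite sumE SV mulrCA -(rmorph_nat (real_complex R)) ReM /= mul0r subr0.
    rewrite -(mulr_natr k1) -(mulr_natr k2) -(mulr_natr (u m)) => sumle.
    have {}sumle : 2 * complex.Re ((F m)^* * V) - k1 + d * k2 <= u m.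
      by rewrite -(ler_pM2r M0); lra.
    have cF : complex.Re ((F m)^* * F m) = k1.
      by rewrite /k1 mulrC mul_conjc.
    have hre : - (N (F m) * (K * 2^-1 ^+ n)) <= complex.Re ((F m)^* * V) - k1.
      have hq : K * 2^-1 ^+ n.+2 <= K * 2^-1 ^+ n.
        apply: ler_wpM2l; first exact: taylor_ge0 hK.
        have : 0 <= (2^-1 : R) ^+ n by rewrite exprn_ge0// invr_ge0.
        by rewrite !exprS; lra.
      have := normc_ge_Re ((F m)^* * (V - F m)).
      rewrite Normc.normcM normc_conj mulrBr ReD ReN cF ler_norml => /andP[h _].
      have := ler_wpM2l (normc_ge0 (F m)) (le_trans hV hq); lra.
    move: sumle; rewrite /u -/k1 /k2; lra.
  have := geo_le (half01 R) key.
  have : 0 < d * (s / 2) ^+ 2 by rewrite mulr_gt0// exprn_gt0.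
  lra.
have := hm z (conj z0 zr); have : 0 <= d * N z ^+ 2.
  by rewrite mulr_ge0 ?sqr_ge0// ltW.
rewrite /u in um *; lra.
Qed.

End real_rooted.

(** * Unconditional infinite products *)

Section infinite_products.
Variable R : realType.
Local Notation C := R[i].
Local Notation N := (@Normc.normc R).
Implicit Types (A B : set R) (u : R -> C) (v w : C) (s t : seq R).

Definition listin A s : Prop := uniq s /\ forall l, l \in s -> A l.

(** The filter of unconditional convergence over [A], on duplicate-free lists so that finite
    products are open to induction. *)
Definition lists A : set_system (seq R) :=
  filter_from (listin A) (fun s0 => [set s | listin A s /\ {subset s0 <= s}]).

Global Instance lists_filter A : ProperFilter (lists A).
Proof.
apply: filter_from_proper; last by move=> s hs; exists s; split.
apply: filter_from_filter; first by exists [::].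
move=> s t [us hs] [ut ht]; exists (undup (s ++ t)).
  split; first exact: undup_uniq.
  by move=> l; rewrite mem_undup mem_cat => /orP[/hs|/ht].
move=> r [hr hst]; split; split=> // l hl; apply: hst;
  by rewrite mem_undup mem_cat hl ?orbT.
Qed.

Definition abs_summable A := (forall l, A l -> l != 0) /\
  exists M : R, forall s, listin A s -> \sum_(l <- s) `|l|^-1 <= M.

Lemma abs_summableS A B : B `<=` A -> abs_summable A -> abs_summable B.
Proof.
move=> BA [n0 [M hM]]; split; first by move=> l /BA; exact: n0.
by exists M => s [us hs]; apply: hM; split=> // l /hs /BA.
Qed.

Lemma lists_near A (P : set (seq R)) : (forall s, listin A s -> P s) -> lists A P.
Proof. by move=> h; exists [::]; [split|move=> s [hs _]; exact: h]. Qed.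

Lemma abs_summable_tail A (e : R) : abs_summable A -> 0 < e ->
  exists2 s0, listin A s0 & forall s, listin A s -> (forall l, l \in s -> l \notin s0) ->
    \sum_(l <- s) `|l|^-1 <= e.
Proof.
move=> [n0 [M hM]] e0.
pose V := [set x : R | exists2 s, listin A s & x = \sum_(l <- s) `|l|^-1].
have Vs : has_sup V.
  split; first by exists 0; exists [::]; rewrite ?big_nil.
  by exists M => x [s hs ->]; exact: hM.
have [_ [s0 hs0 ->] hx] := sup_adherent e0 Vs.
exists s0 => // s hs dis.
have hcat : listin A (s ++ s0).
  split; last by move=> l; rewrite mem_cat => /orP[]; [exact: hs.2|exact: hs0.2].
  rewrite cat_uniq hs.1 hs0.1 andbT /=; apply/hasPn => l ls0.
  by apply/negP => /dis; rewrite ls0.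
have : \sum_(l <- s ++ s0) `|l|^-1 <= sup V.
  by apply: ub_le_sup; [exact: Vs.2|exists (s ++ s0)].
by rewrite big_cat /=; lra.
Qed.

Lemma prod1D_exp (I : Type) (s : seq I) (x : I -> R) : (forall i, 0 <= x i) ->
  \prod_(i <- s) (1 + x i) <= expR (\sum_(i <- s) x i).
Proof.
move=> x0; elim: s => [|i s IH]; first by rewrite !big_nil expR0.
rewrite !big_cons expRD; apply: ler_pM => //.
- by have := x0 i; lra.
- by apply: prodr_ge0 => j _; have := x0 j; lra.
- exact: expR_ge1Dx.
Qed.

Lemma prod1D_sub1 (I : Type) (s : seq I) (u : I -> C) :
  N (\prod_(i <- s) (1 + u i) - 1) <= \prod_(i <- s) (1 + N (u i)) - 1.
Proof.
elim: s => [|i s IH]; first by rewrite !big_nil !subrr Normc.normc0.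
rewrite !big_cons; set P := \prod_(j <- s) _ in IH *; set Q := \prod_(j <- s) _ in IH *.
rewrite (_ : (1 + u i) * P - 1 = (P - 1) + u i * (P - 1) + u i); last by ring.
apply: le_trans (le_normcD _ _) _.
apply: le_trans (lerD (le_normcD _ _) (lexx _)) _; rewrite Normc.normcM.
have := ler_wpM2l (normc_ge0 (u i)) IH; lra.
Qed.

(** By induction, the product [P] and the sum [S] satisfy [P * (1 - S) <= 1]. For [S <= 1 / 2] this
    gives [P <= 2] and [P - 1 <= P * S <= 2 * S]. *)
Lemma prod1D_small (I : Type) (s : seq I) (x : I -> R) : (forall i, 0 <= x i) ->
  \sum_(i <- s) x i <= 1 / 2 -> \prod_(i <- s) (1 + x i) - 1 <= 2 * \sum_(i <- s) x i.
Proof.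
move=> x0 hs.
have H : (\prod_(i <- s) (1 + x i)) * (1 - \sum_(i <- s) x i) <= 1.
  elim: s {hs} => [|i s IH]; first by rewrite !big_nil subr0 mulr1.
  rewrite !big_cons; set P := \prod_(j <- s) _ in IH *; set S := \sum_(j <- s) _ in IH *.
  have P0 : 0 <= P by apply: prodr_ge0 => j _; have := x0 j; lra.
  have S0 : 0 <= S by apply: sumr_ge0 => j _.
  have := x0 i; have := mulr_ge0 (x0 i) (x0 i) => h1 h2.
  have := mulr_ge0 P0 h1; have := mulr_ge0 P0 (mulr_ge0 h2 S0); lra.
set P := \prod_(i <- s) _ in H *; set S := \sum_(i <- s) _ in H hs *.
have S0 : 0 <= S by apply: sumr_ge0 => j _.
nra.
Qed.

Section convergence.
Variables (A : set R) (u : R -> C) (D : R).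
Hypotheses (hA : abs_summable A) (D0 : 0 <= D).
Hypothesis hu : forall l, A l -> N (u l) <= D * `|l|^-1.

Let P s := \prod_(l <- s) (1 + u l).

Lemma listin_sum_le s : listin A s -> \sum_(l <- s) N (u l) <= D * \sum_(l <- s) `|l|^-1.
Proof.
move=> [_ hs]; rewrite mulr_sumr !big_seq; apply: ler_sum => l /hs; exact: hu.
Qed.

Lemma listin_prod_bound (M : R) s : listin A s ->
  (forall s, listin A s -> \sum_(l <- s) `|l|^-1 <= M) -> N (P s) <= expR (D * M).
Proof.
move=> hs hM; rewrite /P normc_prod; apply: (@le_trans _ _ (\prod_(l <- s) (1 + N (u l)))).
  apply: ler_prod => l _; rewrite normc_ge0 /=.
  by apply: le_trans (le_normcD _ _) _; rewrite Normc.normc1.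
apply: le_trans (prod1D_exp _ _) _; first by move=> l; exact: normc_ge0.
rewrite ler_expR; apply: le_trans (listin_sum_le hs) _.
by apply: ler_wpM2l => //; exact: hM.
Qed.

Lemma listin_split s s0 : listin A s -> listin A s0 -> {subset s0 <= s} ->
  P s = P s0 * P [seq l <- s | l \notin s0].
Proof.
move=> [us hs] [us0 hs0] sub.
rewrite /P (bigID (mem s0)) /= -big_filter -[X in _ * X]big_filter; congr (_ * _).
apply: perm_big; apply: uniq_perm => //; first exact: filter_uniq.
move=> l; rewrite mem_filter; case: (boolP (l \in s0)) => //= /sub ->//.
Qed.

(** An ultrafilter supplies a candidate limit. Beyond a finite list [s0] with small tail, all
    partial products lie within [e / 4] of [P s0], so the candidate is the limit along the whole
    filter. *)
Lemma prod_cvg : exists v, cvgc (lists A) P v.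
Proof.
have [n0 [M hM]] := hA; pose B := expR (D * M).
have B0 : 0 < B by exact: expR_gt0.
have [U [UU FU]] := @ultraFilterLemma _ _ (lists_filter A).
have [v hv] : exists v, cvgc U P v.
  apply: (@ultra_cvgc _ _ _ _ B) => //; apply: FU; apply: lists_near => s hs.
  exact: listin_prod_bound.
exists v; apply/cvgcP => e e0.
pose e1 := Num.min (1 / 2) (e / (8 * B)) / (D + 1).
have D1 : 0 < D + 1 by rewrite ltr_wpDl.
have m0 : 0 < Num.min (1 / 2) (e / (8 * B)).
  by rewrite lt_min; apply/andP; split; [lra|rewrite divr_gt0// mulr_gt0].
have e10 : 0 < e1 by rewrite divr_gt0.
have De1 : D * e1 <= Num.min (1 / 2) (e / (8 * B)).
  have : (D + 1) * e1 = Num.min (1 / 2) (e / (8 * B)) by rewrite /e1 mulrC divfK// gt_eqF.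
  by lra.
have [s0 hs0 tail] := abs_summable_tail hA e10.
have close s : listin A s -> {subset s0 <= s} -> N (P s - P s0) <= e / 4.
  move=> hs sub; rewrite (listin_split hs hs0 sub) -[X in _ - X]mulr1 -mulrBr Normc.normcM.
  set t := [seq l <- s | l \notin s0].
  have ht : listin A t.
    split; first by rewrite filter_uniq// hs.1.
    by move=> l; rewrite mem_filter => /andP[_]; exact: hs.2.
  have tt : \sum_(l <- t) N (u l) <= D * e1.
    apply: le_trans (listin_sum_le ht) _; apply: ler_wpM2l => //.
    by apply: tail => // l; rewrite mem_filter => /andP[].
  have [k1 k2] : D * e1 <= 1 / 2 /\ D * e1 <= e / (8 * B).
    by split; apply: le_trans De1 _; rewrite ge_min lexx ?orbT.
  have h1 : N (P t - 1) <= 2 * (e / (8 * B)).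
    apply: le_trans (prod1D_sub1 _ _) _.
    apply: le_trans (prod1D_small _ _) _; first by move=> l; exact: normc_ge0.
      by apply: le_trans tt k1.
    by apply: ler_wpM2l => //; exact: le_trans tt k2.
  apply: le_trans (ler_pM _ _ (listin_prod_bound hs0 hM) h1) _; rewrite ?normc_ge0//.
  rewrite -/B le_eqVlt; apply/orP; left; apply/eqP; field.
  by rewrite gt_eqF.
have v0 : N (v - P s0) <= e / 4.
  apply: (@cvgc_le _ _ U _ (fun s => P s - P s0)).
    by apply: cvgcB => //; exact: cvgc_cst.
  by apply: FU; exists s0 => // s [hs sub]; exact: close.
exists s0 => // s [hs sub] /=.
rewrite (_ : P s - v = (P s - P s0) - (v - P s0)); last by ring.
by apply: le_lt_trans (ler_normcB _ _) _; have := close s hs sub; lra.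
Qed.

(** Beyond a suitable [s0] the product of the further factors stays within 1/2 of 1, so the modulus
    never drops below half that of [P s0], a finite product of nonzero factors. *)
Lemma prod_cvg_neq0 v : (forall l, A l -> 1 + u l != 0) -> cvgc (lists A) P v -> v != 0.
Proof.
move=> u0 hv.
pose e1 := (1 / 4) / (D + 1).
have D1 : 0 < D + 1 by rewrite ltr_wpDl.
have e10 : 0 < e1 by rewrite divr_gt0//; lra.
have De1 : D * e1 <= 1 / 4.
  have : (D + 1) * e1 = 1 / 4 by rewrite /e1 mulrC divfK// gt_eqF.
  by lra.
have [s0 hs0 tail] := abs_summable_tail hA e10.
have p0 : 0 < N (P s0).
  rewrite normc_gt0 /P prodf_seq_neq0; apply/allP => l ls /=.
  by apply: u0; exact: hs0.2.
have low s : listin A s -> {subset s0 <= s} -> N (P s0) / 2 <= N (P s).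
  move=> hs sub; rewrite (listin_split hs hs0 sub) Normc.normcM.
  set t := [seq l <- s | l \notin s0].
  have ht : listin A t.
    split; first by rewrite filter_uniq// hs.1.
    by move=> l; rewrite mem_filter => /andP[_]; exact: hs.2.
  have tt : \sum_(l <- t) N (u l) <= D * e1.
    apply: le_trans (listin_sum_le ht) _; apply: ler_wpM2l => //.
    by apply: tail => // l; rewrite mem_filter => /andP[].
  have h1 : N (P t - 1) <= 1 / 2.
    apply: le_trans (prod1D_sub1 _ _) _.
    have t1 : \sum_(l <- t) N (u l) <= 1 / 2 by lra.
    apply: le_trans (prod1D_small _ t1) _; first by move=> l; exact: normc_ge0.
    lra.
  apply: ler_wpM2l; first exact: ltW.
  have := ler_normc_sub 1 (1 - P t); rewrite subKr Normc.normc1 normcB; lra.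
have : N (P s0) / 2 <= N v.
  have nv := @cvgc_norm _ _ _ (lists_filter A) _ _ hv.
  by apply: (cvgr_to_ge nv); exists s0 => // s [hs sub]; exact: low.
by move=> h; rewrite -normc_gt0; lra.
Qed.

End convergence.

Lemma cvgc_lists_sub A B (F : seq R -> C) v : B `<=` A -> cvgc (lists B) F v ->
  cvgc (lists A) (fun s => F [seq l <- s | l \in B]) v.
Proof.
move=> BA /cvgcP h; apply/cvgcP => e /h[s0 hs0 hh].
exists s0; first by split; [exact: hs0.1|move=> l ls; apply: BA; exact: hs0.2].
move=> s [hs sub]; apply: hh; split.
  split; first by rewrite filter_uniq// hs.1.
  by move=> l; rewrite mem_filter => /andP[]; rewrite inE.
by move=> l ls; rewrite mem_filter sub// andbT inE; exact: hs0.2.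
Qed.

Lemma cvgc_eq_near (T : Type) (U : set_system T) {FU : ProperFilter U}
    (f g : T -> C) l :
  U [set t | f t = g t] -> cvgc U f l -> cvgc U g l.
Proof.
move=> fg /cvgcP h; apply/cvgcP => e /h h'.
by apply: filterS2 fg h' => t /= ->.
Qed.

Lemma prod_cvgU A B u (v w : C) : (forall l, A l -> B l -> False) ->
  cvgc (lists A) (fun s => \prod_(l <- s) (1 + u l)) v ->
  cvgc (lists B) (fun s => \prod_(l <- s) (1 + u l)) w ->
  cvgc (lists (A `|` B)) (fun s => \prod_(l <- s) (1 + u l)) (v * w).
Proof.
move=> dis /(cvgc_lists_sub (@subsetUl _ A B)) hv /(cvgc_lists_sub (@subsetUr _ A B)) hw.
apply: cvgc_eq_near (cvgcM hv hw); apply: lists_near => s [us hs] /=.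
rewrite [RHS](bigID (mem A)) /= !big_filter; congr (_ * _).
rewrite big_seq_cond [RHS]big_seq_cond; apply: eq_bigl => l.
case: (boolP (l \in s)) => //= ls; case: (hs l ls) => h.
  rewrite [l \in A]mem_set// [l \in B]memNset//; exact: dis.
by rewrite [l \in B]mem_set// [l \in A]memNset// => /dis; exact.
Qed.

Lemma prod_cvg_fin s u : uniq s ->
  cvgc (lists [set` s]) (fun s => \prod_(l <- s) (1 + u l)) (\prod_(l <- s) (1 + u l)).
Proof.
move=> us; apply: cvgc_eq_near (cvgc_cst _); exists s; first by split.
move=> t [[ut ht] sub] /=; apply: perm_big; apply: uniq_perm => // l.
by apply/idP/idP => [/sub|/ht].
Qed.

Lemma cvgc_lists_totally A (f : R -> C) v :
  cvgc (lists A) (fun s => \prod_(l <- s) f l) v ->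
  cvgc totally (fun F : {fset R} => \prod_(l <- F | l \in A) f l) v.
Proof.
move=> /cvgcP h; apply/(@cvgcP _ _ _ totally_filter) => e /h[s0 hs0 hh].
exists [fset l in s0]%fset => // F /= sub.
rewrite -big_filter; apply: hh; split.
  split; first by apply: filter_uniq; exact: fset_uniq.
  by move=> l; rewrite mem_filter => /andP[]; rewrite inE.
move=> l ls; rewrite mem_filter; apply/andP; split; first by rewrite inE; exact: hs0.2.
by move/fsubsetP : sub; apply; rewrite inE.
Qed.

Lemma infprodE_complex A (f : R -> C) v :
  cvgc (lists A) (fun s => \prod_(l <- s) f l) v ->
  infprod A (f : R -> Cplx R) = v.
Proof.
move=> /cvgc_lists_totally h.
have FT : ProperFilter (@totally R) := totally_filter.
suff hv : (fun F : {fset R} => \prod_(l <- F | l \in A) (f l : Cplx R)) @ totally -->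
    (v : Cplx R).
  by apply: cvg_lim hv; exact: norm_hausdorff.
apply/cvgrPdist_lt => e e0.
have [e1 e2] : complex.Im e = 0 /\ 0 < complex.Re e.
  by move: e0; rewrite ltcE /= => /andP[/eqP ? ?].
move/(@cvgcP _ _ _ totally_filter) : h => /(_ _ e2); apply: filterS => F /= hF.
rewrite distrC (_ : e = (complex.Re e)%:C); last exact: real_of_Im0.
by rewrite [X in X < _](_ : _ = (N (\prod_(x <- F | x \in A) f x - v))%:C) ?ltcR.
Qed.

Lemma infprodE_real A (f : R -> R) (v : C) :
  cvgc (lists A) (fun s => \prod_(l <- s) (f l)%:C) v ->
  v = (infprod A f)%:C.
Proof.
have FT : ProperFilter (@totally R) := totally_filter.
move=> /cvgc_lists_totally[hr hi].
have e (F : {fset R}) : \prod_(l <- F | l \in A) (f l)%:C = (\prod_(l <- F | l \in A) f l)%:C :> C.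
  by rewrite rmorph_prod.
have {}hr : (fun F : {fset R} => \prod_(l <- F | l \in A) f l) @ totally --> complex.Re v.
  apply: cvg_trans hr; apply: near_eq_cvg; apply: (@nearW _ totally) => F.
  by rewrite /= e.
have {}hi : (fun F : {fset R} => 0 : R) @ totally --> complex.Im v.
  apply: cvg_trans hi; apply: near_eq_cvg; apply: (@nearW _ totally) => F.
  by rewrite /= e.
apply: complex_eqP => /=; first by apply/esym/cvg_lim.
by apply: (@cvg_unique _ _ _ _ _ _ hi) => //; exact: cvg_cst.
Qed.

Lemma abs_summable_esum A : (forall l, A l -> l != 0) ->
  (\esum_(l in A) (1 / `|l|)%:E < +oo)%E -> abs_summable A.
Proof.
move=> n0 hs; split=> //.
have e0 : (0 <= \esum_(l in A) (1 / `|l|)%:E)%E.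
  by apply: esum_ge0 => l _; rewrite lee_fin divr_ge0.
exists (fine (\esum_(l in A) (1 / `|l|)%:E)) => s [us hs'].
rewrite -lee_fin fineK ?ge0_fin_numE//.
apply: esum_ge; exists [set` s].
  by split; [exact: finite_seq|move=> l /= /hs'].
rewrite -fsbig_seq//= -sumEFin le_eqVlt; apply/orP; left; apply/eqP.
by apply: eq_bigr => l _; rewrite mul1r.
Qed.

(** Each point with [|l| <= r] contributes at least [1 / r] to the sum of inverses, so more than
    [M * r] such points would exceed the bound [M]. *)
Lemma abs_summable_list A (r : R) : abs_summable A ->
  exists2 s, uniq s & forall l, (l \in s) = `[< A l /\ `|l| <= r >].
Proof.
move=> [n0 [M hM]]; apply: contrapT => nex.
pose B : set R := [set l | A l /\ `|l| <= r].
have long n : exists2 s, listin B s & size s = n.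
  elim: n => [|n [s hs sn]]; first by exists [::].
  have [l Bl ls] : exists2 l, B l & l \notin s.
    apply: contrapT => h; apply: nex; exists s; first exact: hs.1.
    move=> l; apply/idP/asboolP => [lls|Bl]; first exact: hs.2.
    by apply: contrapT => /negP ls; apply: h; exists l.
  exists (l :: s); last by rewrite /= sn.
  split; first by rewrite /= ls hs.1.
  by move=> m; rewrite inE => /predU1P[->//|]; exact: hs.2.
have M0 : 0 <= M by have := hM [::]; rewrite big_nil; apply.
have [r0|r0] := leP r 0.
  have [s [us hs] sn] := long 1%N; case: s us hs sn => // l [|//] _ hs _.
  have [Al lr] := hs l (mem_head _ _).
  have := n0 l Al; rewrite -normr_gt0; lra.
have [s [us hs] sn] := long (Num.bound (M * r)).
have hA : listin A s by split=> // l /hs[].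
have := hM s hA; apply/negP; rewrite -ltNge.
apply: (@lt_le_trans _ _ (\sum_(l <- s) r^-1)); last first.
  rewrite !big_seq; apply: ler_sum => l /hs[/n0 l0 lr].
  by rewrite lef_pV2 ?posrE// normr_gt0.
rewrite big_const_seq count_predT sn iter_addr_0 -mulr_natl ltr_pdivlMr//.
by apply: archi_boundP; rewrite mulr_ge0// ltW.
Qed.

End infinite_products.

(** * Canonical products of genus zero and their growth *)

Section canonical_products.
Variable R : realType.
Local Notation C := R[i].
Local Notation N := (@Normc.normc R).
Implicit Types (A B : set R) (nu : R -> R) (z w v : C) (s t : seq R).

Definition wfin nu s z : C := \prod_(l <- s) (1 - z / (nu l)%:C).

(* [nu] is the identity, or [fun l => - `|l|] for the majorant [\prod (1 + z / |l|)]. *)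
Definition wprod A nu z : C := xget 0 [set v | cvgc (lists A) (fun s => wfin nu s z) v].

Definition negabs (l : R) : R := - `|l|.

Section fixed.
Variables (A : set R) (nu : R -> R).
Hypotheses (hA : abs_summable A) (hnu : forall l, `|nu l| = `|l|).

Lemma wfactor_bound z l : N (- (z / (nu l)%:C)) <= N z * `|l|^-1.
Proof. by rewrite normcN normcf_div normc_real hnu. Qed.

Lemma wprod_cvg z : cvgc (lists A) (fun s => wfin nu s z) (wprod A nu z).
Proof.
have [v hv] := prod_cvg hA (normc_ge0 z) (fun l _ => wfactor_bound z l).
by apply: (@xgetPex _ 0 [set v | cvgc (lists A) (fun s => wfin nu s z) v]); exists v.
Qed.

Lemma wprod_unique z v : cvgc (lists A) (fun s => wfin nu s z) v -> wprod A nu z = v.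
Proof. by move=> hv; apply: cvgc_unique hv; exact: wprod_cvg. Qed.

Lemma nu_neq0 l : A l -> (nu l)%:C != 0 :> C.
Proof.
move=> /hA.1; rewrite -!normc_eq0 normc_real => l0.
by rewrite hnu normr_eq0.
Qed.

Lemma wprod_neq0 z : (forall l, A l -> z != (nu l)%:C) -> wprod A nu z != 0.
Proof.
move=> hz; apply: (prod_cvg_neq0 hA (normc_ge0 z) (fun l _ => wfactor_bound z l)).
  move=> l Al; rewrite subr_eq0 eq_sym; apply: contra (hz l Al) => /eqP h.
  by rewrite -[z](divfK (nu_neq0 Al)) h mul1r.
exact: wprod_cvg.
Qed.

Lemma wprod0 : wprod A nu 0 = 1.
Proof.
apply: wprod_unique; apply: cvgc_eq_near (cvgc_cst _); apply: lists_near => s _ /=.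
by rewrite /wfin big1 // => l _; rewrite mul0r subr0.
Qed.

Lemma wfin_entire s : centire (wfin nu s).
Proof. by move=> z; apply: cdiff_prod => l _; exact: centire_linear. Qed.

Lemma wprod_entire : centire (wprod A nu).
Proof.
have [M hM] := hA.2.
have [U [UU FU]] := @ultraFilterLemma _ _ (lists_filter A).
pose F s z := if `[< listin A s >] then wfin nu s z else 1.
apply: (@centire_limit _ _ U F (fun x => expR (`|x| * M) + 1)) => //.
- move=> s; rewrite /F; case: asboolP => _; [exact: wfin_entire|exact: centire_cst].
- move=> s z; rewrite /F; case: asboolP => hs; last first.
    by rewrite Normc.normc1 lerDr expR_ge0.
  apply: (@le_trans _ _ (expR (N z * M))); last first.
    by rewrite ger0_norm ?normc_ge0// lerDl.
  exact: (listin_prod_bound (normc_ge0 z) (fun l _ => wfactor_bound z l) hs hM).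
- move=> z; apply: (@cvgc_eq_near _ _ U _ (fun s => wfin nu s z)).
    by apply: FU; apply: lists_near => s hs; rewrite /F /= asboolT.
  have [hr hi] := wprod_cvg z; split.
    by move=> W /hr; exact: FU.
  by move=> W /hi; exact: FU.
Qed.

End fixed.

Lemma wprodU A B nu z : abs_summable (A `|` B) -> (forall l, `|nu l| = `|l|) ->
  (forall l, A l -> B l -> False) -> wprod (A `|` B) nu z = wprod A nu z * wprod B nu z.
Proof.
move=> hAB hnu dis; apply: wprod_unique => //; apply: prod_cvgU => //;
  apply: wprod_cvg => //; apply: abs_summableS hAB.
- exact: subsetUl.
- exact: subsetUr.
Qed.

Lemma wprod_seq A nu s z : abs_summable A -> (forall l, `|nu l| = `|l|) -> listin A s ->
  wprod [set` s] nu z = wfin nu s z.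
Proof.
move=> hA hnu [us hs]; apply: wprod_unique => //; last exact: prod_cvg_fin.
by apply: abs_summableS hA => l /= /hs.
Qed.

Lemma wprod_split A nu s z : abs_summable A -> (forall l, `|nu l| = `|l|) -> listin A s ->
  wprod A nu z = wfin nu s z * wprod (A `\` [set` s]) nu z.
Proof.
move=> hA hnu hs; rewrite -(wprod_seq z hA hnu hs) -wprodU//.
- congr (wprod _ _ _); apply/seteqP; split=> l /=.
    by move=> Al; have [ls|/negP ls] := boolP (l \in s); [left|right].
  by case=> [/hs.2 //|[]].
- apply: abs_summableS hA => l /= [/hs.2 //|[]//].
- by move=> l ls [_]; exact.
Qed.

Lemma wprod_root A nu l : abs_summable A -> (forall l, `|nu l| = `|l|) -> A l ->
  wprod A nu (nu l)%:C = 0.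
Proof.
move=> hA hnu Al; have hs : listin A [:: l].
  by split=> // m; rewrite inE => /eqP ->.
rewrite (wprod_split _ hA hnu hs) /wfin big_seq1 divff ?subrr ?mul0r//.
exact: (nu_neq0 hA hnu).
Qed.

Lemma wprod_le A nu nu' z w : abs_summable A -> (forall l, `|nu l| = `|l|) ->
  (forall l, `|nu' l| = `|l|) ->
  (forall l, A l -> N (1 - z / (nu l)%:C) <= N (1 - w / (nu' l)%:C)) ->
  N (wprod A nu z) <= N (wprod A nu' w).
Proof.
move=> hA hnu hnu' h.
have c1 := @cvgc_norm _ _ _ (lists_filter A) _ _ (wprod_cvg hA hnu z).
have c2 := @cvgc_norm _ _ _ (lists_filter A) _ _ (wprod_cvg hA hnu' w).
rewrite -subr_ge0; apply: (cvgr_to_ge (cvgB c2 c1)); exists [::]; first by split.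
move=> s [[us hs] _] /=; rewrite subr_ge0.
rewrite /wfin !normc_prod !big_seq; apply: ler_prod => l ls.
by rewrite normc_ge0 h//; exact: hs.
Qed.

Lemma wprod_conj A nu z : abs_summable A -> (forall l, `|nu l| = `|l|) ->
  wprod A nu z^* = (wprod A nu z)^*.
Proof.
move=> hA hnu; apply: wprod_unique => //.
have [hr hi] := wprod_cvg hA hnu z.
have e s : wfin nu s z^* = (wfin nu s z)^*.
  rewrite /wfin rmorph_prod; apply: eq_bigr => l _.
  by rewrite rmorphB rmorph1 rmorphM fmorphV /= oppr0.
have cr x : complex.Re (x^* : C) = complex.Re x by case: x.
have ci x : complex.Im (x^* : C) = - complex.Im x by case: x.
split.
  by rewrite cr; under eq_fun do rewrite e cr.
by rewrite ci; under eq_fun do rewrite e ci; exact: cvgN.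
Qed.

Lemma negabs_norm l : `|negabs l| = `|l|.
Proof. by rewrite /negabs normrN normr_id. Qed.

Lemma negabs_factor (l : R) z : 1 - z / (negabs l)%:C = 1 + z / `|l|%:C.
Proof. by rewrite /negabs rmorphN invrN mulrN opprK. Qed.

Lemma negabs_factor_real (x l : R) :
  1 - x%:C / (negabs l)%:C = (1 + x / `|l|)%:C :> C.
Proof. by rewrite negabs_factor rmorphD rmorphM fmorphV. Qed.

Lemma wprod_negabs_ge1 A z : abs_summable A -> 0 <= complex.Re z ->
  1 <= N (wprod A negabs z).
Proof.
move=> hA z0.
have c1 := @cvgc_norm _ _ _ (lists_filter A) _ _ (wprod_cvg hA negabs_norm z).
apply: (cvgr_to_ge c1); apply: lists_near => s _; rewrite /wfin normc_prod.
apply: (big_ind (fun x : R => 1 <= x)) => // [x y hx hy|l _].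
  by rewrite -[1]mulr1; apply: ler_pM.
rewrite negabs_factor; apply: le_trans (normc_ge_Re _).
have -> : complex.Re (1 + z / `|l|%:C) = 1 + complex.Re z / `|l|.
  by rewrite -fmorphV ReD ReM /= mulr0 subr0.
have h : 0 <= complex.Re z / `|l| by rewrite divr_ge0.
by rewrite ger0_norm; lra.
Qed.

Lemma imag_factor (l l' y : R) : `|l| = `|l'| ->
  N (1 - imag y / l%:C) = N (1 - imag y / l'%:C).
Proof.
move=> h; have E (m : R) : N (1 - imag y / m%:C) = Num.sqrt (1 + (y / `|m|) ^+ 2).
  rewrite -fmorphV normcE ReD ImD ReN ImN ReM ImM /= !(mul0r, mulr0, subr0, addr0, add0r, oppr0).
  by rewrite expr1n sqrrN !exprMn !exprVn real_normK ?num_real.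
by rewrite !E h.
Qed.

Lemma wprod_imag A nu y : abs_summable A -> (forall l, `|nu l| = `|l|) ->
  N (wprod A nu (imag y)) <= N (wprod A negabs (imag y)).
Proof.
move=> hA hnu; apply: wprod_le => //; first exact: negabs_norm.
by move=> l _; rewrite (imag_factor (l' := negabs l)) ?negabs_norm ?hnu.
Qed.

Lemma wprod_majorant A nu z : abs_summable A -> (forall l, `|nu l| = `|l|) ->
  N (wprod A nu z) <= N (wprod A negabs (N z)%:C).
Proof.
move=> hA hnu; apply: wprod_le => //; first exact: negabs_norm.
move=> l _; rewrite negabs_factor_real normc_real.
rewrite ger0_norm ?addr_ge0 ?mulr_ge0 ?invr_ge0 ?normc_ge0//.
by apply: le_trans (ler_normcB _ _) _; rewrite Normc.normc1 normcf_div normc_real hnu.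
Qed.

(** The tail beyond [s0] is at most [expR (e / 2 * x)]. In the head each factor satisfies [1 + x /
    |l| <= (1 + 1 / (d |l|)) * (1 + d x)], and [1 + d x <= expR (d * x)]. *)
Lemma wprod_type_zero A (e : R) : abs_summable A -> 0 < e ->
  exists M : R, forall x, 0 <= x -> N (wprod A negabs x%:C) <= M * expR (e * x).
Proof.
move=> hA e0; have e2 : 0 < e / 2 by lra.
have [s0 hs0 tail] := abs_summable_tail hA e2.
(* The [size s0] factors of the head then cost an exponent of at most [e / 2 * x] together. *)
pose d := e / 2 / (size s0).+1%:R.
have d0 : 0 < d by rewrite divr_gt0.
exists (\prod_(l <- s0) (1 + (d * `|l|)^-1)) => x x0.
have c1 := @cvgc_norm _ _ _ (lists_filter A) _ _ (wprod_cvg hA negabs_norm x%:C).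
apply: (cvgr_to_le c1); exists s0 => // s [hs sub] /=.
have -> : wfin negabs s x%:C = wfin negabs s0 x%:C * wfin negabs [seq l <- s | l \notin s0] x%:C.
  exact: (listin_split _ hs hs0 sub).
set t := [seq l <- s | l \notin s0].
have ht : listin A t.
  split; first by rewrite filter_uniq// hs.1.
  by move=> l; rewrite mem_filter => /andP[_]; exact: hs.2.
have fac l : N (1 - x%:C / (negabs l)%:C) = 1 + x / `|l|.
  rewrite negabs_factor_real normc_real ger0_norm//.
  by rewrite addr_ge0// divr_ge0.
have h2 : N (wfin negabs t x%:C) <= expR (e / 2 * x).
  rewrite /wfin normc_prod; under eq_bigr do rewrite fac.
  apply: le_trans (prod1D_exp _ _) _; first by move=> l; rewrite divr_ge0.
  rewrite ler_expR -mulr_sumr mulrC; apply: ler_wpM2r => //; apply: tail => //.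
  by move=> l; rewrite mem_filter => /andP[].
have h1 : N (wfin negabs s0 x%:C) <= \prod_(l <- s0) (1 + (d * `|l|)^-1) * expR (e / 2 * x).
  have -> : e / 2 * x = d * x * (size s0).+1%:R.
    have := pnatr_eq0 R (size s0).+1; rewrite /d; move: (_%:R) => n n0.
    by field; rewrite n0.
  have dx : 0 <= d * x by rewrite mulr_ge0// ltW.
  have inv0 (l : R) : 0 <= (d * `|l|)^-1 by rewrite invr_ge0 mulr_ge0// ltW.
  apply: (@le_trans _ _ (\prod_(l <- s0) (1 + (d * `|l|)^-1) * expR (d * x * (size s0)%:R))).
    rewrite /wfin normc_prod; under eq_bigr do rewrite fac.
    elim: (s0) => [|l r IH]; first by rewrite !big_nil mulr0 expR0 mulr1.
    rewrite !big_cons /= -[(size r).+1]add1n natrD mulrDr mulr1 expRD.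
    rewrite mulrACA; apply: ler_pM => //.
    - by rewrite addr_ge0// divr_ge0.
    - by apply: prodr_ge0 => m _; rewrite addr_ge0// divr_ge0.
    - have a0 := inv0 l; have y0 := expR_ge1Dx (d * x).
      have -> : x / `|l| = (d * `|l|)^-1 * (d * x).
        by rewrite invfM mulrACA mulVf ?gt_eqF// mul1r mulrC.
      apply: (@le_trans _ _ ((1 + (d * `|l|)^-1) * (1 + d * x))); first by nra.
      by apply: ler_wpM2l => //; rewrite addr_ge0.
  apply: ler_wpM2l; first by apply: prodr_ge0 => l _; rewrite addr_ge0.
  by rewrite ler_expR; apply: ler_wpM2l => //; rewrite ler_nat.
rewrite Normc.normcM; apply: le_trans (ler_pM _ _ h1 h2) _; rewrite ?normc_ge0//.
have -> : e * x = e / 2 * x + e / 2 * x by lra.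
by rewrite expRD mulrA.
Qed.

End canonical_products.

(** * The Herglotz expansion of the quotient *)

Section herglotz.
Variable R : realType.
Local Notation C := R[i].
Local Notation N := (@Normc.normc R).
Implicit Types (A : set R) (z w v : C) (s t : seq R) (f g : C -> C) (a : nat -> C).

Lemma conjc_realE z : complex.Im z = 0 -> z^* = z.
Proof. by case: z => x y /= ->; rewrite oppr0. Qed.

(** The Taylor coefficients are real, by strong induction: at a small real [x] the imaginary part of
    [a n * x ^+ n] is bounded by the next remainder, of order [x ^+ n.+1]. *)
Lemma centire_conj f z : centire f -> (forall x : R, complex.Im (f x%:C) = 0) ->
  f z^* = (f z)^*.
Proof.
move=> /centire_taylor[a ha] hr.
have a_real n : complex.Im (a n) = 0.
  elim/ltn_ind: n => n IH.
  have [K hK] := ha 1 ltr01; have K0 := taylor_ge0 ltr01 hK.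
  apply/eqP; rewrite -normr_eq0 eq_le normr_ge0 andbT; apply/ler_addgt0Pl => e e0.
  pose x := Num.min (1 / 2) (e / (K + 1)).
  have x0 : 0 < x by rewrite lt_min; apply/andP; split; [lra|rewrite divr_gt0//; lra].
  have xh : x <= 1 / 2 by rewrite ge_min lexx.
  have xe : K * x <= e.
    have : x <= e / (K + 1) by rewrite ge_min lexx orbT.
    rewrite ler_pdivlMr; lra.
  have Nx : N x%:C = x by rewrite normc_real gtr0_norm.
  have hx : N x%:C <= 1 / 2 by rewrite Nx.
  have := hK n.+1 _ hx; rewrite Nx divr1 /psum big_ord_recr /= => h.
  have := le_trans (normc_ge_Im _) h.
  rewrite ImD hr add0r ImN normrN ImD Im_sum big1 ?add0r; last first.
    move=> k _; rewrite -rmorphXn ImM /= (IH k (ltn_ord k)) mulr0 mul0r addr0//.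
  rewrite -rmorphXn ImM /= mulr0 add0r normrM (ger0_norm (exprn_ge0 _ (ltW x0))).
  rewrite exprSr mulrCA mulrC ler_pM2l ?exprn_gt0// => {}h.
  by rewrite addr0; exact: le_trans h xe.
have z0 := normc_ge0 z; pose s := 2 * N z + 1.
have s0 : 0 < s by rewrite /s; lra.
have zs : N z <= s / 2 by rewrite /s; lra.
have [K hK] := ha _ s0; have K0 := taylor_ge0 s0 hK.
apply/eqP; rewrite -subr_eq0; apply/eqP.
apply: (@geo_zero _ _ (2 * K) _ (ratio_half s0 zs)) => n.
have pE : psum a n z^* = (psum a n z)^*.
  rewrite /psum rmorph_sum; apply: eq_bigr => k _.
  by rewrite rmorphM rmorphXn /= (conjc_realE (a_real k)).
rewrite (_ : _ - _ = (f z^* - psum a n z^*) - (f z - psum a n z)^*); last first.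
  by rewrite pE rmorphB; ring.
apply: le_trans (ler_normcB _ _) _; rewrite normc_conj.
have h1 := hK n z zs; have h2 := hK n z^*; rewrite normc_conj in h2.
have := h2 zs; lra.
Qed.

Lemma centire_div_list f s : centire f -> uniq s ->
  (forall l, l \in s -> l != 0 /\ f l%:C = 0) ->
  exists2 g, centire g & forall z, f z = wfin id s z * g z.
Proof.
elim: s f => [|l s IH] f hf; first by exists f => // z; rewrite /wfin big_nil mul1r.
move=> /= /andP[ls us] hs; have [l0 fl] := hs l (mem_head _ _).
have lc : l%:C != 0 :> C by rewrite -normc_eq0 normc_real normr_eq0.
have [g hg fg] := centire_div hf lc fl.
have [m ms|h hh gh] := IH g hg us; last first.
  by exists h => // z; rewrite fg gh /wfin big_cons mulrA.
have ms' : m \in l :: s by rewrite inE ms orbT.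
have [m0 fm] := hs m ms'.
split=> //; move/eqP: fm; rewrite fg mulf_eq0 => /orP[|/eqP //].
rewrite subr_eq0 => /eqP h; have : m%:C = l%:C :> C by rewrite -[LHS](divfK lc) -h mul1r.
by move=> /complexI ml; rewrite -ml ms in ls.
Qed.

(** The constants are hidden so that the functions to which Harnack's inequality applies can be
    assembled by sums, products with [z] and simple fractions. *)
Definition hol f (r : R) := exists a q K, 0 < q < 1 /\ pser f a r q K.

Lemma pser_ge0 f a (r q K : R) : 0 <= r -> pser f a r q K -> 0 <= K.
Proof.
move=> r0 h; have := h 0%N 0; rewrite Normc.normc0 expr0 mulr1 => /(_ r0).
by apply: le_trans; exact: normc_ge0.
Qed.

Lemma holD f g (r : R) : 0 <= r -> hol f r -> hol g r -> hol (fun z => f z + g z) r.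
Proof.
move=> r0 [a [q [K [/andP[q0 q1] hf]]]] [b [p [L [/andP[p0 p1] hg]]]].
have K0 := pser_ge0 r0 hf; have L0 := pser_ge0 r0 hg.
exists (fun n => a n + b n), (Num.max q p), (K + L); split.
  by rewrite lt_max q0 gt_max q1 p1.
move=> n z zr.
have -> : f z + g z - psum (fun n => a n + b n) n z = (f z - psum a n z) + (g z - psum b n z).
  rewrite /psum; under [X in _ - X = _]eq_bigr do rewrite mulrDl.
  by rewrite big_split /=; ring.
apply: le_trans (le_normcD _ _) _; rewrite mulrDl; apply: lerD.
- apply: le_trans (hf _ _ zr) _; apply: ler_wpM2l => //.
  by apply: lerXn2r; rewrite ?nnegrE ?le_max ?lexx ?(ltW q0).
- apply: le_trans (hg _ _ zr) _; apply: ler_wpM2l => //.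
  by apply: lerXn2r; rewrite ?nnegrE ?le_max ?lexx ?(ltW q0) ?(ltW p0) ?orbT.
Qed.

Lemma holZ f c (r : R) : hol f r -> hol (fun z => c * f z) r.
Proof.
move=> [a [q [K [q01 hf]]]]; exists (fun n => c * a n), q, (N c * K); split=> // n z zr.
have -> : c * f z - psum (fun n => c * a n) n z = c * (f z - psum a n z).
  by rewrite /psum mulrBr mulr_sumr; under eq_bigr do rewrite -mulrA.
by rewrite Normc.normcM -mulrA; apply: ler_wpM2l; [exact: normc_ge0|exact: hf].
Qed.

Lemma holX f (r : R) : 0 <= r -> hol f r -> hol (fun z => z * f z) r.
Proof.
move=> r0 [a [q [K [/andP[q0 q1] hf]]]]; have K0 := pser_ge0 r0 hf.
exists (fun n => if n is m.+1 then a m else 0), q, (r * K / q); split; first by rewrite q0.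
move=> n z zr; case: n => [|n].
  rewrite /psum big_ord0 subr0 expr0 mulr1 Normc.normcM ler_pdivlMr//.
  have := hf 0%N z zr; rewrite /psum big_ord0 subr0 expr0 mulr1 => h.
  have h' := ler_pM (normc_ge0 z) (normc_ge0 _) zr h.
  by apply: le_trans h'; apply: ler_piMr; [apply: mulr_ge0; exact: normc_ge0|exact: ltW].
have -> : psum (fun n => if n is m.+1 then a m else 0) n.+1 z = z * psum a n z.
  rewrite /psum big_ord_recl /= mul0r add0r mulr_sumr; apply: eq_bigr => k _.
  by rewrite /= exprS; ring.
rewrite -mulrBr Normc.normcM (_ : r * K / q * q ^+ n.+1 = r * (K * q ^+ n)); last first.
  by rewrite exprS; field; rewrite gt_eqF.
by rewrite ler_pM ?normc_ge0//; exact: hf.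
Qed.

Lemma hol_eq f g (r : R) : (forall z, N z <= r -> f z = g z) -> hol f r -> hol g r.
Proof.
move=> fg [a [q [K [q01 hf]]]]; exists a, q, K; split=> // n z zr.
by rewrite -fg//; exact: hf.
Qed.

Lemma hol_cst c (r : R) : 0 <= r -> hol (fun=> c) r.
Proof.
move=> r0; exists (fun n => if n is 0%N then c else 0), 2^-1, (N c); split.
  by apply/andP; split; lra.
move=> [|n] z zr; first by rewrite /psum big_ord0 subr0 expr0 mulr1.
rewrite /psum big_ord_recl /= expr0 mulr1 big1 => [|k _]; last by rewrite mul0r.
rewrite addr0 subrr Normc.normc0 mulr_ge0 ?normc_ge0// exprn_ge0// invr_ge0//.
Qed.

Lemma hol_sum (I : eqType) (t : seq I) (F : I -> C -> C) (r : R) : 0 <= r ->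
  (forall i, i \in t -> hol (F i) r) -> hol (fun z => \sum_(i <- t) F i z) r.
Proof.
move=> r0; elim: t => [|i t IH] h.
  by apply: hol_eq (hol_cst 0 r0) => z _; rewrite big_nil.
have ht : forall j, j \in t -> hol (F j) r by move=> j jt; apply: h; rewrite inE jt orbT.
apply: hol_eq (holD r0 (h i (mem_head _ _)) (IH ht)) => z _.
by rewrite big_cons.
Qed.

Lemma hol_geo c b (r : R) : 0 < r -> r < N b -> hol (fun z => c / (1 - z / b)) r.
Proof.
move=> r0 rb; have nb : 0 < N b by lra.
have b0 : b != 0 by rewrite -normc_gt0.
pose q := r / N b; have q1 : q < 1 by rewrite /q ltr_pdivrMr// mul1r.
have q0 : 0 < q by rewrite divr_gt0.
exists (fun n => c / b ^+ n), q, (N c / (1 - q)); split; first by rewrite q0.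
move=> n z zr.
have zq : N (z / b) <= q by rewrite normcf_div ler_pM2r// invr_gt0.
have d1 : 1 - q <= N (1 - z / b).
  by have := ler_normc_sub 1 (z / b); rewrite Normc.normc1; lra.
have d0 : 1 - z / b != 0 by rewrite -normc_gt0; lra.
have E : c / (1 - z / b) - psum (fun n => c / b ^+ n) n z = c * (z / b) ^+ n / (1 - z / b).
  have bn0 k : b ^+ k != 0 by rewrite expf_neq0.
  rewrite /psum (_ : \sum_(k < n) _ = c * \sum_(k < n) (z / b) ^+ k); last first.
    by rewrite mulr_sumr; apply: eq_bigr => k _; rewrite exprMn exprVn; ring.
  move/eqP: (subrX1 (z / b) n); move: d0; move: (\sum_(_ < _) _) ((z / b) ^+ n) => S T.
  move: (z / b) => x d0 /eqP h; apply: (mulIf d0); rewrite divfK// mulrBl divfK//.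
  by rewrite -mulrA (_ : S * (1 - x) = 1 - T); [ring|rewrite -[LHS]opprK -mulrN opprB mulrC -h opprB].
rewrite E normcf_div Normc.normcM normcX mulrAC.
apply: ler_pM; rewrite ?mulr_ge0 ?invr_ge0 ?exprn_ge0 ?normc_ge0//.
  by apply: ler_wpM2l; [exact: normc_ge0|rewrite lef_pV2 ?posrE; lra].
by apply: lerXn2r; rewrite ?nnegrE ?normc_ge0 ?(ltW q0).
Qed.

End herglotz.

(** * The poles of the quotient and the sign of their weights *)

Section partial_fractions.
Variable R : realType.
Local Notation C := R[i].
Local Notation N := (@Normc.normc R).
Implicit Types (A : set R) (z w v : C) (s t : seq R) (f g : C -> C).

Lemma wprod_real A nu (x : R) : abs_summable A -> (forall l, `|nu l| = `|l|) ->
  complex.Im (wprod A nu x%:C) = 0.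
Proof.
move=> hA hnu; have := wprod_conj x%:C hA hnu; rewrite conjc_realE//.
move/(congr1 (@complex.Im R)); case: (wprod _ _ _) => a b /= h; lra.
Qed.

Lemma normc_pos_Im0 z : complex.Im z != 0 -> z != 0.
Proof. by apply: contraNneq => ->. Qed.

Lemma ImV z : complex.Im z^-1 = - complex.Im z / N z ^+ 2.
Proof. by rewrite sqr_normcE; case: z => a b /=; rewrite mulNr. Qed.

Lemma ReV z : complex.Re z^-1 = complex.Re z / N z ^+ 2.
Proof. by rewrite sqr_normcE; case: z. Qed.

Variables (A : set R) (Q : C -> C).
Local Notation W := (wprod A id).

Let Wl l := wprod (A `\` [set` [:: l]]) id.

(** The coefficient of [l / (l - z)] in [Q / W], obtained by removing the factor [1 - z / l] from
    [W]; it differs from the classical residue by the factor [- l]. *)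
Definition residue (l : R) : R :=
  complex.Re (Q l%:C / wprod (A `\` [set` [:: l]]) id l%:C).

Hypotheses (hA : abs_summable A) (hQ : centire Q) (Q0 : Q 0 = 1).
Hypotheses (Qreal : forall x : R, complex.Im (Q x%:C) = 0)
  (Qim : forall z, 0 < complex.Im z -> 0 <= complex.Im (z * (Q z / W z))).

Let hid (l : R) : `|id l| = `|l|. Proof. by []. Qed.

Let hAl l : abs_summable (A `\` [set` [:: l]]).
Proof. by apply: abs_summableS hA => m []. Qed.

Lemma factor_out l z : A l -> W z = (1 - z / l%:C) * Wl l z.
Proof.
move=> Al; have hs : listin A [:: l] by split=> // m; rewrite inE => /eqP ->.
by rewrite (wprod_split _ hA hid hs) /wfin big_seq1.
Qed.

Lemma cofactor_neq0 l : Wl l l%:C != 0.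
Proof.
apply: (wprod_neq0 (hAl l) hid) => m [_ /= ml]; apply: contra_notN ml => /eqP/complexI ->.
exact: mem_head.
Qed.

Lemma cofactor_root l m : A m -> m != l -> Wl l m%:C = 0.
Proof.
move=> Am ml; apply: (wprod_root (hAl l) hid); split=> //=.
by rewrite inE => /eqP h; rewrite h eqxx in ml.
Qed.

Lemma residueE l : (residue l)%:C * Wl l l%:C = Q l%:C.
Proof.
have h : complex.Im (Q l%:C / Wl l l%:C) = 0.
  by rewrite ImM ImV Qreal (wprod_real _ (hAl l) hid) oppr0 !mul0r mulr0 addr0.
by rewrite /residue -(real_of_Im0 h) divfK// cofactor_neq0.
Qed.

Lemma W_neq0 z : (forall l, A l -> z != l%:C) -> W z != 0.
Proof. by move=> h; exact: (wprod_neq0 hA hid). Qed.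

Lemma W_Im_neq0 z : complex.Im z != 0 -> W z != 0.
Proof.
by move=> h; apply: W_neq0 => l _; apply: contra h => /eqP ->.
Qed.

(** At [z = l + i d / 2], vertically above the pole, [Im (z Q / W)] is [2 / d] times the real part
    of a function continuous at [l] with value [l ^+ 2 * residue l] there. A negative weight would
    contradict [Qim]. *)
Lemma residue_ge0 l : A l -> 0 <= residue l.
Proof.
move=> Al; have l0 : l != 0 by exact: hA.1.
have lc : l%:C != 0 :> C by rewrite -normc_eq0 normc_real normr_eq0.
rewrite leNgt; apply/negP => g0.
pose F z := l%:C * (z * (Q z / Wl l z)).
have cF : ccont F l%:C.
  apply: cdiff_cont; apply: cdiffM; first exact: cdiff_cst.
  apply: cdiffM; first exact: cdiff_id.
  apply: cdiffM; first exact: hQ.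
  by apply: cdiffV; [exact: cofactor_neq0|exact: (wprod_entire (hAl l) hid)].
have Fl : F l%:C = (l ^+ 2 * residue l)%:C.
  by rewrite /F -residueE mulfK ?cofactor_neq0// rmorphM rmorphXn /=; ring.
have lg : 0 < - (l ^+ 2 * residue l) by rewrite oppr_gt0 pmulr_rlt0// exprn_even_gt0.
move/ccontP: cF => /(_ _ lg)[d d0 hd].
have d2 : 0 < d / 2 by lra.
pose z : C := l%:C + imag (d / 2).
have := hd z; rewrite /z addrC addKr -/z.
have -> : N (imag (d / 2) : C) = d / 2.
  by rewrite /imag normcE /= expr0n add0r sqrtr_sqr gtr0_norm.
have dd : d / 2 < d by lra.
move=> /(_ dd) h.
have zi : complex.Im z = d / 2 by rewrite /z /= add0r.
have := Qim; move=> /(_ z); rewrite zi => /(_ d2).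
have id0 : imag (d / 2) != 0 :> C by apply: normc_pos_Im0; rewrite /= gt_eqF.
have wz : Wl l z != 0.
  have := W_Im_neq0 (z := z); rewrite zi gt_eqF// => /(_ isT).
  by rewrite (factor_out _ Al) mulf_eq0 negb_or => /andP[].
pose J : C := imag 1; have J2 : J * J = -1 by apply: complex_eqP => /=; ring.
have J0 : J != 0 by apply: normc_pos_Im0; rewrite /= oner_neq0.
have dJ : imag (d / 2) = J * (d / 2)%:C by apply: complex_eqP => /=; ring.
have d2c : (d / 2)%:C != 0 :> C by rewrite -normc_gt0 normc_real gtr0_norm.
have -> : z * (Q z / W z) = J * ((d / 2)^-1)%:C * F z.
  have zE : 1 - z / l%:C = - (J * (d / 2)%:C) / l%:C by rewrite /z dJ; field.
  rewrite (factor_out _ Al) /F (_ : ((d / 2)^-1)%:C = (d / 2)%:C^-1 :> C); last exact: fmorphV.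
  rewrite zE.
  move: (Wl l z) wz ((d / 2)%:C) d2c => w0 hw0 d' hd'.
  rewrite (_ : J / d' * _ = - d'^-1 / J * (l%:C * (z * (Q z / w0)))); last first.
    rewrite (_ : - d'^-1 = J * J * d'^-1); last by rewrite J2 mulN1r.
    by field; rewrite J0 hd' hw0.
  by field; rewrite hw0 hd' J0 lc.
have -> : complex.Im (J * ((d / 2)^-1)%:C * F z) = (d / 2)^-1 * complex.Re (F z).
  by rewrite !ImM !ReM /=; ring.
rewrite pmulr_rge0 ?invr_gt0// => Fz.
have := le_lt_trans (normc_ge_Re _) h.
rewrite Fl ReD ReN /= ltr_norml => /andP[_]; lra.
Qed.

End partial_fractions.

(** * Positivity on discs that avoid the poles *)

Section herglotz_disc.
Variable R : realType.
Local Notation C := R[i].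
Local Notation N := (@Normc.normc R).
Implicit Types (z w v : C) (s t : seq R) (f g : C -> C).
Variables (A : set R) (Q : C -> C).
Local Notation W := (wprod A id).
Local Notation Wl l := (wprod (A `\` [set` [:: l]]) id).
Local Notation res := (residue A Q).
Hypotheses (hA : abs_summable A) (hQ : centire Q) (Q0 : Q 0 = 1).
Hypotheses (Qreal : forall x : R, complex.Im (Q x%:C) = 0)
  (Qim : forall z, 0 < complex.Im z -> 0 <= complex.Im (z * (Q z / W z))).

Let hid (l : R) : `|id l| = `|l|. Proof. by []. Qed.

Let hAl l : abs_summable (A `\` [set` [:: l]]).
Proof. by apply: abs_summableS hA => m []. Qed.

(** On the circle [r ^+ 2] is [z] times its conjugate; substituting this turns the product into a
    real number times [z] minus its conjugate, which is purely imaginary. *)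
Lemma circle_kernel (l r : R) z : 0 < r -> N z = r -> l != 0 -> `|l| != r ->
  complex.Re ((1 - z ^+ 2 / r%:C ^+ 2) *
    (l%:C / (l%:C - z) - l%:C ^+ 2 / (r%:C ^+ 2 - l%:C * z))) = 0.
Proof.
move=> r0 zr l0 lr; have zn0 : z != 0 by rewrite -normc_gt0 zr.
have cn0 : (conjc z) != 0 by rewrite -normc_gt0 normc_conj zr.
have lz : l%:C - z != 0.
  by rewrite subr_eq0; apply: contra lr => /eqP h; rewrite -zr -h normc_real.
have lc : l%:C - (conjc z) != 0.
  by rewrite subr_eq0; apply: contra lr => /eqP h; rewrite -zr -normc_conj -h normc_real.
have rE : r%:C ^+ 2 = z * (conjc z) by rewrite mul_conjc zr rmorphXn.
have cl : (conjc (l%:C - z)) = l%:C - (conjc z) by rewrite rmorphB /= oppr0.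
have nE : (l%:C - z) * (l%:C - (conjc z)) = (N (l%:C - z) ^+ 2)%:C by rewrite -(mul_conjc _ : _ * conjc _ = _) cl.
have -> : (1 - z ^+ 2 / r%:C ^+ 2) *
    (l%:C / (l%:C - z) - l%:C ^+ 2 / (r%:C ^+ 2 - l%:C * z)) =
    (l * (r ^+ 2 - l ^+ 2) / (r ^+ 2 * N (l%:C - z) ^+ 2))%:C * (z - (conjc z)).
  have cE (n : R) : (l * (r ^+ 2 - l ^+ 2) / (r ^+ 2 * n))%:C =
      l%:C * (r%:C ^+ 2 - l%:C ^+ 2) / (r%:C ^+ 2 * n%:C) :> C.
    by rewrite !(rmorphM, rmorphB, fmorphV, rmorphXn).
  rewrite cE -nE rE.
  move: lz lc cn0 zn0; move: (conjc z) => c lz lc cn0 zn0.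
  have zc : z * c - l%:C * z != 0.
    rewrite (_ : _ - _ = - z * (l%:C - c)); last by ring.
    by rewrite mulf_neq0// oppr_eq0.
  by field; rewrite zc lz lc cn0 zn0.
rewrite ReM /=; case: z {zr zn0 cn0 lz lc rE cl nE} => x y /=; ring.
Qed.

(** On the circle the real part equals [2 Im z Im (z Q / W) / r ^+ 2]; in the lower half plane both
    imaginary parts change sign by conjugation. *)
Lemma circle_positive (r : R) z : 0 < r -> (forall l, A l -> `|l| != r) -> N z = r ->
  0 <= complex.Re ((1 - z ^+ 2 / r%:C ^+ 2) * (Q z / W z)).
Proof.
move=> r0 hr zr; have zn0 : z != 0 by rewrite -normc_gt0 zr.
have cn0 : (conjc z) != 0 by rewrite -normc_gt0 normc_conj zr.
have rE : r%:C ^+ 2 = z * (conjc z) by rewrite mul_conjc zr rmorphXn.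
have -> : (1 - z ^+ 2 / r%:C ^+ 2) * (Q z / W z) =
    ((r ^+ 2)^-1)%:C * (((conjc z) - z) * (z * (Q z / W z))).
  rewrite fmorphV rmorphXn /= rE; move: (Q z / W z) => p; move: cn0; move: (conjc z) => c cn0.
  by field; rewrite cn0 zn0.
rewrite ReM /= mul0r subr0; apply: mulr_ge0; first by rewrite invr_ge0 exprn_ge0// ltW.
have -> w : complex.Re (((conjc z) - z) * w) = 2 * complex.Im z * complex.Im w.
  by case: (z) w => x y [a b] /=; ring.
have [y0|y0|y0] := ltgtP (complex.Im z) 0; last by rewrite y0 mulr0 mul0r.
- have yc : 0 < complex.Im (conjc z) by case: (z) y0 => x y /=; lra.
  have := Qim yc; rewrite (centire_conj _ hQ Qreal) (wprod_conj _ hA hid).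
  rewrite -fmorphV -!rmorphM /=; move: (z * _) => w.
  have -> : complex.Im (conjc w) = - complex.Im w by case: w.
  nra.
- by have := Qim y0; nra.
Qed.

(* [F / (1 - z ^ 2 / r ^ 2)] is [Q / W] with every pole [l / (l - z)] in the disc
   traded for its reflection [l ^ 2 / (r ^ 2 - l z)]; by [circle_kernel] this does
   not change the real part of [F] on the circle, where it is
   [2 Im z Im (z Q / W) / r ^ 2]. *)
Lemma herglotz_disc (r : R) s : 0 < r -> (forall l, A l -> `|l| != r) -> uniq s ->
  (forall l, (l \in s) = `[< A l /\ `|l| < r >]) ->
  exists F, [/\ hol F r, forall z, N z = r -> 0 <= complex.Re (F z) &
    forall z, N z < r -> W z != 0 -> F z / (1 - z ^+ 2 / r%:C ^+ 2) = Q z / W z -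
      \sum_(l <- s) (res l)%:C * (l%:C / (l%:C - z) - l%:C ^+ 2 / (r%:C ^+ 2 - l%:C * z))].
Proof.
(* All poles up to [4 * r] are treated, so that what remains is holomorphic on a square containing
   the disc of radius [2 * r], enough room for a Taylor expansion on the disc of radius [r]. *)
move=> r0 hr us hs; have [s4 us4 hs4] := @abs_summable_list _ A (4 * r) hA.
have s4A l : l \in s4 -> A l by rewrite hs4 => /asboolP[].
have ls4 : listin A s4 by [].
(* Lagrange interpolation: subtracting the multiples of the cofactors [Wl l] makes [T] vanish at
   every point of [s4], so these zeros cancel against those of [W]. *)
pose T z := Q z - \sum_(l <- s4) (res l)%:C * Wl l z.
have eT : centire T.
  move=> z; apply: cdiffB; first exact: hQ.
  apply: cdiff_sum => l _; apply: cdiffM; first exact: cdiff_cst.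
  exact: (wprod_entire (hAl l) hid).
have T0 l : l \in s4 -> l != 0 /\ T l%:C = 0.
  move=> ll; split; first by apply: hA.1; exact: s4A.
  rewrite /T (bigD1_seq l)//= (residueE hA Qreal) big_seq_cond big1 ?addr0 ?subrr//.
  by move=> m /andP[ms ml]; rewrite (cofactor_root hA (s4A _ ll)) ?mulr0// eq_sym.
have [T1 eT1 TT1] := centire_div_list eT us4 T0.
pose Wt := wprod (A `\` [set` s4]) id.
have hAt : abs_summable (A `\` [set` s4]) by apply: abs_summableS hA => m [].
have Wt0 z : N z <= 3 * r -> Wt z != 0.
  move=> zr; apply: (wprod_neq0 hAt hid) => l [Al /= ns]; apply/eqP => zl.
  apply: ns; rewrite hs4; apply/asboolP; split=> //.
  by move: zr; rewrite zl normc_real; lra.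
pose h z := T1 z / Wt z.
have hh : hol h r.
  have r2 : 0 < 2 * r by lra.
  have dh w : inrect (- (2 * r)) (2 * r) (- (2 * r)) (2 * r) w -> cdiff h w.
    move=> [/andP[w1 w2] /andP[w3 w4]]; apply: cdiffM; first exact: eT1.
    apply: cdiffV; last exact: (wprod_entire hAt hid).
    apply: Wt0; rewrite -(@ler_pXn2r _ 2)// ?nnegrE ?normc_ge0//; last by lra.
    rewrite sqr_normcE; nra.
  have [a [K hK]] := cauchy_taylor r2 dh.
  exists a, 2^-1, K; split; first by apply/andP; split; lra.
  by apply: (taylor_pser r2 _ hK); lra.
(* Poles inside the disc are reflected to the outside; those between [r] and [4 * r] are harmless in
   the disc and stay. *)
pose k l z : C := if `|l| < r then l%:C ^+ 2 / (r%:C ^+ 2 - l%:C * z) else l%:C / (l%:C - z).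
have hk l : l \in s4 -> hol (k l) r.
  move=> ll; have l0 : l != 0 by apply: hA.1; exact: s4A.
  have lc : l%:C != 0 :> C by rewrite -normc_eq0 normc_real normr_eq0.
  have rc : r%:C != 0 :> C by rewrite -normc_gt0 normc_real gtr0_norm.
  have nl : 0 < `|l| by rewrite normr_gt0.
  have lr := hr l (s4A _ ll).
  case: (ltgtP `|l| r) lr => // lr _.
    have nb : r < N (r%:C ^+ 2 / l%:C).
      rewrite normcf_div normcX !normc_real (gtr0_norm r0) ltr_pdivlMr// expr2 ltr_pM2l//.
    apply: hol_eq (hol_geo (l%:C ^+ 2 / r%:C ^+ 2) r0 nb) => z zr.
    rewrite /k lr.
    have d0 : r%:C ^+ 2 - l%:C * z != 0.
      rewrite subr_eq0; apply/eqP => /(congr1 N); rewrite normcX Normc.normcM !normc_real.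
      rewrite (gtr0_norm r0) => e; nra.
    have d1 : 1 - z / (r%:C ^+ 2 / l%:C) = (r%:C ^+ 2 - l%:C * z) / r%:C ^+ 2.
      by field; rewrite lc rc.
    by rewrite d1; field; rewrite d0 rc.
  have nb : r < N (l%:C : C) by rewrite normc_real.
  apply: hol_eq (hol_geo 1 r0 nb) => z zr; rewrite /k ltNge (ltW lr) /=.
  have d0 : l%:C - z != 0.
    by rewrite subr_eq0; apply/eqP => e; move: zr; rewrite -e normc_real; lra.
  have d1 : 1 - z / l%:C = (l%:C - z) / l%:C by field.
  by rewrite d1; field; rewrite d0 lc.
pose G z := h z + \sum_(l <- s4) (res l)%:C * k l z.
have hG : hol G r.
  apply: holD => //; first exact: ltW.
  by apply: hol_sum; [exact: ltW|move=> l ll; apply: holZ; exact: hk].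
have GE z : N z <= r -> W z != 0 -> G z = Q z / W z -
    \sum_(l <- s) (res l)%:C * (l%:C / (l%:C - z) - l%:C ^+ 2 / (r%:C ^+ 2 - l%:C * z)).
  move=> zr Wz.
  have ph : Q z / W z = h z + \sum_(l <- s4) (res l)%:C * (l%:C / (l%:C - z)).
    have -> : h z = T z / W z.
      move: (Wz); rewrite TT1 (wprod_split _ hA hid ls4) -/(Wt z) mulf_eq0 negb_or => /andP[w1 w2].
      by rewrite /h; field; rewrite w1 w2.
    rewrite /T mulrBl -addrA -[LHS]addr0; congr (_ + _); apply/esym/eqP.
    rewrite addrC subr_eq0 mulr_suml; apply/eqP.
    rewrite !big_seq; apply: eq_bigr => l ll; rewrite -mulrA; congr (_ * _).
    have lc : l%:C != 0 :> C.
      by rewrite -normc_eq0 normc_real normr_eq0; apply: hA.1; exact: s4A.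
    move: Wz; rewrite (factor_out hA _ (s4A _ ll)) mulf_eq0 negb_or => /andP[w1 w2].
    have w3 : l%:C - z != 0.
      by apply: contra w1; rewrite !subr_eq0 => /eqP <-; rewrite divff.
    have d1 : 1 - z / l%:C = (l%:C - z) / l%:C by field.
    by rewrite d1; field; rewrite w2 w3 lc.
  rewrite ph /G -addrA; congr (_ + _); apply/eqP; rewrite eq_sym subr_eq; apply/eqP.
  have -> : \sum_(l <- s) (res l)%:C * (l%:C / (l%:C - z) - l%:C ^+ 2 / (r%:C ^+ 2 - l%:C * z)) =
      \sum_(l <- s4 | `|l| < r) (res l)%:C * (l%:C / (l%:C - z) - k l z).
    rewrite -[RHS]big_filter (perm_big [seq l <- s4 | `|l| < r]) /=; last first.
      apply: uniq_perm => //; first by rewrite filter_uniq.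
      move=> l; rewrite mem_filter hs hs4; apply/asboolP/andP.
        by move=> [Al lr]; split=> //; apply/asboolP; split=> //; lra.
      by move=> [lr /asboolP[]].
    by rewrite !big_filter; apply: eq_bigr => l lr; rewrite /k lr.
  rewrite (big_mkcond (fun l => `|l| < r)) /= -big_split /=; apply: eq_bigr => l _.
  by rewrite /k; case: ifP => _; ring.
exists (fun z => G z + (- (r%:C ^+ 2)^-1) * (z * (z * G z))); split.
- exact: holD (ltW r0) hG (holZ _ (holX (ltW r0) (holX (ltW r0) hG))).
- move=> z zr; have Wz : W z != 0.
    apply: (wprod_neq0 hA hid) => l Al; apply: contra (hr l Al) => /eqP e.
    by rewrite -zr e normc_real.
  have -> : G z + - (r%:C ^+ 2)^-1 * (z * (z * G z)) = (1 - z ^+ 2 / r%:C ^+ 2) * G z by ring.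
  rewrite GE ?zr// mulrBr ReD ReN mulr_sumr Re_sum big_seq big1 ?subr0.
    exact: circle_positive.
  move=> l; rewrite hs => /asboolP[Al lr].
  rewrite mulrCA ReM /= mul0r subr0 circle_kernel ?mulr0//; last exact: hr.
  exact: hA.1.
- move=> z zr Wz.
  have rc : r%:C != 0 :> C by rewrite -normc_gt0 normc_real gtr0_norm.
  have q0 : 1 - z ^+ 2 / r%:C ^+ 2 != 0.
    rewrite subr_eq0; apply/eqP => /(congr1 N).
    rewrite Normc.normc1 normcf_div !normcX normc_real (gtr0_norm r0) => /esym/eqP.
    rewrite eq_sym; apply/negP; rewrite gt_eqF// ltr_pdivrMr ?exprn_gt0// mul1r.
    by rewrite ltrXn2r//; exact: normc_ge0.
  have -> : G z + - (r%:C ^+ 2)^-1 * (z * (z * G z)) = G z * (1 - z ^+ 2 / r%:C ^+ 2) by ring.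
  by rewrite mulfK// GE// ltW.
Qed.

End herglotz_disc.

(** * The expansion of the quotient and its consequences *)

Section herglotz_expansion.
Variable R : realType.
Local Notation C := R[i].
Local Notation N := (@Normc.normc R).
Implicit Types (z w v : C) (s t : seq R) (f g : C -> C).
Variables (A : set R) (Q : C -> C).
Local Notation W := (wprod A id).
Local Notation res := (residue A Q).
Hypotheses (hA : abs_summable A) (hQ : centire Q) (Q0 : Q 0 = 1).
Hypotheses (Qreal : forall x : R, complex.Im (Q x%:C) = 0)
  (Qim : forall z, 0 < complex.Im z -> 0 <= complex.Im (z * (Q z / W z))).

Let hid (l : R) : `|id l| = `|l|. Proof. by []. Qed.

Lemma avoid_list s (x y : R) : x < y -> exists2 r, x < r < y & r \notin s.
Proof.
elim: s x y => [|l s IH] x y xy; first by exists ((x + y) / 2) => //; lra.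
have [lm|lm] := leP l ((x + y) / 2).
  have [|r /andP[r1 r2] rs] := IH ((x + y) / 2) y; first lra.
  exists r; first by lra.
  by rewrite inE negb_or rs gt_eqF//; lra.
have [|r /andP[r1 r2] rs] := IH x ((x + y) / 2); first lra.
exists r; first by lra.
by rewrite inE negb_or rs lt_eqF//; lra.
Qed.

Definition disc_list (r : R) s := [/\ 0 < r, forall l, A l -> `|l| != r, uniq s &
  forall l, (l \in s) = `[< A l /\ `|l| < r >]].

Lemma disc_list_exists (r0 : R) : exists r s, r0 < r /\ disc_list r s.
Proof.
pose x := `|r0| + 1; have x0 : 0 < x by rewrite /x; have := normr_ge0 r0; lra.
have [s us hs] := @abs_summable_list _ A (x + 1) hA.
have [|r /andP[r1 r2] rs] := @avoid_list [seq `|l| | l <- s] x (x + 1); first lra.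
exists r, [seq l <- s | `|l| < r]; split.
  by have := ler_norm r0; rewrite /x in r1; lra.
split; [lra| |exact: filter_uniq|].
  move=> l Al; apply: contra rs => /eqP lr; apply/mapP; exists l => //.
  by rewrite hs; apply/asboolP; split=> //; lra.
move=> l; rewrite mem_filter hs; apply/andP/asboolP.
  by move=> [lr /asboolP[]].
by move=> [Al lr]; split=> //; apply/asboolP; split=> //; lra.
Qed.

Lemma disc_listin (r : R) s : disc_list r s -> listin A s.
Proof. by move=> [_ _ us hs]; split=> // l; rewrite hs => /asboolP[]. Qed.

(** At [z = 0] the identity for [F] becomes the formula for [p], and [p >= 0] is the positivity of
    the real part at the centre; Harnack's inequality then controls [F] in terms of [p] alone. *)
Lemma residue_disc (r : R) s : disc_list r s -> exists F (p : R),
  [/\ F 0 = p%:C, p = 1 - \sum_(l <- s) res l * (1 - l ^+ 2 / r ^+ 2), 0 <= p,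
    forall z, N z <= r / 2 -> N (F z - F 0) <= 4 * p * (N z / r) &
    forall z, N z < r -> W z != 0 -> F z / (1 - z ^+ 2 / r%:C ^+ 2) = Q z / W z -
      \sum_(l <- s) (res l)%:C * (l%:C / (l%:C - z) - l%:C ^+ 2 / (r%:C ^+ 2 - l%:C * z))].
Proof.
move=> ds; have [r0 hr us hs] := ds.
have [F [[a [q [K [/andP[q0 q1] ha]]]] Fpos FE]] := herglotz_disc hA hQ Qreal Qim r0 hr us hs.
have q01 : 0 <= q < 1 by rewrite (ltW q0).
have [F0 hF] := pser_harnack r0 q01 ha Fpos.
pose p := 1 - \sum_(l <- s) res l * (1 - l ^+ 2 / r ^+ 2).
have Fp : F 0 = p%:C.
  have := FE 0; rewrite Normc.normc0 (wprod0 hA hid) Q0 => /(_ r0 (oner_neq0 _)).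
  rewrite expr0n /= mul0r subr0 !divr1 => ->.
  rewrite /p rmorphB rmorph1 rmorph_sum /=; congr (1 - _).
  rewrite !big_seq; apply: eq_bigr => l ls.
  have l0 : l%:C != 0 :> C.
    by rewrite -normc_eq0 normc_real normr_eq0; apply: hA.1; exact: (disc_listin ds).2.
  by rewrite !(rmorphM, rmorphB, fmorphV, rmorphXn, rmorph1) /= mulr0 !subr0 divff.
move: F0 hF; rewrite {1 3}Fp /= => F0 hF.
by exists F, p; split.
Qed.

(** For a fixed list the weights [1 - l ^+ 2 / r ^+ 2] tend to 1 as [r] grows, and the other terms
    of the sum bounded by [p >= 0] are nonnegative. *)
Lemma residue_sum_le1 s : listin A s -> \sum_(l <- s) res l <= 1.
Proof.
move=> [us hs]; have [M M0 hM] : exists2 M : R, 0 < M & forall l, l \in s -> `|l| <= M.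
  elim: (s) => [|l t [M M0 hM]]; first by exists 1.
  exists (M + `|l|); first by rewrite ltr_wpDr.
  move=> m; rewrite inE => /predU1P[->|/hM h]; first by rewrite lerDr ltW.
  by apply: le_trans h _; rewrite lerDl.
set S := \sum_(l <- s) _.
have S0 : 0 <= S.
  by rewrite /S big_seq; apply: sumr_ge0 => l /hs; exact: (residue_ge0 hA hQ Qreal Qim).
apply/ler_addgt0Pl => e e0.
pose r0 := M + S * M ^+ 2 / e.
have Sq : 0 <= S * M ^+ 2 / e by rewrite !mulr_ge0 ?invr_ge0 ?exprn_ge0// ltW.
have [r [t [rr dt]]] := disc_list_exists (r0 + 1).
have [r_pos _ ut ht] := dt.
have [F [p [_ pE p0 _ _]]] := residue_disc dt.
have rM : M < r by rewrite /r0 in rr; lra.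
have st l : l \in s -> l \in t.
  by move=> ls; rewrite ht; apply/asboolP; split; [exact: hs|have := hM _ ls; lra].
have small l : l \in t -> 0 <= res l * (1 - l ^+ 2 / r ^+ 2).
  rewrite ht => /asboolP[Al lr]; apply: mulr_ge0.
    exact: (residue_ge0 hA hQ Qreal Qim).
  rewrite subr_ge0 ler_pdivrMr ?exprn_gt0// mul1r -real_normK ?num_real//.
  by apply: lerXn2r; rewrite ?nnegrE ?(ltW r_pos) ?(ltW lr).
have h1 : \sum_(l <- s) res l * (1 - l ^+ 2 / r ^+ 2) <=
          \sum_(l <- t) res l * (1 - l ^+ 2 / r ^+ 2).
  rewrite [leRHS](bigID (mem s)) /= -[leLHS]addr0; apply: lerD.
    rewrite -[leRHS]big_filter le_eqVlt; apply/orP; left; apply/eqP; apply: perm_big.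
    apply: uniq_perm => //; first by rewrite filter_uniq.
    by move=> l; rewrite mem_filter /=; case: (boolP (l \in s)) => // /st ->.
  by rewrite big_seq_cond; apply: sumr_ge0 => l /andP[lt _]; exact: small.
have h2 : S * (1 - M ^+ 2 / r ^+ 2) <= \sum_(l <- s) res l * (1 - l ^+ 2 / r ^+ 2).
  rewrite /S mulr_suml !big_seq; apply: ler_sum => l ls.
  apply: ler_wpM2l; first by apply: (residue_ge0 hA hQ Qreal Qim); exact: hs.
  rewrite lerD2l lerN2 ler_pM2r ?invr_gt0 ?exprn_gt0//.
  by rewrite -(real_normK (num_real l)); apply: lerXn2r; rewrite ?nnegrE ?(ltW M0) ?hM.
have h3 : S * (M ^+ 2 / r ^+ 2) <= e.
  rewrite mulrA ler_pdivrMr ?exprn_gt0//.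
  have : S * M ^+ 2 / e <= r by rewrite /r0 in rr; lra.
  rewrite ler_pdivrMr// => h; have : 1 <= r by rewrite /r0 in rr; lra.
  move=> r1; apply: le_trans h _; rewrite mulrC ler_pM2l// expr2 ler_peMl//; exact: ltW.
lra.
Qed.

(** With [t = N z / r], three errors occur: Harnack's bound for [F z - F 0] gives [16 / 3 * t], the
    factor [1 - z ^+ 2 / r ^+ 2] gives [2 / 3 * t], and the reflected poles give [2 * t] because the
    weights sum to at most 1. The total is [8 * t]. *)
Lemma herglotz_expansion (r : R) s z : disc_list r s -> W z != 0 -> N z <= r / 2 ->
  N (Q z / W z - 1 - \sum_(l <- s) (res l)%:C * (z / (l%:C - z))) <= 8 * (N z / r).
Proof.
move=> ds Wz zr; have [r0 hr us hs] := ds.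
have [F [p [F0 pE p0 hF FE]]] := residue_disc ds.
have zr' : N z < r by lra.
have z0 := normc_ge0 z.
have rc : r%:C != 0 :> C by rewrite -normc_gt0 normc_real gtr0_norm.
have res0 l : l \in s -> 0 <= res l.
  by rewrite hs => /asboolP[Al _]; exact: (residue_ge0 hA hQ Qreal Qim).
have p1 : p <= 1.
  rewrite pE gerBl big_seq; apply: sumr_ge0 => l ls; apply: mulr_ge0; first exact: res0.
  move: ls; rewrite hs => /asboolP[Al lr].
  rewrite subr_ge0 ler_pdivrMr ?exprn_gt0// mul1r -real_normK ?num_real//.
  by apply: lerXn2r; rewrite ?nnegrE ?(ltW r0) ?(ltW lr).
pose t := N z / r.
have t0 : 0 <= t by rewrite /t divr_ge0// ltW.
have t1 : t <= 1 / 2 by rewrite /t ler_pdivrMr//; lra.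
set D := 1 - z ^+ 2 / r%:C ^+ 2.
have nD : N (z ^+ 2 / r%:C ^+ 2) = t ^+ 2.
  by rewrite normcf_div !normcX normc_real (gtr0_norm r0) /t exprMn exprVn.
have D1 : 3 / 4 <= N D.
  by have := ler_normc_sub 1 (z ^+ 2 / r%:C ^+ 2); rewrite Normc.normc1 nD -/D; nra.
have D0 : D != 0 by rewrite -normc_gt0; lra.
have iD : (N D)^-1 <= 4 / 3.
  by rewrite -[4 / 3]invf_div lef_pV2 ?posrE//; lra.
have iD0 : 0 <= (N D)^-1 by rewrite invr_ge0; lra.
have den l : l \in s -> r ^+ 2 / 2 <= N (r%:C ^+ 2 - l%:C * z).
  rewrite hs => /asboolP[Al lr].
  have := ler_normc_sub (r%:C ^+ 2) (l%:C * z).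
  rewrite normcX Normc.normcM !normc_real (gtr0_norm r0).
  have : `|l| * N z <= r * (r / 2) by apply: ler_pM => //; exact: ltW.
  lra.
have r2 : 0 < r ^+ 2 by rewrite exprn_gt0.
have key : Q z / W z - 1 - \sum_(l <- s) (res l)%:C * (z / (l%:C - z)) =
    (F z - F 0) / D + F 0 * (z ^+ 2 / r%:C ^+ 2) / D -
    \sum_(l <- s) (res l)%:C * (l%:C ^+ 3 * z / (r%:C ^+ 2 * (r%:C ^+ 2 - l%:C * z))).
  have E1 : F z / D = (F z - F 0) / D + F 0 * (z ^+ 2 / r%:C ^+ 2) / D + F 0.
    rewrite (_ : z ^+ 2 / r%:C ^+ 2 = 1 - D); last by rewrite /D; ring.
    by field.
  have := FE z zr' Wz; rewrite -/D E1 => /eqP.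
  rewrite eq_sym subr_eq => /eqP ->.
  set X := (F z - F 0) / D; set Y := _ / D; set S1 := \sum_(l <- s) _.
  set S2 := \sum_(l <- s) _; set S3 := \sum_(l <- s) _.
  suff : F 0 - 1 + S1 - S2 = - S3.
    by move: (F 0) => c e; rewrite -e; ring.
  rewrite F0 pE rmorphB rmorph1 rmorph_sum /= [1 - _]addrC addrK.
  rewrite /S1 /S2 /S3 -!sumrN -!big_split /= !big_seq; apply: eq_bigr => l ls.
  have dl : r%:C ^+ 2 - l%:C * z != 0 by rewrite -normc_gt0; have := den l ls; lra.
  have lz : l%:C - z != 0.
    move: ls; rewrite hs => /asboolP[Al lr].
    rewrite subr_eq0; apply: contra Wz => /eqP <-.
    by rewrite (wprod_root hA hid Al).
  rewrite !(rmorphM, rmorphB, fmorphV, rmorphXn, rmorph1) /=.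
  by field; rewrite dl lz rc.
rewrite key; apply: le_trans (ler_normcB _ _) _.
have a1 : N ((F z - F 0) / D) <= 16 / 3 * t.
  rewrite normcf_div; have := hF z zr; rewrite -/t => h.
  apply: le_trans (ler_pM (normc_ge0 _) iD0 h iD) _.
  by nra.
have a2 : N (F 0 * (z ^+ 2 / r%:C ^+ 2) / D) <= 2 / 3 * t.
  rewrite normcf_div Normc.normcM nD F0 normc_real (ger0_norm p0).
  have h : p * t ^+ 2 <= 1 / 2 * t by nra.
  have pt : 0 <= p * t ^+ 2 by rewrite mulr_ge0 ?exprn_ge0.
  by apply: le_trans (ler_pM pt iD0 h iD) _; lra.
have a3 : N (\sum_(l <- s) (res l)%:C * (l%:C ^+ 3 * z / (r%:C ^+ 2 * (r%:C ^+ 2 - l%:C * z)))) <=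
    2 * t.
  apply: le_trans (normc_sum _ _ _) _.
  apply: (@le_trans _ _ (\sum_(l <- s) res l * (2 * t))).
    rewrite !big_seq; apply: ler_sum => l ls; rewrite Normc.normcM normc_real (ger0_norm (res0 l ls)).
    apply: ler_wpM2l; first exact: res0.
    have dl := den l ls; move: ls; rewrite hs => /asboolP[Al lr].
    rewrite normcf_div [N (_ ^+ 3 * _)]Normc.normcM [N (_ ^+ 2 * _)]Normc.normcM !normcX.
    rewrite !normc_real (gtr0_norm r0).
    rewrite ler_pdivrMr; last by rewrite mulr_gt0//; lra.
    apply: (@le_trans _ _ (2 * t * (r ^+ 2 * (r ^+ 2 / 2)))); last first.
      by apply: ler_wpM2l; [rewrite mulr_ge0|rewrite ler_pM2l].
    rewrite (_ : 2 * t * _ = r ^+ 3 * N z); last by rewrite /t; field; rewrite gt_eqF.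
    by apply: ler_wpM2r => //; apply: lerXn2r; rewrite ?nnegrE ?(ltW r0) ?(ltW lr).
  rewrite -mulr_suml; have := residue_sum_le1 (disc_listin ds); nra.
have := le_normcD ((F z - F 0) / D) (F 0 * (z ^+ 2 / r%:C ^+ 2) / D).
rewrite -/t; lra.
Qed.

(** Since [1 + z / (l - z) = l / (l - z)], the expansion is a convex combination of 1 and the
    numbers [l / (l - imag y)], all of modulus at most 1. *)
Lemma herglotz_imag (y : R) : N (Q (imag y)) <= N (W (imag y)).
Proof.
have [->|y0] := eqVneq y 0.
  rewrite (_ : imag 0 = 0); last exact: complex_eqP.
  by rewrite Q0 (wprod0 hA hid).
have Wy : W (imag y) != 0 by exact: W_Im_neq0.
have Ny : N (imag y) = `|y| by rewrite /imag normcE /= expr0n add0r sqrtr_sqr.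
have Wp : 0 < N (W (imag y)) by rewrite normc_gt0.
rewrite -[leRHS]mul1r -ler_pdivrMr// -normcf_div.
apply/ler_addgt0Pl => e e0.
have [r [s [rr ds]]] := disc_list_exists (2 * `|y| + 8 * `|y| / e).
have q0 : 0 <= 8 * `|y| / e by rewrite !mulr_ge0 ?invr_ge0// ltW.
have [r0 _ us hs] := ds.
have yr : N (imag y) <= r / 2 by rewrite Ny; lra.
have := herglotz_expansion ds Wy yr; set S := \sum_(l <- s) _ => h.
have h8 : 8 * (N (imag y) / r) <= e.
  rewrite Ny mulrA ler_pdivrMr// -ler_pdivrMl// mulrC; have := normr_ge0 y; lra.
have S1 : N (1 + S) <= 1.
  have -> : 1 + S = (1 - \sum_(l <- s) res l)%:C +
      \sum_(l <- s) (res l)%:C * (l%:C / (l%:C - imag y)).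
    rewrite rmorphB rmorph1 rmorph_sum /= -addrA; congr (1 + _).
    rewrite -sumrN -big_split /=; apply: eq_bigr => l _.
    have ly : l%:C - imag y != 0 by apply: normc_pos_Im0; rewrite /= sub0r oppr_eq0.
    by field.
  apply: le_trans (le_normcD _ _) _.
  have g1 := residue_sum_le1 (disc_listin ds).
  rewrite normc_real ger0_norm ?subr_ge0//.
  suff : N (\sum_(l <- s) (res l)%:C * (l%:C / (l%:C - imag y))) <= \sum_(l <- s) res l by lra.
  apply: le_trans (normc_sum _ _ _) _; rewrite !big_seq; apply: ler_sum => l ls.
  have g0 : 0 <= res l.
    by apply: (residue_ge0 hA hQ Qreal Qim); exact: (disc_listin ds).2.
  rewrite Normc.normcM normc_real (ger0_norm g0) -[leRHS]mulr1; apply: ler_wpM2l => //.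
  have ly : 0 < N (l%:C - imag y).
    by rewrite normc_gt0; apply: normc_pos_Im0; rewrite /= sub0r oppr_eq0.
  rewrite normcf_div ler_pdivrMr// mul1r normc_real.
  by apply: le_trans (normc_ge_Re _); rewrite /= subr0.
have := le_normcD (Q (imag y) / W (imag y) - 1 - S) (1 + S).
rewrite (_ : _ - 1 - S + (1 + S) = Q (imag y) / W (imag y)); last by ring.
lra.
Qed.

(** [Im (z Q / W)] is [Im z] times a sum of nonnegative terms. This sum is bounded below by some
    [c > 0] for all large lists: a positive weight contributes a fixed amount, and without positive
    weights the sum is 1. A nonreal zero would make the expansion error exceed [c]. *)
Lemma herglotz_zero_real z : Q z = 0 -> complex.Im z = 0.
Proof.
wlog y0 : z / 0 < complex.Im z => [hw Qz|].
  have [y0|y0|//] := ltgtP (complex.Im z) 0; last exact: hw.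
  have yc : 0 < complex.Im (conjc z) by case: (z) y0 => x y /=; lra.
  have := hw _ yc; rewrite (centire_conj _ hQ Qreal) Qz.
  move=> /(_ (conjc_realE (erefl : complex.Im (0 : C) = 0))).
  by case: (z) => x y /=; lra.
move=> Qz; exfalso.
have Wz : W z != 0 by apply: W_Im_neq0; rewrite // gt_eqF.
have lz l : l%:C - z != 0 by apply: normc_pos_Im0; rewrite ImD ImN /= sub0r oppr_eq0 gt_eqF.
have ip (l : R) w : complex.Im (l%:C * w) = l * complex.Im w.
  by rewrite ImM /= mul0r addr0.
have imE s : complex.Im (z * (1 + \sum_(l <- s) (res l)%:C * (z / (l%:C - z)))) =
    complex.Im z * ((1 - \sum_(l <- s) res l) + \sum_(l <- s) res l * (l ^+ 2 / N (l%:C - z) ^+ 2)).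
  have -> : z * (1 + \sum_(l <- s) (res l)%:C * (z / (l%:C - z))) =
      (1 - \sum_(l <- s) res l)%:C * z +
      \sum_(l <- s) ((res l * l)%:C * (z / (l%:C - z))).
    rewrite rmorphB rmorph1 rmorph_sum /= mulrDr mulr1 mulrBl mul1r -addrA; congr (_ + _).
    rewrite mulr_suml mulr_sumr -sumrN -big_split /=; apply: eq_bigr => l _.
    by rewrite rmorphM /=; field; exact: lz.
  rewrite ImD ip Im_sum mulrDr; congr (_ + _); first by rewrite mulrC.
  rewrite mulr_sumr; apply: eq_bigr => l _; rewrite ip.
  have -> : complex.Im (z / (l%:C - z)) = l * complex.Im z / N (l%:C - z) ^+ 2.
    by rewrite ImM ImV ReV; move: (N _) => n; rewrite ReD ImD ReN ImN /=; ring.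
  by ring.
have [c c0 [s0 hs0 hc]] : exists2 c : R, 0 < c & exists2 s0, listin A s0 &
    forall s, listin A s -> {subset s0 <= s} ->
      c <= (1 - \sum_(l <- s) res l) + \sum_(l <- s) res l * (l ^+ 2 / N (l%:C - z) ^+ 2).
  have tg0 s l : listin A s -> l \in s -> 0 <= res l * (l ^+ 2 / N (l%:C - z) ^+ 2).
    move=> hs ls; apply: mulr_ge0; last by rewrite divr_ge0 ?sqr_ge0.
    by apply: (residue_ge0 hA hQ Qreal Qim); exact: hs.2.
  have [[l [Al gl]]|nex] := pselect (exists l, A l /\ 0 < res l).
    exists (res l * (l ^+ 2 / N (l%:C - z) ^+ 2)).
      apply: mulr_gt0 => //; apply: divr_gt0; last by rewrite exprn_gt0// normc_gt0.
      by rewrite exprn_even_gt0//; exact: hA.1.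
    exists [:: l]; first by split=> // m; rewrite inE => /eqP ->.
    move=> s hs sub; have g1 := residue_sum_le1 hs.
    have ls : l \in s by apply: sub; exact: mem_head.
    rewrite [X in _ <= _ + X](bigD1_seq l)//=; last exact: hs.1.
    have : 0 <= \sum_(m <- s | m != l) res m * (m ^+ 2 / N (m%:C - z) ^+ 2).
      by rewrite big_seq_cond; apply: sumr_ge0 => m /andP[ms _]; exact: tg0 ms.
    lra.
  exists 1; first exact: ltr01.
  exists [::]; first by split.
  move=> s hs _; have -> : \sum_(l <- s) res l = 0.
    rewrite big_seq big1// => l /hs.2 Al; apply: le_anti.
    rewrite (residue_ge0 hA hQ Qreal Qim Al) andbT leNgt; apply/negP => gl.
    by apply: nex; exists l.
  rewrite subr0 lerDl big_seq; apply: sumr_ge0 => l; exact: tg0.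
have [M M0 hM] : exists2 M : R, 0 < M & forall l, l \in s0 -> `|l| <= M.
  elim: (s0) => [|l t [M M0 hM]]; first by exists 1.
  exists (M + `|l|); first by rewrite ltr_wpDr.
  move=> m; rewrite inE => /predU1P[->|/hM h]; first by rewrite lerDr ltW.
  by apply: le_trans h _; rewrite lerDl.
have z0 := normc_ge0 z.
have yc : 0 < complex.Im z * c by rewrite mulr_gt0.
have q0 : 0 <= 8 * N z ^+ 2 / (complex.Im z * c) by rewrite !mulr_ge0 ?invr_ge0 ?exprn_ge0// ltW.
have [r [s [rr ds]]] := disc_list_exists (M + 2 * N z + 8 * N z ^+ 2 / (complex.Im z * c)).
have [r0 _ us hs] := ds.
have zr : N z <= r / 2 by lra.
have := herglotz_expansion ds Wz zr; rewrite Qz mul0r sub0r -opprD normcN => h.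
have sub : {subset s0 <= s}.
  move=> l ls; rewrite hs; apply/asboolP; split; first exact: hs0.2.
  by have := hM _ ls; lra.
have := hc s (disc_listin ds) sub; set X := _ + _ => cX.
have := normc_ge_Im (z * (1 + \sum_(l <- s) (res l)%:C * (z / (l%:C - z)))).
rewrite imE -/X Normc.normcM => h1.
have h2 := le_trans h1 (ler_wpM2l z0 h).
have h3 : complex.Im z * c <= N z * (8 * (N z / r)).
  apply: le_trans h2; apply: le_trans (ler_norm _); rewrite ler_pM2l//.
have : N z * (8 * (N z / r)) < complex.Im z * c.
  rewrite (_ : N z * _ = 8 * N z ^+ 2 / r); last by ring.
  rewrite ltr_pdivrMr// [ltRHS]mulrC -ltr_pdivrMr//; lra.
lra.
Qed.

End herglotz_expansion.

(** * From the imaginary axis to a majorant on the plane *)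

Section majorant.
Variable R : realType.
Local Notation C := R[i].
Local Notation N := (@Normc.normc R).
Implicit Types (A : set R) (z w m : C) (s : seq C) (f g G : C -> C).

Lemma normc_1D_half z (a : R) : 0 <= a -> 0 <= complex.Re z ->
  1 <= N (1 + a%:C * z) /\ a * N z <= N (1 + a%:C * z).
Proof.
move=> a0 z0; have az : 0 <= a * complex.Re z by rewrite mulr_ge0.
split.
  apply: le_trans (normc_ge_Re _); rewrite ReD ReM /= mul0r subr0.
  by rewrite ger0_norm; lra.
rewrite -(@ler_pXn2r _ 2)// ?nnegrE ?normc_ge0//; last by rewrite mulr_ge0 ?normc_ge0.
by rewrite exprMn !sqr_normcE ReD ImD ReM ImM /=; nra.
Qed.

(* The quotient by [G z * (1 + e z) ^ (size s + 1)] tends to [0] at infinity in the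
   half plane and is at most [1] on the imaginary axis; then [e] tends to [0]. *)
Lemma right_half_bound s G (x : R) : (forall m, m \in s -> m != 0) ->
  (forall z, 0 <= complex.Re z -> cdiff G z /\ 1 <= N (G z)) ->
  (forall y, N (\prod_(m <- s) (1 + ((N m)^-1)%:C * imag y)) <= N (G (imag y))) ->
  0 <= x -> \prod_(m <- s) (1 + x / N m) <= N (G x%:C).
Proof.
move=> s0 hG hI x0; pose P z := \prod_(m <- s) (1 + ((N m)^-1)%:C * z).
have Px : N (P x%:C) = \prod_(m <- s) (1 + x / N m).
  rewrite /P normc_prod; apply: eq_bigr => m _.
  rewrite (_ : 1 + _ = (1 + x / N m)%:C); last by rewrite rmorphD rmorphM rmorph1 mulrC.
  by rewrite normc_real ger0_norm// addr_ge0// divr_ge0 ?normc_ge0.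
have P1 : 1 <= N (P x%:C).
  rewrite Px; apply: (big_ind (fun x : R => 1 <= x)) => // [a b ha hb|m _].
    by rewrite -[1]mulr1; apply: ler_pM.
  by rewrite lerDl divr_ge0 ?normc_ge0.
have [_ G1] := hG x%:C x0.
rewrite -Px -ler_ln ?posrE; [|lra|lra].
apply/ler_addgt0Pl => d d0.
pose n := (size s).+1.
pose e := d / (n%:R * (x + 1)).
have n0 : 0 < n%:R :> R by rewrite ltr0n.
have e0 : 0 < e by rewrite divr_gt0// mulr_gt0//; lra.
pose c := \prod_(m <- s) (1 + (N m)^-1).
have c1 : 1 <= c.
  apply: (big_ind (fun x : R => 1 <= x)) => // [a b ha hb|m _].
    by rewrite -[1]mulr1; apply: ler_pM.
  by rewrite lerDl invr_ge0 normc_ge0.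
have en0 : 0 < e ^+ n by rewrite exprn_gt0.
(* Since [r >= c / e ^+ n], one has [c * r ^+ size s <= (e * r) ^+ n]: the additional factor in the
   denominator beats the numerator on the arc. *)
pose r := c / e ^+ n + x + 1.
have ce : 0 < c / e ^+ n by rewrite divr_gt0//; lra.
have r1 : 1 <= r by rewrite /r; lra.
pose F z := P z / (G z * (1 + e%:C * z) ^+ n).
have den z : 0 <= complex.Re z -> 0 < N (G z) * N (1 + e%:C * z) ^+ n.
  move=> z0; have [_ h] := hG z z0; have [h1 _] := normc_1D_half (ltW e0) z0.
  by rewrite mulr_gt0 ?exprn_gt0//; lra.
have NF z : N (F z) = N (P z) / (N (G z) * N (1 + e%:C * z) ^+ n).
  by rewrite /F normcf_div Normc.normcM normcX.
have dF z : 0 <= complex.Re z -> cdiff F z.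
  move=> z0; have [dG _] := hG z z0; apply: cdiffM.
    apply: cdiff_prod => m _; apply: cdiffD; first exact: cdiff_cst.
    by apply: cdiffM; [exact: cdiff_cst|exact: cdiff_id].
  apply: cdiffV; first by rewrite -normc_gt0 Normc.normcM normcX; exact: den.
  apply: cdiffM => //; apply: cdiffX; apply: cdiffD; first exact: cdiff_cst.
  by apply: cdiffM; [exact: cdiff_cst|exact: cdiff_id].
have FI z : complex.Re z = 0 -> N (F z) <= 1.
  move=> zre; have z0 : 0 <= complex.Re z by rewrite zre.
  rewrite NF ler_pdivrMr ?den// mul1r.
  have zI : z = imag (complex.Im z) by apply: complex_eqP => //=.
  have h : N (P z) <= N (G z) by rewrite zI; exact: hI.
  apply: le_trans h _; have [h1 _] := normc_1D_half (ltW e0) z0.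
  by rewrite ler_peMr ?normc_ge0// exprn_ege1.
have Fr z : 0 <= complex.Re z -> N z = r -> N (F z) <= 1.
  move=> z0 zr; rewrite NF ler_pdivrMr ?den// mul1r.
  have [_ h1] := hG z z0; have [_ h2] := normc_1D_half (ltW e0) z0.
  apply: (@le_trans _ _ (c * r ^+ size s)).
    rewrite /P /c normc_prod; elim: (s) => [|m t IH]; first by rewrite !big_nil mulr1.
    rewrite !big_cons /= exprS mulrACA; apply: ler_pM => //.
      by apply: prodr_ge0.
    apply: le_trans (le_normcD _ _) _.
    rewrite Normc.normc1 Normc.normcM normc_real zr ger0_norm ?invr_ge0 ?normc_ge0//.
    by rewrite mulrDl mul1r; lra.
  have h3 : (e * r) ^+ n <= N (1 + e%:C * z) ^+ n.
    apply: lerXn2r; rewrite ?nnegrE ?normc_ge0//; last by rewrite -zr.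
    by rewrite mulr_ge0//; lra.
  have h4 : c * r ^+ size s <= (e * r) ^+ n.
    rewrite exprMn [r ^+ n]exprS mulrA; apply: ler_wpM2r; first by rewrite exprn_ge0//; lra.
    by rewrite mulrC -ler_pdivrMr// /r; lra.
  apply: le_trans h4 (le_trans h3 _).
  by rewrite ler_peMl// exprn_ge0// normc_ge0.
have xr : N (x%:C : C) <= r by rewrite normc_real ger0_norm// /r; lra.
have r0 : 0 < r by lra.
have := half_disc_max r0 dF FI Fr (x0 : 0 <= complex.Re x%:C) xr.
rewrite NF ler_pdivrMr ?den// mul1r -ler_ln ?posrE ?den//; last by lra.
move=> h; apply: le_trans h _.
have ex : 0 <= e * x by rewrite mulr_ge0// ltW.
have k1 : N (1 + e%:C * x%:C) = 1 + e * x.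
  have -> (u v : R) : 1 + u%:C * v%:C = (1 + u * v)%:C :> C by rewrite rmorphD rmorphM rmorph1.
  by rewrite normc_real ger0_norm//; lra.
rewrite k1 lnM ?posrE ?exprn_gt0//; [|lra|lra].
rewrite addrC lerD2r.
have k2 : (1 + e * x) ^+ n <= expR (e * x) ^+ n.
  by apply: lerXn2r; rewrite ?nnegrE ?expR_ge0//; [lra|exact: expR_ge1Dx].
have k3 : ln ((1 + e * x) ^+ n) <= ln (expR (e * x) ^+ n).
  by rewrite ler_ln ?posrE ?exprn_gt0 ?expR_gt0//; lra.
apply: le_trans k3 _; rewrite -expRM_natl expRK.
have -> : n%:R * (e * x) = d * (x / (x + 1)).
  by rewrite /e; field; rewrite gt_eqF ?gt_eqF//; lra.
rewrite ger_pMr// ler_pdivrMr; lra.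
Qed.

(** Up to a factor close to 1, [f z] is a finite product over real zeros, at most
    [\prod (1 + N z / N m)]. On the imaginary axis moving each zero [m] to [- N m] does not change
    moduli, so that product is dominated there by [f], hence by [W] and by the majorant;
    [right_half_bound] transfers this to the positive half line. *)
Lemma real_rooted_majorant A f z : abs_summable A -> centire f -> type_zero f -> f 0 = 1 ->
  (forall w, f w = 0 -> complex.Im w = 0) ->
  (forall y, N (f (imag y)) <= N (wprod A id (imag y))) ->
  N (f z) <= N (wprod A (@negabs R) (N z)%:C).
Proof.
move=> hA hf tf f0 hr hI.
have We1 w : 0 <= complex.Re w -> 1 <= N (wprod A (@negabs R) w) by exact: wprod_negabs_ge1.
have [->|fz] := eqVneq (f z) 0; first by rewrite Normc.normc0 normc_ge0.
have G1 : 1 <= N (wprod A (@negabs R) (N z)%:C) by apply: We1; exact: normc_ge0.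
have fz0 : 0 < N (f z) by rewrite normc_gt0.
rewrite -ler_ln ?posrE//; last by lra.
apply/ler_addgt0Pl => d d0.
have [r r0 hcore] := hadamard_core z tf f0 d0.
have [s [g [hg hs fg g0 sI]]] := real_rooted_zprod hf tf f0 hr r0.
have hs' m : m \in s -> m != 0 /\ N m <= r by move=> /hs[].
have := hcore _ _ _ (lexx _) hg hs' fg g0.
rewrite ler_norml => /andP[_ lg].
move: fz0; rewrite fg Normc.normcM => fz0.
have z0 := normc_ge0 (zprod s z); have g0' := normc_ge0 (g z).
have gp : 0 < N (g z).
  by rewrite lt_def g0' andbT; apply/eqP => h; rewrite h mulr0 ltxx in fz0.
have zp : 0 < N (zprod s z) by rewrite -(pmulr_lgt0 _ gp).
rewrite lnM ?posrE// addrC; apply: lerD => //.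
rewrite ler_ln ?posrE//; last by lra.
apply: (@le_trans _ _ (\prod_(m <- s) (1 + N z / N m))).
  rewrite /zprod normc_prod; apply: ler_prod => m _; rewrite normc_ge0 /=.
  by apply: le_trans (ler_normcB _ _) _; rewrite Normc.normc1 normcf_div.
apply: right_half_bound => //; last exact: normc_ge0.
- by move=> m /hs[].
- move=> w w0; split; last exact: We1.
  exact: (wprod_entire hA (@negabs_norm R)).
move=> y; apply: le_trans (wprod_imag _ hA (fun=> erefl)).
apply: le_trans (le_trans (sI y) (hI y)).
rewrite /zprod !normc_prod !big_seq; apply: ler_prod => m ms; rewrite normc_ge0 /=.
have [_ _ mI] := hs m ms; rewrite (real_of_Im0 mI).
set a := N (complex.Re m)%:C; rewrite (imag_factor (l' := - a)); last first.
  by rewrite normrN /a normc_real normr_id.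
rewrite (_ : 1 - imag y / (- a)%:C = 1 + (a^-1)%:C * imag y)//.
by rewrite (fmorphV (real_complex R)) rmorphN invrN mulrN opprK mulrC.
Qed.

End majorant.

(** * Rigidity of the limit factors *)

Section rigidity.
Variable R : realType.
Local Notation C := R[i].
Local Notation N := (@Normc.normc R).
Implicit Types (A B : set R) (z w m : C) (s : seq R) (f g F H G : C -> C).

Let hid (l : R) : `|id l| = `|l|. Proof. by []. Qed.

(** Divisions by factors with real zeros give identities only off the real axis; continuity restores
    them on it. *)
Lemma eq_nonreal f g : centire f -> centire g ->
  (forall z, complex.Im z != 0 -> f z = g z) -> forall z, f z = g z.
Proof.
move=> hf hg fg z; apply/eqP; rewrite -subr_eq0 -normc_eq0 eq_le normc_ge0 andbT.
apply/ler_addgt0Pl => e e0; rewrite addr0.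
have e2 : 0 < e / 2 by lra.
have /ccontP /(_ _ e2)[d1 d10 h1] := cdiff_cont (hf z).
have /ccontP /(_ _ e2)[d2 d20 h2] := cdiff_cont (hg z).
have [y [y0 yd yz]] : exists y : R, [/\ 0 < y, y < Num.min d1 d2 & complex.Im z + y != 0].
  have m0 : 0 < Num.min d1 d2 by rewrite lt_min d10.
  have [y /andP[y0 yd] ys] := @avoid_list _ [:: - complex.Im z] _ _ m0.
  exists y; split=> //; move: ys; rewrite inE; apply: contra => /eqP h.
  by apply/eqP; lra.
pose w := z + imag y.
have Nw : N (w - z) = y by rewrite /w addrC addKr /imag normcE /= expr0n add0r sqrtr_sqr gtr0_norm.
have wI : complex.Im w != 0 by rewrite ImD.
move: yd; rewrite lt_min => /andP[y1 y2].
have k1 : N (f w - f z) < e / 2 by apply: h1; rewrite Nw.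
have k2 : N (g w - g z) < e / 2 by apply: h2; rewrite Nw.
rewrite (_ : f z - g z = (g w - g z) - (f w - f z)); last by rewrite (fg w wI); ring.
by apply: le_trans (ler_normcB _ _) _; lra.
Qed.

Definition vanishing A f := forall l, A l -> f l%:C = 0.

Definition normalized f := [/\ centire f, type_zero f & f 0 = 1].

Lemma wprod_normalized A nu : abs_summable A -> (forall l, `|nu l| = `|l|) ->
  normalized (wprod A nu).
Proof.
move=> hA hnu; split; [exact: wprod_entire| |exact: wprod0].
move=> e e0; have [M hM] := wprod_type_zero hA e0; exists M => z.
by apply: le_trans (wprod_majorant z hA hnu) _; apply: hM; exact: normc_ge0.
Qed.

Lemma normalized_div f g m : m != 0 -> normalized f -> centire g ->
  (forall z, f z = (1 - z / m) * g z) -> normalized g.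
Proof.
move=> m0 [hf tf f0] hg fg; split=> //.
  apply: (@type_zero_div _ f g [:: m]) => //.
    by move=> w; rewrite inE => /eqP ->.
  by move=> z; rewrite zprod_cons /zprod big_nil mulr1.
by have := fg 0; rewrite mul0r subr0 mul1r f0.
Qed.

(* The zero [r] of [F * H] belongs to a factor that can lose it while still
   vanishing on its prescribed set, as the sets are disjoint. *)
Lemma pull_factor_left (A B : set R) F H G (r : R) : (forall l, A l -> B l -> False) ->
  r != 0 -> ~ B r -> normalized F -> normalized H -> centire G ->
  vanishing A F -> vanishing B H -> vanishing A G ->
  (forall z, F z * H z = (1 - z / r%:C) * G z) ->
  exists F1 H1, [/\ normalized F1 /\ normalized H1, vanishing A F1, vanishing B H1,
    forall z, F1 z * H1 z = G z &
    (forall z, F z = (1 - z / r%:C) * F1 z /\ H z = H1 z) \/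
    (forall z, F z = F1 z /\ H z = (1 - z / r%:C) * H1 z)].
Proof.
move=> dis r0 Br nF nH hG vF vH vG FH.
have [hF _ _] := nF; have [hH _ _] := nH.
have rc : r%:C != 0 :> C by rewrite -normc_eq0 normc_real normr_eq0.
have nz z : complex.Im z != 0 -> 1 - z / r%:C != 0.
  apply: contra; rewrite subr_eq0 => /eqP h.
  by rewrite -[z](divfK rc) -h mul1r.
have vdiv S f g : ~ S r -> vanishing S f -> (forall z, f z = (1 - z / r%:C) * g z) ->
    vanishing S g.
  move=> Sr vf fg l Sl; have := vf l Sl; rewrite fg => /eqP; rewrite mulf_eq0 => /orP[|/eqP //].
  rewrite subr_eq0 => /eqP h; have : l%:C = r%:C :> C by rewrite -[LHS](divfK rc) -h mul1r.
  by move=> /complexI lr; case: Sr; rewrite -lr.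
have pullH : H r%:C = 0 -> exists F1 H1, [/\ normalized F1 /\ normalized H1, vanishing A F1,
    vanishing B H1, forall z, F1 z * H1 z = G z &
    (forall z, F z = (1 - z / r%:C) * F1 z /\ H z = H1 z) \/
    (forall z, F z = F1 z /\ H z = (1 - z / r%:C) * H1 z)].
  move=> Hr; have [H1 hH1 HH1] := centire_div hH rc Hr.
  exists F, H1; split=> //.
  - by split=> //; exact: normalized_div nH hH1 HH1.
  - exact: vdiv vH HH1.
  - apply: eq_nonreal => // [|z zI]; first exact: centireM.
    by apply: (mulfI (nz z zI)); rewrite -FH HH1; ring.
  - by right.
have [Hr|Hr] := eqVneq (H r%:C) 0; first exact: pullH.
have Fr : F r%:C = 0.
  have := FH r%:C; rewrite divff// subrr mul0r => /eqP; rewrite mulf_eq0 (negPf Hr) orbF.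
  by move/eqP.
have [F1 hF1 FF1] := centire_div hF rc Fr.
have F1H : forall z, F1 z * H z = G z.
  apply: eq_nonreal => // [|z zI]; first exact: centireM.
  by apply: (mulfI (nz z zI)); rewrite -FH FF1; ring.
exists F1, H; split=> //; [by split=> //; exact: normalized_div nF hF1 FF1| |by left].
move=> l Al; have [lr|lr] := eqVneq l r.
  have := F1H l%:C; rewrite (vG l Al) lr => /eqP; rewrite mulf_eq0 (negPf Hr) orbF.
  by move/eqP.
have := vF l Al; rewrite FF1 => /eqP; rewrite mulf_eq0 => /orP[|/eqP //].
rewrite subr_eq0 => /eqP h; have : l%:C = r%:C :> C by rewrite -[LHS](divfK rc) -h mul1r.
by move=> /complexI e; rewrite e eqxx in lr.
Qed.

(** Adds to the preceding lemma the case [c = 0], where the factor is 1, and the case of a zero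
    prescribed for [H], where the roles are exchanged. The boolean records which function receives
    the factor. *)
Lemma pull_factor (A B : set R) F H G (c : R) : (forall l, A l -> B l -> False) ->
  normalized F -> normalized H -> centire G ->
  vanishing A F -> vanishing B H -> vanishing A G -> vanishing B G ->
  (forall z, F z * H z = (1 - c%:C * z) * G z) ->
  exists F1 H1, [/\ normalized F1 /\ normalized H1, vanishing A F1, vanishing B H1,
    forall z, F1 z * H1 z = G z &
    exists b : bool, forall z,
      F z = (1 - c%:C * z) ^+ b * F1 z /\ H z = (1 - c%:C * z) ^+ (~~ b) * H1 z].
Proof.
move=> dis nF nH hG vF vH vGA vGB FH.
have [c0|c0] := eqVneq c 0.
  exists F, H; split=> //; first by move=> z; rewrite FH c0 mul0r subr0 mul1r.
  by exists true => z; rewrite c0 mul0r subr0 !expr1n !mul1r.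
have r0 : c^-1 != 0 by rewrite invr_neq0.
have cE z : c%:C * z = z / (c^-1)%:C by rewrite fmorphV invrK mulrC.
have [Br|Br] := pselect (B c^-1).
  have dis' l : B l -> A l -> False by move=> Bl Al; exact: dis Al Bl.
  have nA : ~ A c^-1 by move=> /dis; exact.
  have HF z : H z * F z = (1 - z / (c^-1)%:C) * G z by rewrite mulrC FH cE.
  have [H1 [F1 [[n1 n2] v1 v2 e [h|h]]]] :=
    pull_factor_left dis' r0 nA nH nF hG vH vF vGB HF.
  - exists F1, H1; split=> //; first by move=> z; rewrite mulrC.
    by exists false => z; rewrite cE expr0 mul1r expr1; have [-> ->] := h z.
  - exists F1, H1; split=> //; first by move=> z; rewrite mulrC.
    by exists true => z; rewrite cE expr0 mul1r expr1; have [-> ->] := h z.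
have FH' z : F z * H z = (1 - z / (c^-1)%:C) * G z by rewrite FH cE.
have [F1 [H1 [[n1 n2] v1 v2 e [h|h]]]] := pull_factor_left dis r0 Br nF nH hG vF vH vGA FH'.
- exists F1, H1; split=> //; exists true => z; rewrite cE expr0 mul1r expr1.
  by have [-> ->] := h z.
- exists F1, H1; split=> //; exists false => z; rewrite cE expr0 mul1r expr1.
  by have [-> ->] := h z.
Qed.

Lemma wfin_zprod s z : wfin id s z = zprod [seq l%:C | l <- s] z.
Proof. by rewrite /zprod big_map. Qed.

Lemma wfin_nonreal s z : (forall l, l \in s -> l != 0) -> complex.Im z != 0 -> wfin id s z != 0.
Proof.
move=> s0 zI; rewrite /wfin prodf_seq_neq0; apply/allP => l ls /=.
have lc : l%:C != 0 :> C by rewrite -normc_eq0 normc_real normr_eq0; exact: s0.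
rewrite subr_eq0; apply: contra zI => /eqP h.
by rewrite -[z](divfK lc) -h mul1r.
Qed.

(** Divide [F] and [wprod A id] by the same zeros of [A] in a large disc. The quotient of [F] has no
    zero left there, since its product with the quotient of [H] has none; so [hadamard_core] puts
    both quotients within [d] of modulus 1 on the logarithmic scale. *)
Lemma wprod_rigid A B F H z : abs_summable A -> abs_summable B ->
  normalized F -> normalized H -> vanishing A F -> vanishing B H ->
  (forall z, F z * H z = wprod A id z * wprod B id z) ->
  wprod A id z != 0 -> N (F z) = N (wprod A id z).
Proof.
move=> hA hB [hF tF F0] [hH tH H0] vF vH FH Az.
(* The common factor [a], the finite product over the zeros, cancels when the moduli are
   compared. *)
suff close (d : R) : 0 < d -> exists a g g' : C, [/\ F z = a * g, wprod A id z = a * g', g != 0,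
    `|ln (N g)| <= d & `|ln (N g')| <= d].
  have A0 : 0 < N (wprod A id z) by rewrite normc_gt0.
  have F0z : 0 < N (F z).
    have [a [g [g' [-> e g0 _ _]]]] := close 1 ltr01.
    by move: Az; rewrite e mulf_eq0 negb_or normc_gt0 => /andP[a0 _]; rewrite mulf_neq0.
  apply: ln_inj; rewrite ?posrE//.
  apply/eqP; rewrite -subr_eq0 -normr_eq0 eq_le normr_ge0 andbT.
  apply/ler_addgt0Pl => e e0; rewrite addr0; have e2 : 0 < e / 2 by lra.
  have [a [g [g' [Fe Ae g0 lg lg']]]] := close _ e2.
  move: Az; rewrite Ae mulf_eq0 negb_or -!normc_gt0 => /andP[a0 g'0].
  have g0' : 0 < N g by rewrite normc_gt0.
  rewrite Fe !Normc.normcM !lnM ?posrE//.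
  rewrite opprD addrACA subrr add0r; apply: le_trans (ler_normB _ _) _; lra.
move=> d0; have [_ tA A0] := wprod_normalized hA hid.
have [r1 r10 c1] := hadamard_core z tF F0 d0.
have [r2 r20 c2] := hadamard_core z tA A0 d0.
pose r := r1 + r2 + N z; have z0 := normc_ge0 z.
have lst (S : set R) : abs_summable S -> exists2 s, listin S s /\ (forall l, l \in s -> `|l| <= r) &
    forall w, N w <= r -> wprod (S `\` [set` s]) id w != 0.
  move=> hS; have [s us hs] := @abs_summable_list _ S r hS.
  exists s; first by split; [split=> //|]; move=> l; rewrite hs => /asboolP[].
  move=> w wr; apply: wprod_neq0 => //; first by apply: abs_summableS hS => l [].
  move=> l [Sl /= ns]; apply/eqP => h; apply: ns; rewrite hs; apply/asboolP; split=> //.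
  by move: wr; rewrite h normc_real.
have [s [hs sr] ts] := lst A hA; have [t [ht tr] tt] := lst B hB.
have ok S s' f : abs_summable S -> listin S s' -> vanishing S f ->
    forall l, l \in s' -> l != 0 /\ f l%:C = 0.
  move=> hS hs' vf l ls; split; first by apply: hS.1; exact: hs'.2.
  by apply: vf; exact: hs'.2.
have [G hG FG] := centire_div_list hF hs.1 (ok _ _ _ hA hs vF).
have [K hK HK] := centire_div_list hH ht.1 (ok _ _ _ hB ht vH).
have hA' : abs_summable (A `\` [set` s]) by apply: abs_summableS hA => l [].
have hB' : abs_summable (B `\` [set` t]) by apply: abs_summableS hB => l [].
have GK w : G w * K w = wprod (A `\` [set` s]) id w * wprod (B `\` [set` t]) id w.
  move: w; apply: eq_nonreal; [exact: centireM|by apply: centireM; exact: wprod_entire|].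
  move=> w wI.
  have a0 : wfin id s w != 0 by apply: wfin_nonreal => // l /hs.2; exact: hA.1.
  have b0 : wfin id t w != 0 by apply: wfin_nonreal => // l /ht.2; exact: hB.1.
  have := FH w; rewrite FG HK (wprod_split _ hA hid hs) (wprod_split _ hB hid ht).
  move=> h; apply: (mulfI (mulf_neq0 a0 b0)).
  by rewrite -mulrACA [RHS]mulrACA -h; ring.
have G0 w : N w <= r -> G w != 0.
  move=> wr; have := mulf_neq0 (ts w wr) (tt w wr).
  by rewrite -GK mulf_eq0 negb_or => /andP[].
have hm m : m \in [seq l%:C | l <- s] -> m != 0 /\ N m <= r.
  move=> /mapP[l ls ->]; have l0 : l != 0 by apply: hA.1; exact: hs.2.
  rewrite -normc_eq0 normc_real normr_eq0 l0; split=> //.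
  exact: sr.
have rr1 : r1 <= r by rewrite /r; lra.
have rr2 : r2 <= r by rewrite /r; lra.
exists (wfin id s z), (G z), (wprod (A `\` [set` s]) id z); split.
- exact: FG.
- exact: wprod_split.
- by apply: G0; rewrite /r; lra.
- apply: (c1 r [seq l%:C | l <- s] G) => // w.
  by rewrite -wfin_zprod.
- apply: (c2 r [seq l%:C | l <- s]) => //; first exact: (wprod_entire hA' hid).
  by move=> w; rewrite -wfin_zprod; exact: wprod_split.
Qed.

End rigidity.

(** * Values of the limit factors at [l0] and [- l0] *)

Section limit_values.
Variable R : realType.
Local Notation C := R[i].
Local Notation N := (@Normc.normc R).
Implicit Types (A B : set R) (z w m : C) (f h : C -> C).

Let hid (l : R) : `|id l| = `|l|. Proof. by []. Qed.

Lemma wprod_vanishing A : abs_summable A -> vanishing A (wprod A id).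
Proof. by move=> hA l Al; exact: (wprod_root hA hid). Qed.

Lemma factor_distribution A B f h (x y : R) : abs_summable A -> abs_summable B ->
  (forall l, A l -> B l -> False) ->
  normalized f -> normalized h -> vanishing A f -> vanishing B h ->
  (forall z, f z * h z = (1 - x%:C * z) * ((1 - y%:C * z) * (wprod A id z * wprod B id z))) ->
  exists a b : bool, forall z, wprod A id z != 0 -> wprod B id z != 0 ->
    N (f z) = N (1 - x%:C * z) ^+ a * N (1 - y%:C * z) ^+ b * N (wprod A id z) /\
    N (h z) = N (1 - x%:C * z) ^+ (~~ a) * N (1 - y%:C * z) ^+ (~~ b) * N (wprod B id z).
Proof.
move=> hA hB dis nf nh vf vh fh.
have eA := wprod_entire hA hid; have eB := wprod_entire hB hid.
pose G2 z := wprod A id z * wprod B id z.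
have eG2 : centire G2 by exact: centireM.
pose G1 z := (1 - y%:C * z) * G2 z.
have eG1 : centire G1.
  apply: centireM => // z; apply: cdiffB; first exact: cdiff_cst.
  by apply: cdiffM; [exact: cdiff_cst|exact: cdiff_id].
have vA2 : vanishing A G2 by move=> l Al; rewrite /G2 (wprod_vanishing hA)// mul0r.
have vB2 : vanishing B G2 by move=> l Bl; rewrite /G2 (wprod_vanishing hB)// mulr0.
have vA1 : vanishing A G1 by move=> l Al; rewrite /G1 vA2// mulr0.
have vB1 : vanishing B G1 by move=> l Bl; rewrite /G1 vB2// mulr0.
have [f1 [h1 [[nf1 nh1] vf1 vh1 fh1 [a e1]]]] :=
  pull_factor dis nf nh eG1 vf vh vA1 vB1 fh.
have [f2 [h2 [[nf2 nh2] vf2 vh2 fh2 [b e2]]]] :=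
  pull_factor dis nf1 nh1 eG2 vf1 vh1 vA2 vB2 fh1.
exists a, b => z Az Bz.
have [-> ->] := e1 z; have [-> ->] := e2 z.
have <- := wprod_rigid hA hB nf2 nh2 vf2 vh2 fh2 Az.
have hf2 w : h2 w * f2 w = wprod B id w * wprod A id w by rewrite mulrC fh2 mulrC.
have <- := wprod_rigid hB hA nh2 nf2 vh2 vf2 hf2 Bz.
by rewrite !Normc.normcM !normcX !mulrA.
Qed.

(* With [t = z / l0], the product [(1 - x t) (1 - y t)] is
   [1 + (p - q) t - (1 - p - q) t ^ 2], which takes the values [2 p] and [2 q] at
   [1] and [-1]. *)
Lemma quadratic_factors (p q : R) : 0 <= p -> 0 <= q -> p + q <= 1 ->
  exists x y : R, [/\ x * y <= 0, - 1 <= x <= 1, - 1 <= y <= 1,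
    x + y = q - p & x * y = p + q - 1].
Proof.
move=> p0 q0 pq; pose d := p - q; pose m := 1 - p - q.
have m0 : 0 <= m by rewrite /m; lra.
have D0 : 0 <= d ^+ 2 + 4 * m by rewrite addr_ge0 ?sqr_ge0// mulr_ge0.
(* The root of the discriminant of [T ^+ 2 + d * T - m], whose roots are the required [x] and
   [y]. *)
pose S := Num.sqrt (d ^+ 2 + 4 * m).
have S0 : 0 <= S by exact: sqrtr_ge0.
have S2 : S ^+ 2 = d ^+ 2 + 4 * m by rewrite sqr_sqrtr.
have b1 : S <= 2 - d.
  rewrite -(@ler_pXn2r _ 2)// ?nnegrE//; last by rewrite /d; lra.
  rewrite S2 /d /m; nra.
have b2 : S <= 2 + d.
  rewrite -(@ler_pXn2r _ 2)// ?nnegrE//; last by rewrite /d; lra.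
  rewrite S2 /d /m; nra.
have d1 : `|d| <= 1 by rewrite ler_norml /d; apply/andP; split; lra.
move: d1; rewrite ler_norml => /andP[d1 d2].
have xy : (- d - S) / 2 * ((- d + S) / 2) = p + q - 1.
  have -> : (- d - S) / 2 * ((- d + S) / 2) = (d ^+ 2 - S ^+ 2) / 4 by field.
  by rewrite S2 /m; field.
exists ((- d - S) / 2), ((- d + S) / 2); split; rewrite ?xy//; first by lra.
- by apply/andP; split; lra.
- by apply/andP; split; lra.
- by rewrite /d; field.
Qed.

Lemma coupling_limit A B f h (l0 p q : R) : abs_summable A -> abs_summable B ->
  (forall l, A l -> B l -> False) -> 0 < l0 -> 0 <= p -> 0 <= q -> p + q <= 1 ->
  normalized f -> normalized h -> vanishing A f -> vanishing B h ->
  wprod A id l0%:C != 0 -> wprod B id l0%:C != 0 ->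
  wprod B id (- l0)%:C = wprod A id l0%:C -> wprod A id (- l0)%:C = wprod B id l0%:C ->
  f l0%:C * f (- l0)%:C = h l0%:C * h (- l0)%:C ->
  (forall z, f z * h z = wprod A id z * wprod B id z *
    (1 + ((p - q) / l0)%:C * z - ((1 - p - q) / l0 ^+ 2)%:C * z ^+ 2)) ->
  let u := N (f l0%:C) / N (wprod A id l0%:C) in
  let v := N (h l0%:C) / N (wprod B id l0%:C) in
  [/\ p = q, 0 < u + v & 4 * u * v / (u + v) ^+ 2 = 2 * p].
Proof.
move=> hA hB dis l00 p0 q0 pq nf nh vf vh A0 B0 BA AB sym fh u v.
have [x [y [xy0 /andP[x1 x2] /andP[y1 y2] xDy xMy]]] := quadratic_factors p0 q0 pq.
have ln0 : l0 != 0 by rewrite gt_eqF.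
have fh' z : f z * h z = (1 - (x / l0)%:C * z) * ((1 - (y / l0)%:C * z) *
    (wprod A id z * wprod B id z)).
  rewrite fh mulrA [RHS]mulrC; congr (_ * _).
  have -> : (p - q) / l0 = - (x / l0 + y / l0) by rewrite -mulrDl xDy; field.
  have -> : (1 - p - q) / l0 ^+ 2 = - (x / l0 * (y / l0)).
    rewrite (_ : x / l0 * (y / l0) = x * y / l0 ^+ 2); last by field.
    by rewrite xMy; field.
  by rewrite !rmorphN rmorphD rmorphM /=; ring.
have [a [b hab]] := factor_distribution hA hB dis nf nh vf vh fh'.
have nE (s e : R) : s ^+ 2 = 1 -> - 1 <= e <= 1 -> N (1 - (e / l0)%:C * (s * l0)%:C) = 1 - e * s.
  move=> s1 /andP[e1 e2]; rewrite (_ : 1 - _ = (1 - e * s)%:C).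
    by rewrite normc_real ger0_norm//; nra.
  by rewrite -rmorphM /= rmorphB rmorph1; congr (1 - _%:C); field.
have n1 (e : R) : - 1 <= e <= 1 -> N (1 - (e / l0)%:C * l0%:C) = 1 - e.
  by move=> he; have := nE 1 e (expr1n _ _) he; rewrite mul1r mulr1.
have n2 (e : R) : - 1 <= e <= 1 -> N (1 - (e / l0)%:C * (- l0)%:C) = 1 + e.
  by move=> he; have := nE (- 1) e _ he; rewrite sqrrN expr1n mulN1r mulrN1 opprK; apply.
have x12 : - 1 <= x <= 1 by apply/andP.
have y12 : - 1 <= y <= 1 by apply/andP.
have [f1 h1] := hab _ A0 B0.
have A0' : wprod A id (- l0)%:C != 0 by rewrite AB.
have B0' : wprod B id (- l0)%:C != 0 by rewrite BA.
have [f2 h2] := hab _ A0' B0'.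
rewrite !n1// in f1 h1; rewrite !n2// in f2 h2.
have An : N (wprod A id l0%:C) != 0 by rewrite normc_eq0.
have Bn : N (wprod B id l0%:C) != 0 by rewrite normc_eq0.
have uE : u = (1 - x) ^+ a * (1 - y) ^+ b by rewrite /u f1 mulfK.
have vE : v = (1 - x) ^+ (~~ a) * (1 - y) ^+ (~~ b) by rewrite /v h1 mulfK.
have := congr1 N sym; rewrite !Normc.normcM f1 f2 h1 h2 AB BA => rel.
have {}rel : (1 - x) ^+ a * (1 - y) ^+ b * ((1 + x) ^+ a * (1 + y) ^+ b) =
    (1 - x) ^+ (~~ a) * (1 - y) ^+ (~~ b) * ((1 + x) ^+ (~~ a) * (1 + y) ^+ (~~ b)).
  apply: (mulIf An); apply: (mulIf Bn); move: rel => rel.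
  by rewrite -[LHS]mulrA -[RHS]mulrA; lra.
have E1 : (1 - x) * (1 - y) = 2 * p by lra.
have E2 : (1 + x) * (1 + y) = 2 * q by lra.
have same (s t : R) : 4 * p * q = 1 -> s = 2 * p -> t = 1 ->
    [/\ p = q, 0 < s + t & 4 * s * t / (s + t) ^+ 2 = 2 * p].
  move=> pq4 -> ->; have : (p - q) ^+ 2 <= 0 by nra.
  rewrite exprn_even_le0//= subr_eq0 => /eqP epq; subst q.
  have hp : p = 1 / 2 by nra.
  by rewrite hp; split; [by []|lra|field].
have mixed (s t : R) : (1 - x) * (1 + x) = (1 - y) * (1 + y) ->
    s + t = 2 - x - y -> s * t = 2 * p ->
    [/\ p = q, 0 < s + t & 4 * s * t / (s + t) ^+ 2 = 2 * p].
  move=> e st sMt; have yx : y = - x.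
    have : (x + y) * (y - x) = 0 by lra.
    move/eqP; rewrite mulf_eq0 => /orP[/eqP|/eqP] k; first by lra.
    have yx : y = x by lra.
    have k2 := sqr_ge0 x; rewrite expr2 in k2; rewrite yx in xy0.
    have /eqP : x * x = 0 by lra.
    by rewrite mulf_eq0 orbb yx => /eqP ->; rewrite oppr0.
  have pq' : p = q by rewrite yx in E1 E2; lra.
  split=> //; first by rewrite st yx; lra.
  have -> : s + t = 2 by rewrite st yx; lra.
  by rewrite -(mulrA 4) sMt; field.
rewrite uE vE; case: a b rel {uE vE f1 f2 h1 h2 hab} => -[] /=;
  rewrite ?expr1 ?expr0 => rel.
- by apply: same; [nra|lra|lra].
- by apply: mixed; lra.
- by apply: mixed; lra.
- rewrite (addrC (1 * 1)) (mulrAC 4).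
  by apply: same; [nra|lra|lra].
Qed.

End limit_values.

(** * Asymptotics along the sequence of coupling problems *)

Section coupling_sequence.
Variable R : realType.
Local Notation C := R[i].
Local Notation N := (@Normc.normc R).
Implicit Types (z w m : C) (s t : seq R).

(** If [u] stayed away from 0 frequently, [\oo] restricted to those indices would be a proper
    filter, and an ultrafilter finer than it would contradict the hypothesis. *)
Lemma cvg_ultra0 (u : nat -> R) :
  (forall U : set_system nat, UltraFilter U -> \oo `<=` U -> u @ U --> (0 : R)) ->
  u @ \oo --> (0 : R).
Proof.
move=> h; apply/cvgrPdist_lt => e e0; apply: contrapT => nE.
pose E := [set k | `|0 - u k| < e].
have PF : ProperFilter (within (~` E) \oo).
  apply: (Build_ProperFilter_ex _ (within_filter (~` E) eventually_filter)) => P hP; apply: contrapT => nP; apply: nE.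
  rewrite /within /= in hP; apply: (@filterS _ _ eventually_filter _ _ _ hP) => k hk /=.
  apply: contrapT => nk.
  by apply: nP; exists k; exact: hk.
have [U [UU FU]] := @ultraFilterLemma _ _ PF.
have sub : \oo `<=` U by move=> P hP; apply: FU; apply: filterS hP => k hk _.
have /cvgrPdist_lt /(_ e e0) UE := h U UU sub.
have UE' : U (~` E) by apply: FU; apply: nearW => k.
by have [k [h1 h2]] := filter_ex (filterI UE UE').
Qed.

Lemma cvgc_le0 (T : Type) (U : set_system T) (FU : ProperFilter U) (u : T -> C) l (b : T -> R) :
  b @ U --> (0 : R) -> U [set t | N (u t) <= b t] -> cvgc U u l -> l = 0.
Proof.
move=> hb hu hl; apply: (cvgc_unique hl); apply: (cvgc_squeeze hb).
by apply: filterS hu => t /=; rewrite subr0.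
Qed.

Lemma wprod_opp (Am Ap : set R) z : abs_summable Am -> abs_summable Ap ->
  (forall l, Ap l <-> Am (- l)) -> wprod Ap id z = wprod Am id (- z).
Proof.
move=> hAm hAp Ap_opp; have hid (l : R) : `|id l| = `|l| by [].
apply: wprod_unique => //; have /cvgcP h := wprod_cvg hAm hid (- z).
apply/cvgcP => e /h[s0 hs0 hh].
have lopp B B' t : (forall l, B l -> B' (- l)) -> listin B t -> listin B' [seq - l | l <- t].
  move=> BB [ut ht]; split; first by rewrite map_inj_uniq//; exact: oppr_inj.
  by move=> l /mapP[m ms ->]; apply: BB; exact: ht.
exists [seq - l | l <- s0]; first by apply: lopp hs0 => l Bl; apply/Ap_opp; rewrite opprK.
move=> s [hs sub] /=.
have -> : wfin id s z = wfin id [seq - l | l <- s] (- z).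
  rewrite /wfin big_map; apply: eq_bigr => l _.
  by rewrite rmorphN invrN mulrNN.
apply: hh; split; first by apply: lopp hs => l /Ap_opp.
move=> l ls; rewrite -[l]opprK; apply: map_f; apply: sub.
exact: map_f.
Qed.

(** [Am] and [Ap] carry the zeros forced on the limits of [fm] and [fp], and [S] stands for the
    squared hyperbolic secant. The formula [SE] is required only where [u k + v k > 0]: when both
    values vanish, the fraction says nothing about [S]. *)
Variables (A Am Ap : set R) (l0 : R) (fm fp : nat -> C -> C) (S : nat -> R).
Local Notation Q k := (fun z => fm k z * fp k z).
Local Notation W := (wprod A id).
Local Notation res k := (residue A (Q k)).
Local Notation Wm := (wprod Am id).
Local Notation Wp := (wprod Ap id).
Let u k := N (fm k l0%:C) / N (Wm l0%:C).
Let v k := N (fp k l0%:C) / N (Wp l0%:C).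

Hypothesis hA : abs_summable A.
Hypothesis l0_gt0 : 0 < l0.
Hypothesis AE : A = (Am `|` Ap) `|` [set` [:: l0; - l0]].
Hypothesis dis : forall l, Am l -> Ap l -> False.
Hypothesis Ap_opp : forall l, Ap l <-> Am (- l).
Hypotheses (Aml0 : ~ Am l0) (Aml0' : ~ Am (- l0)).
Hypotheses (nm : forall k, normalized (fm k)) (np : forall k, normalized (fp k)).
Hypotheses (rm : forall k (x : R), complex.Im (fm k x%:C) = 0)
  (rp : forall k (x : R), complex.Im (fp k x%:C) = 0).
Hypothesis QW : forall k z, 0 < complex.Im z -> 0 <= complex.Im (z * (Q k z / W z)).
Hypothesis fm0 : forall l, Am l -> (fun k => N (fm k l%:C)) @ \oo --> (0 : R).
Hypothesis fp0 : forall l, Ap l -> (fun k => N (fp k l%:C)) @ \oo --> (0 : R).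
Hypothesis sym : forall k, fm k l0%:C * fm k (- l0)%:C = fp k l0%:C * fp k (- l0)%:C.
Hypothesis SE : forall k, 0 < u k + v k -> S k = 4 * u k * v k / (u k + v k) ^+ 2.

Let hid (l : R) : `|id l| = `|l|. Proof. by []. Qed.
Let hAm : abs_summable Am.
Proof. by apply: abs_summableS hA; rewrite AE => l h; left; left. Qed.
Let hAp : abs_summable Ap.
Proof. by apply: abs_summableS hA; rewrite AE => l h; left; right. Qed.
Let Apl0 : ~ Ap l0. Proof. by move/Ap_opp. Qed.
Let Apl0' : ~ Ap (- l0). Proof. by move/Ap_opp; rewrite opprK. Qed.
Let A_l0 : A l0. Proof. by rewrite AE; right; rewrite /= inE eqxx. Qed.
Let A_l0' : A (- l0). Proof. by rewrite AE; right; rewrite /= !inE eqxx orbT. Qed.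
Let l0_neq : l0 != - l0. Proof. by rewrite gt_eqF// (lt_trans _ l0_gt0)// oppr_lt0. Qed.

Lemma quot_entire k : centire (Q k).
Proof. by have [h1 _ _] := nm k; have [h2 _ _] := np k; exact: centireM. Qed.

Lemma quot0 k : Q k 0 = 1.
Proof. by have [_ _ h1] := nm k; have [_ _ h2] := np k; rewrite /= h1 h2 mulr1. Qed.

Lemma quot_real k (x : R) : complex.Im (Q k x%:C) = 0.
Proof. by rewrite /= ImM rm rp mulr0 mul0r addr0. Qed.

Lemma res_ge0 k l : A l -> 0 <= res k l.
Proof. exact: (residue_ge0 hA (quot_entire k) (quot_real k) (QW k)). Qed.

Lemma res_sum_le1 k s : listin A s -> \sum_(l <- s) res k l <= 1.
Proof. exact: (residue_sum_le1 hA (quot_entire k) (quot0 k) (quot_real k) (QW k)). Qed.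

Definition entire_majorant (x : R) := N (wprod A (@negabs R) x%:C).

(** On the imaginary axis the product is at most [W] in modulus and the other factor is at least 1,
    so each factor alone satisfies the hypothesis of [real_rooted_majorant]. *)
Lemma factors_majorant k z :
  N (fm k z) <= entire_majorant (N z) /\ N (fp k z) <= entire_majorant (N z).
Proof.
have real z' : Q k z' = 0 -> complex.Im z' = 0.
  exact: (herglotz_zero_real hA (quot_entire k) (quot0 k) (quot_real k) (QW k)).
have im y : N (Q k (imag y)) <= N (W (imag y)).
  exact: (herglotz_imag hA (quot_entire k) (quot0 k) (quot_real k) (QW k)).
have [hm tm m0] := nm k; have [hp tp p0] := np k.
have zm w : fm k w = 0 -> complex.Im w = 0 by move=> h; apply: real; rewrite h mul0r.
have zp w : fp k w = 0 -> complex.Im w = 0 by move=> h; apply: real; rewrite h mulr0.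
split; apply: real_rooted_majorant => // y; apply: le_trans (im y);
  rewrite Normc.normcM.
- by rewrite ler_peMr ?normc_ge0//; exact: real_rooted_imag.
- by rewrite ler_peMl ?normc_ge0//; exact: real_rooted_imag.
Qed.

(** The weight is a fixed multiple of the product of the two values at [l]: one of them tends to 0
    and the other stays below the majorant. *)
Lemma res_cvg0 l : Am l \/ Ap l -> (fun k => res k l) @ \oo --> (0 : R).
Proof.
move=> hl; have Al : A l by rewrite AE; left.
pose c := N (wprod (A `\` [set` [:: l]]) id l%:C).
pose M := entire_majorant (N (l%:C : C)).
have bound k : `|res k l| <= N (fm k l%:C) * N (fp k l%:C) / c.
  apply: le_trans (normc_ge_Re _) _.
  by rewrite normcf_div Normc.normcM.
have c0 : 0 <= c^-1 by rewrite invr_ge0 normc_ge0.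
apply/cvgr0Pnorm_le => e e0.
have sq : (fun k => (if pselect (Am l) then N (fm k l%:C) else N (fp k l%:C)) * (M / c)) @ \oo --> (0 : R).
  rewrite -[X in _ --> X](mul0r (M / c)); apply: cvgM; last exact: cvg_cst.
  by case: pselect => h; [exact: fm0|apply: fp0; case: hl].
move/cvgr0Pnorm_le : sq => /(_ e e0); apply: filterS => k /=.
apply: le_trans; apply: le_trans (ler_norm _); apply: le_trans (bound k) _.
rewrite [leRHS]mulrA; apply: ler_wpM2r => //.
have [b1 b2] := factors_majorant k l%:C; case: pselect => h.
- by apply: ler_wpM2l; rewrite ?normc_ge0.
- by rewrite mulrC; apply: ler_wpM2l; rewrite ?normc_ge0.
Qed.

Lemma W_factor z : W z = Wm z * Wp z * (1 - (z / l0%:C) ^+ 2).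
Proof.
rewrite AE wprodU//; last 2 first.
- by rewrite -AE.
- by move=> l [h|h] /=; rewrite !inE => /orP[]/eqP e; rewrite e in h; contradiction.
rewrite wprodU//; last by apply: abs_summableS hA; rewrite AE => l h; left.
rewrite (wprod_seq z hA hid); last first.
  split; first by rewrite /= !inE l0_neq.
  by move=> l; rewrite !inE => /orP[]/eqP ->.
by rewrite /wfin !big_cons big_nil /= rmorphN invrN; ring.
Qed.

Lemma Wml0 : Wm l0%:C != 0.
Proof.
apply: wprod_neq0 => // l Al; apply/eqP => /complexI e; by rewrite -e in Al.
Qed.

Lemma Wpl0 : Wp l0%:C != 0.
Proof.
apply: wprod_neq0 => // l Al; apply/eqP => /complexI e; by rewrite -e in Al.
Qed.

Section along_ultrafilter.
Variables (U : set_system nat).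
Hypotheses (UU : UltraFilter U) (FU : \oo `<=` U).

Lemma ultra_limit (f : nat -> C -> C) :
  (forall k, normalized (f k)) -> (forall k z, N (f k z) <= entire_majorant (N z)) ->
  exists2 g, normalized g & forall z, cvgc U (f^~ z) (g z).
Proof.
move=> nf bf; have lim z : exists l, cvgc U (f^~ z) l.
  by apply: (@ultra_cvgc _ _ _ _ (entire_majorant (N z))) => //; apply: filterE => k; exact: bf.
have [g hg] := choice lim; exists g => //; split.
- apply: (@centire_limit _ _ U f entire_majorant) => //.
  by move=> k; have [] := nf k.
- move=> e e0; have [M hM] := wprod_type_zero hA e0; exists M => z.
  apply: (cvgc_le (hg z)); apply: filterE => k /=.
  by apply: le_trans (bf k z) _; apply: hM; exact: normc_ge0.
- apply: (cvgc_unique (hg 0)); apply: cvgc_eq_near (cvgc_cst _).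
  by apply: filterE => k /=; have [_ _ ->] := nf k.
Qed.

Lemma res_ultra l : A l -> exists2 p : R, 0 <= p & (fun k => res k l) @ U --> p.
Proof.
move=> Al; have [p hp] : exists p : R, (fun k => res k l) @ U --> p.
  apply: (@ultra_cvg _ _ _ _ 1) => //; apply: filterE => k /=.
  rewrite ger0_norm; last exact: res_ge0.
  have hl : listin A [:: l] by split=> // m; rewrite inE => /eqP ->.
  by have := res_sum_le1 k hl; rewrite big_seq1.
exists p => //; apply: (cvgr_to_ge hp); apply: filterE => k /=.
exact: res_ge0.
Qed.

(** The expansion is cut at a finite list with an error [e] uniform in [k], so the limit is taken in
    a finite sum; only the weights at [l0] and [- l0] survive. *)
Lemma limit_product (f h : C -> C) (p q : R) z : complex.Im z != 0 ->
  (forall z, cvgc U (fm^~ z) (f z)) -> (forall z, cvgc U (fp^~ z) (h z)) ->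
  (fun k => res k l0) @ U --> p -> (fun k => res k (- l0)) @ U --> q ->
  f z * h z / W z = 1 + p%:C * (z / (l0%:C - z)) + q%:C * (z / ((- l0)%:C - z)).
Proof.
move=> zI hf hh hp hq; have Wz : W z != 0 by exact: W_Im_neq0.
apply/eqP; rewrite -subr_eq0 -normc_eq0 eq_le normc_ge0 andbT.
apply/ler_addgt0Pl => e e0; rewrite addr0.
have z0 := normc_ge0 z.
have [r [s [rr ds]]] := disc_list_exists hA (l0 + 2 * N z + 8 * N z / e).
have q0 : 0 <= 8 * N z / e by rewrite !mulr_ge0 ?invr_ge0// ltW.
have l00 : 0 < l0 by [].
have [r0 hr us hs] := ds.
have zr : N z <= r / 2 by lra.
have bound k : N (Q k z / W z - 1 - \sum_(l <- s) (res k l)%:C * (z / (l%:C - z))) <= e.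
  have := herglotz_expansion hA (quot_entire k) (quot0 k) (quot_real k) (QW k) ds Wz zr.
  move=> hh'; apply: le_trans hh' _; rewrite mulrA ler_pdivrMr// [leRHS]mulrC -ler_pdivrMr//; lra.
have in1 : l0 \in s.
  by rewrite hs; apply/asboolP; split=> //; rewrite gtr0_norm//; lra.
have in2 : - l0 \in s.
  by rewrite hs; apply/asboolP; split=> //; rewrite normrN gtr0_norm//; lra.
pose lim l := if l == l0 then p else if l == - l0 then q else 0.
have cl l : l \in s -> cvgc U (fun k => (res k l)%:C * (z / (l%:C - z)))
    ((lim l)%:C * (z / (l%:C - z))).
  move=> ls; apply: cvgcM; last exact: cvgc_cst.
  apply: cvgc_real; rewrite /lim; case: eqVneq => [->//|n1]; case: eqVneq => [->//|n2].
  apply: cvg_trans (res_cvg0 _); last first.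
    have : A l by have := hs l; rewrite ls => /esym/asboolP[].
    by rewrite AE => -[h'|/=]; [exact: h'|rewrite !inE (negPf n1) (negPf n2)].
  by move=> P; exact: FU.
have csum t : {subset t <= s} -> cvgc U (fun k => \sum_(l <- t) (res k l)%:C * (z / (l%:C - z)))
    (\sum_(l <- t) (lim l)%:C * (z / (l%:C - z))).
  elim: t => [|l t IH] ht.
    by rewrite big_nil; under eq_fun do rewrite big_nil; exact: cvgc_cst.
  rewrite big_cons; under eq_fun do rewrite big_cons; apply: cvgcD.
    by apply: cl; apply: ht; exact: mem_head.
  by apply: IH => m mt; apply: ht; rewrite inE mt orbT.
have sumE : \sum_(l <- s) (lim l)%:C * (z / (l%:C - z)) =
    p%:C * (z / (l0%:C - z)) + q%:C * (z / ((- l0)%:C - z)).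
  have in2' : - l0 \in rem l0 s by rewrite mem_rem_uniq// !inE eq_sym l0_neq.
  rewrite (big_rem l0)//= (big_rem (- l0))//= big_seq big1 ?addr0.
    by rewrite /lim eqxx eq_sym (negPf l0_neq) eqxx.
  move=> l; rewrite mem_rem_uniq ?rem_uniq// !inE => /andP[n2].
  rewrite mem_rem_uniq// !inE => /andP[n1 _].
  by rewrite /lim (negPf n1) (negPf n2) mul0r.
have cQ : cvgc U (fun k => Q k z / W z - 1 - \sum_(l <- s) (res k l)%:C * (z / (l%:C - z)))
    (f z * h z / W z - 1 - \sum_(l <- s) (lim l)%:C * (z / (l%:C - z))).
  apply: cvgcB; last exact: csum.
  apply: cvgcB; last exact: cvgc_cst.
  by apply: cvgcM; [exact: cvgcM|exact: cvgc_cst].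
rewrite -addrA -sumE opprD addrA; apply: (cvgc_le cQ); apply: filterE => k; exact: bound.
Qed.


(** The formula for [S] becomes available because the limit of [u k + v k] is positive, hence
    [u k + v k > 0] on a set of the ultrafilter. *)
Lemma sech_ultra :
  (fun k => res k l0 - S k / 2) @ U --> (0 : R) /\
  (fun k => res k (- l0) - S k / 2) @ U --> (0 : R).
Proof.
have l00 : 0 < l0 by [].
have [f nf hf] := ultra_limit nm (fun k z => (factors_majorant k z).1).
have [h nh hh] := ultra_limit np (fun k z => (factors_majorant k z).2).
have [p p0 hp] := res_ultra A_l0; have [q q0 hq] := res_ultra A_l0'.
have pq : p + q <= 1.
  apply: (cvgr_to_le (cvgD hp hq)); apply: filterE => k /=.
  have hl : listin A [:: l0; - l0].
    split; first by rewrite /= !inE l0_neq.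
    by move=> l; rewrite !inE => /orP[]/eqP ->.
  by have := res_sum_le1 k hl; rewrite !big_cons big_nil addr0.
have vf : vanishing Am f.
  move=> l Al; apply: (@cvgc_le0 _ _ _ _ _ (fun k => N (fm k l%:C)) _ _ (hf l%:C)).
    by apply: cvg_trans (fm0 Al) => P; exact: FU.
  by apply: filterE => k /=.
have vh : vanishing Ap h.
  move=> l Al; apply: (@cvgc_le0 _ _ _ _ _ (fun k => N (fp k l%:C)) _ _ (hh l%:C)).
    by apply: cvg_trans (fp0 Al) => P; exact: FU.
  by apply: filterE => k /=.
have lc : l0%:C != 0 :> C by rewrite -normc_gt0 normc_real gtr0_norm.
have fh z : f z * h z = Wm z * Wp z *
    (1 + ((p - q) / l0)%:C * z - ((1 - p - q) / l0 ^+ 2)%:C * z ^+ 2).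
  move: z; apply: eq_nonreal.
  - by apply: centireM; [have [] := nf|have [] := nh].
  - apply: centireM; first by apply: centireM; exact: wprod_entire.
    move=> z; apply: cdiffB.
      apply: cdiffD; first exact: cdiff_cst.
      by apply: cdiffM; [exact: cdiff_cst|exact: cdiff_id].
    by apply: cdiffM; [exact: cdiff_cst|apply: cdiffX; exact: cdiff_id].
  move=> z zI; have Wz : W z != 0 by exact: W_Im_neq0.
  have := limit_product zI hf hh hp hq; move/(congr1 (fun x => x * W z)).
  rewrite divfK// => ->; rewrite W_factor.
  have d1 : l0%:C - z != 0 by apply: normc_pos_Im0; rewrite ImD ImN /= sub0r oppr_eq0.
  have d2 : (- l0)%:C - z != 0 by apply: normc_pos_Im0; rewrite ImD ImN /= sub0r oppr_eq0.
  have -> : ((p - q) / l0)%:C = (p%:C - q%:C) / l0%:C :> C.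
    by rewrite rmorphM rmorphB fmorphV.
  have -> : ((1 - p - q) / l0 ^+ 2)%:C = (1 - p%:C - q%:C) / l0%:C ^+ 2 :> C.
    by rewrite rmorphM !rmorphB rmorph1 fmorphV rmorphXn.
  move: d2; rewrite rmorphN /= => d2.
  by field; rewrite lc d1 d2.
have symf : f l0%:C * f (- l0)%:C = h l0%:C * h (- l0)%:C.
  apply: (cvgc_unique (cvgcM (hf _) (hf _))); apply: cvgc_eq_near (cvgcM (hh _) (hh _)).
  by apply: filterE => k /=; rewrite sym.
have PmE : Wp (- l0)%:C = Wm l0%:C by rewrite (wprod_opp _ hAm hAp Ap_opp) -rmorphN opprK.
have MpE : Wm (- l0)%:C = Wp l0%:C by rewrite (wprod_opp _ hAm hAp Ap_opp) rmorphN.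
have [epq uv SV] := coupling_limit hAm hAp dis l00 p0 q0 pq nf nh vf vh Wml0 Wpl0 PmE MpE symf fh.
set ul := N _ / _ in uv SV; set vl := N _ / _ in uv SV.
have cu : u @ U --> ul.
  by apply: cvgM; [apply: cvgc_norm; exact: hf|exact: cvg_cst].
have cv : v @ U --> vl.
  by apply: cvgM; [apply: cvgc_norm; exact: hh|exact: cvg_cst].
have cuv : (fun k => u k + v k) @ U --> ul + vl by exact: cvgD.
have cS0 : (fun k => 4 * u k * v k / (u k + v k) ^+ 2) @ U --> 2 * p.
  rewrite -SV; apply: cvgM; first by apply: cvgM => //; apply: cvgM => //; exact: cvg_cst.
  apply: cvgV; first by rewrite expf_neq0// gt_eqF.
  by rewrite expr2; under eq_fun do rewrite expr2; exact: cvgM.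
have cS : S @ U --> 2 * p.
  apply: cvg_trans cS0; apply: near_eq_cvg.
  have /cvgrPdist_lt /(_ _ uv) := cuv; apply: filterS => k /=.
  move=> hk; rewrite -SE//; have := ler_norm (ul + vl - (u k + v k)); lra.
have cS2 : (fun k => S k / 2) @ U --> p.
  have -> : p = 2 * p / 2 by field.
  by apply: cvgM => //; exact: cvg_cst.
split; first by rewrite -(subrr p); exact: cvgB.
by rewrite -(subrr p); apply: cvgB => //; rewrite {1}epq.
Qed.

End along_ultrafilter.

Lemma residue_sech : (fun k => res k l0 - S k / 2) @ \oo --> (0 : R) /\
  (fun k => res k (- l0) - S k / 2) @ \oo --> (0 : R).
Proof.
split; apply: cvg_ultra0 => U UU FU; by have [] := sech_ultra UU FU.
Qed.

Definition far_points (d : R) z := forall l, A l -> d <= N (l%:C - z).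

(** Half the error is spent on the tail of the expansion, uniformly in [k], the other half on
    finitely many weights. The main term is [z ^+ 2 / (l0 ^+ 2 - z ^+ 2)], half the sum of
    [z / (l0 - z)] and [z / (- l0 - z)], which is why the weights are compared with [S k / 2]. *)
Lemma coupling_asymptotics (d e r0 : R) : 0 < d -> 0 < e -> \forall k \near \oo,
  forall z, far_points d z -> N z <= r0 ->
  N (Q k z / W z - (1 + z ^+ 2 / (l0%:C ^+ 2 - z ^+ 2) * (S k)%:C)) <= e.
Proof.
move=> d0 e0; have l00 : 0 < l0 by [].
pose r1 := `|r0| + 1; have r10 : 0 < r1 by rewrite /r1; have := normr_ge0 r0; lra.
have q0 : 0 <= 16 * r1 / e by rewrite !mulr_ge0 ?invr_ge0// ltW.
have [r [s [rr ds]]] := disc_list_exists hA (l0 + 2 * r1 + 16 * r1 / e).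
have [rpos hr us hs] := ds.
have in1 : l0 \in s.
  by rewrite hs; apply/asboolP; split=> //; rewrite gtr0_norm//; lra.
have in2 : - l0 \in rem l0 s.
  rewrite mem_rem_uniq// !inE eq_sym l0_neq /= hs; apply/asboolP; split=> //.
  by rewrite normrN gtr0_norm//; lra.
pose t := rem (- l0) (rem l0 s).
have tA l : l \in t -> Am l \/ Ap l.
  rewrite mem_rem_uniq ?rem_uniq// !inE => /andP[n2]; rewrite mem_rem_uniq// !inE => /andP[n1].
  rewrite hs => /asboolP[Al _]; move: Al; rewrite AE => -[h|/=]; first exact: h.
  by rewrite !inE (negPf n1) (negPf n2).
pose a k := \sum_(l <- t) `|res k l| + (`|res k l0 - S k / 2| + `|res k (- l0) - S k / 2|).
have ca : a @ \oo --> (0 : R).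
  have norm0 (x : nat -> R) : x @ \oo --> (0 : R) -> (fun k => `|x k|) @ \oo --> (0 : R).
    by move=> h; rewrite -[X in _ --> X](normr0 R); exact: cvg_norm.
  have [c1 c2] := residue_sech.
  rewrite (_ : 0 = 0 + (0 + 0) :> R); last by rewrite !addr0.
  apply: cvgD; last by apply: cvgD; exact: norm0.
  elim: (t) tA => [|l t' IH] ht.
    by under eq_fun do rewrite big_nil; exact: cvg_cst.
  have g1 := norm0 _ (res_cvg0 (ht _ (mem_head _ _))).
  have /IH g2 : forall j, j \in t' -> Am j \/ Ap j.
    by move=> j jt; apply: ht; rewrite inE jt orbT.
  have := cvgD g1 g2; rewrite addr0 => g3.
  by under eq_fun do rewrite big_cons; exact: g3.
have b0 : 0 < e * d / (2 * r1) by rewrite divr_gt0// mulr_gt0.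
move/cvgr0Pnorm_le : ca => /(_ _ b0); apply: filterS => k ak z far zr.
have z0 := normc_ge0 z.
have zr1 : N z <= r1 by rewrite /r1; have := ler_norm r0; lra.
have Wz : W z != 0.
  apply: wprod_neq0 => // l Al; apply/eqP => zl; have := far l Al.
  by rewrite zl subrr Normc.normc0; lra.
have zr2 : N z <= r / 2 by lra.
have := herglotz_expansion hA (quot_entire k) (quot0 k) (quot_real k) (QW k) ds Wz zr2.
set S0 := \sum_(l <- s) _ => hexp.
have h1 : 8 * (N z / r) <= e / 2.
  rewrite mulrA ler_pdivrMr//.
  have : 16 * r1 <= e * r by rewrite [leRHS]mulrC -ler_pdivrMr//; lra.
  lra.
pose T l := z / (l%:C - z).
have hT l : A l -> N (T l) <= r1 / d.
  move=> Al; rewrite normcf_div; have := far l Al => fl.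
  apply: ler_pM => //; rewrite ?normc_ge0// ?invr_ge0 ?normc_ge0//.
  by rewrite lef_pV2 ?posrE//; lra.
have n1 : l0%:C - z != 0 by rewrite -normc_gt0; have := far _ A_l0; lra.
have n2 : - l0%:C - z != 0.
  by rewrite -rmorphN -normc_gt0; have := far _ A_l0'; lra.
have n12 : l0%:C ^+ 2 - z ^+ 2 != 0.
  have -> : l0%:C ^+ 2 - z ^+ 2 = (l0%:C - z) * - (- l0%:C - z) by ring.
  by rewrite mulf_neq0// oppr_eq0.
have E : S0 - z ^+ 2 / (l0%:C ^+ 2 - z ^+ 2) * (S k)%:C =
    \sum_(l <- t) (res k l)%:C * T l +
    ((res k l0 - S k / 2)%:C * T l0 + (res k (- l0) - S k / 2)%:C * T (- l0)).
  rewrite /S0 (big_rem l0)//= (big_rem (- l0))//= -/t.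
  have hS (x : R) : (x - S k / 2)%:C = x%:C - (S k)%:C / 2 :> C.
    by rewrite rmorphB rmorphM fmorphV rmorphD rmorph1.
  rewrite !hS /T rmorphN /=.
  set X := \sum_(l <- t) _; move: ((S k)%:C) ((res k l0)%:C) ((res k (- l0))%:C) => c c1 c2.
  by field; rewrite n1 n2 n12.
have -> : Q k z / W z - (1 + z ^+ 2 / (l0%:C ^+ 2 - z ^+ 2) * (S k)%:C) =
    (Q k z / W z - 1 - S0) + (S0 - z ^+ 2 / (l0%:C ^+ 2 - z ^+ 2) * (S k)%:C) by ring.
apply: le_trans (le_normcD _ _) _; rewrite (splitr e); apply: lerD; first exact: le_trans hexp h1.
rewrite E; apply: (@le_trans _ _ (a k * (r1 / d))); last first.
  apply: (@le_trans _ _ (e * d / (2 * r1) * (r1 / d))).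
    by apply: ler_wpM2r; [rewrite divr_ge0// ltW|exact: le_trans (ler_norm _) ak].
  rewrite le_eqVlt; apply/orP; left; apply/eqP; field.
  by rewrite !gt_eqF.
have one (x : R) l : A l -> N (x%:C * T l) <= `|x| * (r1 / d).
  by move=> Al; rewrite Normc.normcM normc_real; apply: ler_wpM2l => //; exact: hT.
rewrite /a mulrDl; apply: le_trans (le_normcD _ _) _; apply: lerD.
  apply: le_trans (normc_sum _ _ _) _; rewrite mulr_suml !big_seq; apply: ler_sum => l lt.
  by apply: one; rewrite AE; left; exact: tA.
rewrite mulrDl; apply: le_trans (le_normcD _ _) _.
by apply: lerD; apply: one.
Qed.

End coupling_sequence.

(** * Translation between the topologies of the statement and moduli *)

Section interface.
Variable R : realType.
Local Notation C := (Cplx R).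
Local Notation N := (@Normc.normc R).

Lemma Cplx_gt0 (e : C) : 0 < e -> e = (complex.Re e)%:C :> R[i] /\ 0 < complex.Re e.
Proof.
move=> e0; have [e1 e2] : complex.Im e = 0 /\ 0 < complex.Re e.
  by move: e0; rewrite ltcE /= => /andP[/eqP ? ?].
by split=> //; exact: real_of_Im0.
Qed.

Lemma Cplx_norm_lt (x : C) (e : R) : (`|x| < (e%:C : C)) = (N x < e).
Proof. by rewrite [X in X < _](_ : _ = (N x)%:C) ?ltcR. Qed.

Lemma entire_centire (f : C -> C) : entire f -> centire (f : R[i] -> R[i]).
Proof.
move=> hf z; have /cvg_ex[d hd] := hf z.
exists d => e e0; have ec : 0 < (e%:C : C) by rewrite ltcR.
move/cvgrPdist_lt : hd => /(_ _ ec); rewrite /dnbhs /within /=.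
move/nbhs_normP => [r /= r0 hr]; have [rE rr] := Cplx_gt0 r0.
exists (complex.Re r) => // h hh.
have [->|h0] := eqVneq h 0.
  by rewrite addr0 subrr mulr0 subrr Normc.normc0 mulr0.
have bh : `|(0 : C) - h| < r by rewrite sub0r normrN rE Cplx_norm_lt.
have := hr h bh h0; rewrite Cplx_norm_lt => k.
have hn : 0 < N h by rewrite normc_gt0.
rewrite -ler_pdivrMr// -normcf_div ltW//; apply: le_lt_trans k.
rewrite normcB le_eqVlt; apply/orP; left; apply/eqP; congr (N _).
have sE (a b : C) : a *: b = a * b by [].
by rewrite mulrBl mulfK// !sE mulr1 [z + h]addrC [LHS]addrC [RHS]addrC mulrC.
Qed.

Lemma opc_cvg0 (u : nat -> Rhat R) : u @ \oo --> (Some 0 : Rhat R) ->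
  forall e : R, 0 < e -> \forall k \near \oo, exists2 r, u k = Some r & `|r| < e.
Proof.
move=> h e e0.
have n0 : nbhs (0 : R) [set r | `|r| < e].
  apply/nbhs_normP; exists e => //= r; rewrite /= sub0r normrN.
  by [].
have H : \forall k \near \oo, (Some @` [set r | `|r| < e]) (u k).
  exact: h (@one_point_compactification_some_nbhs _ (0 : R) _ n0).
by apply: filterS H => k /= [r hr <-]; exists r.
Qed.

Lemma opc_cvgoo (u : nat -> Rhat R) : u @ \oo --> (None : Rhat R) ->
  forall M : R, \forall k \near \oo, forall r, u k = Some r -> M < `|r|.
Proof.
move=> h M.
have n0 : nbhs (None : Rhat R) ((Some @` (~` `[- M, M]%classic)) `|` [set None]).
  exists `[- M, M]%classic => //; split; first exact: segment_compact.
  exact: interval_closed.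
have H : \forall k \near \oo, ((Some @` (~` `[- M, M]%classic)) `|` [set None]) (u k).
  exact: h n0.
apply: filterS H => k /= [[r hr <-] s [<-]|-> //].
by rewrite ltNge ler_norml; apply/negP => hM; apply: hr; rewrite /= in_itv.
Qed.

Lemma uniform_cvgP (D : set C) (F : nat -> C -> C) :
  (forall e : R, 0 < e -> \forall k \near \oo, forall z, D z -> N (F k z) <= e) ->
  {uniform D, F @ \oo --> (fun=> 0)}.
Proof.
move=> h P /uniform_nbhs [E [entE sub]].
move: entE; rewrite -entourage_ballE => -[r /= r0 rE].
have [re rr] := Cplx_gt0 r0; have r2 : 0 < complex.Re r / 2 by lra.
have := h _ r2; apply: filterS => k hk /=; apply: sub => z Dz.
apply: rE => /=; rewrite -ball_normE /= sub0r normrN re Cplx_norm_lt.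
by have := hk z Dz; lra.
Qed.

End interface.

(** * The hyperbolic secant, the products in [hat_eta] and isolation of the poles *)

Section assembly.
Variable R : realType.
Local Notation C := R[i].
Local Notation N := (@Normc.normc R).

Lemma W_wprod (A : set R) (z : C) : abs_summable A -> W A (z : Cplx R) = wprod A id z.
Proof.
by move=> hA; apply: infprodE_complex; apply: wprod_cvg.
Qed.

(* With [t = |r|], [cosh (ln t / 2) ^ 2 = (t + 1) ^ 2 / (4 t)]. *)
Lemma sech2E (r : R) : sech2_half_log (Some r) = 4 * `|r| / (`|r| + 1) ^+ 2.
Proof.
rewrite /sech2_half_log; case: eqVneq => [->|r0].
  by rewrite normr0 mulr0 mul0r.
have t0 : 0 < `|r| by rewrite normr_gt0.
rewrite /cosh; set x := 2^-1 * ln `|r|.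
have e2 : expR x ^+ 2 = `|r|.
  by rewrite -expRM_natl /x mulrA divff ?mul1r ?lnK// pnatr_eq0.
have ex : expR x != 0 by rewrite gt_eqF// expR_gt0.
rewrite expRN -e2; move: (expR x) ex (expR_gt0 x) => y y0 yp.
have y1 : y ^+ 2 + 1 != 0 by rewrite gt_eqF// ltr_wpDl// sqr_ge0.
by field; rewrite y0 y1.
Qed.

Lemma sech2_quotient (u v : R) (r : R) : 0 <= u -> 0 < v -> `|r| = u / v ->
  sech2_half_log (Some r) = 4 * u * v / (u + v) ^+ 2.
Proof.
move=> u0 v0 rE; rewrite sech2E rE.
have uv : u + v != 0 by rewrite gt_eqF// ltr_wpDl.
by field; rewrite uv gt_eqF.
Qed.

(** Each factor is [(1 + a / l) / (1 - a / l)], and numerators and denominators converge separately,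
    the latter to a nonzero limit. *)
Lemma infprod_moebius (A : set R) (a : R) : abs_summable A ->
  (forall l, A l -> l != a /\ l != - a) ->
  (infprod A (fun l => (l + a) / (l - a)))%:C =
    wprod A id (- a)%:C / wprod A id a%:C :> C.
Proof.
move=> hA ha; have hid (l : R) : `|id l| = `|l| by [].
apply/esym/infprodE_real.
have n0 : wprod A id a%:C != 0.
  by apply: (wprod_neq0 hA hid) => l /ha[/eqP la _]; apply/eqP => /complexI al; case: la.
have FL := lists_filter A.
apply: cvgc_eq_near (cvgcM (wprod_cvg hA hid (- a)%:C) (cvgcV n0 (wprod_cvg hA hid a%:C))).
apply: lists_near => s hs /=; rewrite /wfin -prodfV -big_split /=.
rewrite !big_seq; apply: eq_bigr => l ls.
have Al := hs.2 l ls; have [la _] := ha l Al; have l0 := hA.1 l Al.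
have lc : l%:C != 0 :> C by rewrite -normc_eq0 normc_real normr_eq0.
have d0 : l%:C - a%:C != 0 :> C by rewrite subr_eq0; apply/eqP => /complexI al; rewrite al eqxx in la.
rewrite rmorphM fmorphV rmorphD rmorphB rmorphN /=.
have d1 : 1 - a%:C / l%:C != 0 :> C.
  rewrite (_ : 1 - _ = (l%:C - a%:C) / l%:C); last by field.
  by rewrite mulf_neq0// invr_neq0.
by field; rewrite lc d0 /=.
Qed.

Lemma infprod_moebius_inv (A : set R) (a : R) : abs_summable A ->
  (forall l, A l -> l != a /\ l != - a) ->
  (infprod A (fun l => (l - a) / (l + a)))%:C =
    wprod A id a%:C / wprod A id (- a)%:C :> C.
Proof.
move=> hA ha; have := @infprod_moebius A (- a) hA; rewrite opprK => <-.
  congr (infprod A _)%:C; apply/funext => l; by rewrite opprK.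
by move=> l /ha[].
Qed.

(** Only finitely many points satisfy [|l| <= N z + 1]; all others are at distance at least 1 from
    [z]. *)
Lemma isolated_from_set (A : set R) (z : C) : abs_summable A ->
  (forall l, A l -> z != l%:C) -> exists2 d : R, 0 < d & forall l, A l -> d <= N (l%:C - z).
Proof.
move=> hA hz; have [s us hs] := @abs_summable_list _ A (N z + 1) hA.
have [d d0 hd] : exists2 d : R, 0 < d & forall l, l \in s -> d <= N (l%:C - z).
  have: forall l, l \in s -> 0 < N (l%:C - z).
    move=> l; rewrite hs => /asboolP[Al _]; rewrite normc_gt0 subr_eq0 eq_sym; exact: hz.
  elim: (s) => [|l t IH] ht; first by exists 1.
  have [d d0 hd] : exists2 d : R, 0 < d & forall l, l \in t -> d <= N (l%:C - z).
    by apply: IH => m mt; apply: ht; rewrite inE mt orbT.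
  exists (Num.min d (N (l%:C - z))); first by rewrite lt_min d0 ht// mem_head.
  move=> m; rewrite inE => /predU1P[->|/hd h]; first by rewrite ge_min lexx orbT.
  by rewrite ge_min h.
exists (Num.min d 1); first by rewrite lt_min d0 /=.
move=> l Al; have [lz|lz] := leP `|l| (N z + 1).
  by rewrite ge_min hd// hs; apply/asboolP.
rewrite ge_min; apply/orP; right.
by have := ler_normc_sub l%:C z; rewrite normc_real; lra.
Qed.

End assembly.

Theorem theorem2p5 (R : realType) (sigma : set R)
  (sigma_discrete : isolated sigma = sigma)
  (sigma_neq0 : forall l, sigma l -> l != 0)
  (sigma_summable : (\esum_(l in sigma) (1 / `|l|)%:E < +oo)%E)
  (eta : nat -> R -> Rhat R) (Phim Phip : nat -> Cplx R -> Cplx R)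
  (eta_symmetric : forall k, coupling_symmetric sigma (eta k))
  (Phi_solution : forall k, coupling_solution sigma (eta k) (Phim k) (Phip k))
  (l0 : R) (sigma0 sigmaoo : set R)
  (part_cover : sigma0 `|` [set l0] `|` sigmaoo = sigma `&` [set l | 0 < l])
  (part_l0 : ~ sigma0 l0 /\ ~ sigmaoo l0)
  (part_disjoint : sigma0 `&` sigmaoo = set0)
  (eta_to_0 : forall l, sigma0 l -> (fun k => eta k l) @ \oo --> (Some 0 : Rhat R))
  (eta_to_oo : forall l, sigmaoo l -> (fun k => eta k l) @ \oo --> (None : Rhat R)) :
  locally_uniform_cvg (~` [set (l%:C : Cplx R) | l in sigma])
    (fun k z => Phim k z * Phip k z / W sigma z
       - (1 + z ^+ 2 / ((l0%:C : Cplx R) ^+ 2 - z ^+ 2)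
              * (sech2_half_log (hat_eta (eta k) l0 sigma0 sigmaoo))%:C))
    (fun=> 0).
Proof.
have hA := abs_summable_esum sigma_neq0 sigma_summable.
have hid (l : R) : `|id l| = `|l| by [].
pose fm k : R[i] -> R[i] := Phim k; pose fp k : R[i] -> R[i] := Phip k.
have pos l : (sigma0 `|` [set l0] `|` sigmaoo) l -> sigma l /\ 0 < l.
  by rewrite part_cover.
have l00 : 0 < l0 by have [] := pos l0 (or_introl (or_intror erefl)).
have s0P l : sigma0 l -> sigma l /\ 0 < l by move=> h; apply: pos; left; left.
have sooP l : sigmaoo l -> sigma l /\ 0 < l by move=> h; apply: pos; right.
have sopp l : sigma l -> sigma (- l).
  by move=> Al; rewrite -(eta_symmetric 0%N).1; exists l.
(* By symmetry the data also tend to 0 on the reflection of [sigmaoo] and to infinity on that of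
   [sigma0]; so [Am] gathers the points where the data tend to 0 and [Ap], its reflection, those
   where they tend to infinity. *)
pose Am : set R := sigma0 `|` [set l | sigmaoo (- l)].
pose Ap : set R := [set l | Am (- l)].
have Ap_opp l : Ap l <-> Am (- l) by [].
have AE : sigma = (Am `|` Ap) `|` [set` [:: l0; - l0]].
  apply/seteqP; split=> l.
    move=> Al; have [l_gt|l_lt|l_eq] := ltgtP 0 l; last first.
    - by have := sigma_neq0 l Al; rewrite -l_eq eqxx.
    - have : (sigma0 `|` [set l0] `|` sigmaoo) (- l).
        by rewrite part_cover; split=> /=; [exact: sopp|lra].
      case=> [[h|/= h]|h].
      + by left; right; left.
      + by right; rewrite /= !inE -h opprK eqxx orbT.
      + by left; left; right.
    - have : (sigma0 `|` [set l0] `|` sigmaoo) l by rewrite part_cover.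
      case=> [[h|/= h]|h].
      + by left; left; left.
      + by right; rewrite /= !inE h eqxx.
      + by left; right; right; rewrite /= opprK.
  case=> [[[/s0P[]//|/= /sooP[/sopp]]|[/s0P[/sopp]|/= /sooP[]]]|/=].
  - by rewrite opprK.
  - by rewrite opprK.
  - by rewrite opprK.
  - have : sigma l0 by have [] := pos l0 (or_introl (or_intror erefl)).
    by rewrite !inE => h /orP[]/eqP -> //; exact: sopp.
have dis l : Am l -> Ap l -> False.
  have d0 m : sigma0 m -> sigmaoo m -> False.
    by move=> h1 h2; have : (sigma0 `&` sigmaoo) m by []; rewrite part_disjoint.
  case=> [h1|/= h1] [h2|/= h2].
  - by have := (s0P _ h1).2; have := (s0P _ h2).2; lra.
  - by rewrite opprK in h2; exact: d0 h1 h2.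
  - exact: d0 h2 h1.
  - by have := (sooP _ h1).2; have := (sooP _ h2).2; lra.
have Aml0 : ~ Am l0.
  by case=> [|/= /sooP[_]]; [exact: part_l0.1|lra].
have Aml0' : ~ Am (- l0).
  by case=> [/s0P[_]|/=]; [lra|rewrite opprK; exact: part_l0.2].
have hAm : abs_summable Am by apply: abs_summableS hA; rewrite AE => l h; left; left.
have hAp : abs_summable Ap by apply: abs_summableS hA; rewrite AE => l h; left; right.
have nm k : normalized (fm k).
  have [[h1 h2 _] _ _ _ [h3 _]] := Phi_solution k; split=> //.
  exact: entire_centire.
have np k : normalized (fp k).
  have [_ [h1 h2 _] _ _ [_ h3]] := Phi_solution k; split=> //.
  exact: entire_centire.
have rm k (x : R) : complex.Im (fm k x%:C) = 0.
  by have [[_ _ h] _ _ _ _] := Phi_solution k; exact: h.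
have rp k (x : R) : complex.Im (fp k x%:C) = 0.
  by have [_ [_ _ h] _ _ _] := Phi_solution k; exact: h.
have QW k (z : R[i]) : 0 < complex.Im z ->
    0 <= complex.Im (z * (fm k z * fp k z / wprod sigma id z)).
  move=> zI; have [_ _ _ h _] := Phi_solution k.
  by have := h z zI; rewrite W_wprod// !mulrA.
have etaC k l : sigma l -> if eta k l is Some r then fm k l%:C = r%:C * fp k l%:C
    else fp k l%:C = 0 by have [_ _ h _ _] := Phi_solution k; exact: h.
have maj := factors_majorant hA nm np rm rp QW.
(* A small coupling constant makes one function small relative to the other, which is bounded
   uniformly in [k] at the point [l]. *)
have small l (f g : nat -> R[i] -> R[i]) :
    (forall k, Normc.normc (g k l%:C) <= entire_majorant sigma (Normc.normc (l%:C : R[i]))) ->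
    (forall e : R, 0 < e -> \forall k \near \oo, Normc.normc (f k l%:C) <= e * Normc.normc (g k l%:C)) ->
    (fun k => Normc.normc (f k l%:C)) @ \oo --> (0 : R).
  move=> gM hf; pose M := entire_majorant sigma (Normc.normc (l%:C : R[i])) + 1.
  have M0 : 0 < M by rewrite /M ltr_wpDl// normc_ge0.
  apply/cvgr0Pnorm_le => e e0; have eM : 0 < e / M by rewrite divr_gt0.
  apply: filterS (hf _ eM) => k hk /=; rewrite ger0_norm ?normc_ge0//.
  apply: le_trans hk _; rewrite mulrAC ler_pdivrMr// ler_pM2l//.
  by apply: le_trans (gM k) _; rewrite /M lerDl.
have to0 l e : sigma0 l -> 0 < e -> \forall k \near \oo, exists2 r, eta k l = Some r & `|r| < e.
  by move=> h e0; exact: opc_cvg0 (eta_to_0 l h) e e0.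
have tooo l e : sigmaoo l -> 0 < e -> \forall k \near \oo,
    forall r, eta k l = Some r -> r != 0 /\ `|r^-1| < e.
  move=> h e0; apply: filterS (opc_cvgoo (eta_to_oo l h) e^-1) => k hk r /hk hr.
  have ei : 0 < e^-1 by rewrite invr_gt0.
  have r0 : 0 < `|r| by exact: lt_trans hr.
  split; first by rewrite -normr_gt0.
  by rewrite normfV -[ltRHS]invrK ltf_pV2 ?posrE.
have etaN k l : sigma l -> eta k (- l) = Rhat_inv (eta k l) := (eta_symmetric k).2 l.
have scale (r e : R) (w : R[i]) : `|r| < e -> Normc.normc (r%:C * w) <= e * Normc.normc w.
  by move=> re; rewrite Normc.normcM normc_real; apply: ler_wpM2r; [exact: normc_ge0|exact: ltW].
have zero_le (e : R) (w : R[i]) : 0 < e -> Normc.normc (0 : R[i]) <= e * Normc.normc w.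
  by move=> e0; rewrite Normc.normc0 mulr_ge0 ?normc_ge0// ltW.
have flip (r : R) (v w : R[i]) : r != 0 -> v = (r^-1)%:C * w -> w = r%:C * v.
  by move=> r0 ->; rewrite mulrA -rmorphM mulfV// mul1r.
have fm0 l : Am l -> (fun k => Normc.normc (fm k l%:C)) @ \oo --> (0 : R).
  case=> [h|/= h]; apply: small => [k|e e0]; try exact: (maj k _).2.
    have [Al _] := s0P l h.
    apply: filterS (to0 l e h e0) => k [r er re].
    by have := etaC k l Al; rewrite er => ->; exact: scale.
  have [Al _] := sooP _ h; have Al' : sigma l by rewrite -[l]opprK; exact: sopp.
  apply: filterS (tooo _ e h e0) => k hk.
  have := etaC k l Al'; have := etaN k _ Al; rewrite opprK => ->.
  case: (eta k (- l)) hk => [r|] hk /=; last by rewrite mul0r => ->; exact: zero_le.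
  have [r0 re] := hk r erefl; rewrite (negPf r0) => ->; exact: scale.
have fp0 l : Ap l -> (fun k => Normc.normc (fp k l%:C)) @ \oo --> (0 : R).
  case=> [h|/=]; [|rewrite opprK => h]; apply: small => [k|e e0]; try exact: (maj k _).1.
    have [Al _] := s0P _ h; have Al' : sigma l by rewrite -[l]opprK; exact: sopp.
    apply: filterS (to0 _ e h e0) => k [r er re].
    have := etaC k l Al'; have := etaN k _ Al; rewrite opprK => ->; rewrite er /=.
    have [r0|r0] := eqVneq r 0; first by move=> ->; exact: zero_le.
    by move=> /(flip _ _ _ r0) ->; exact: scale.
  have [Al _] := sooP _ h.
  apply: filterS (tooo _ e h e0) => k hk.
  have := etaC k l Al; case: (eta k l) hk => [r|] hk; last by move=> ->; exact: zero_le.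
  have [r0 re] := hk r erefl; move=> h2; rewrite -(invrK r) in h2.
  have ri : r^-1 != 0 by rewrite invr_neq0.
  by rewrite (flip _ _ _ ri h2); exact: scale.
have Al0 : sigma l0 by have [] := pos l0 (or_introl (or_intror erefl)).
have sym k : fm k l0%:C * fm k (- l0)%:C = fp k l0%:C * fp k (- l0)%:C.
  have := etaC k _ Al0; have := etaC k _ (sopp _ Al0); rewrite (etaN k _ Al0).
  case: (eta k l0) => [r|] /=; last by rewrite mul0r => -> ->; rewrite mulr0 mul0r.
  have [->|r0] := eqVneq r 0; first by rewrite mul0r => -> ->; rewrite mulr0 mul0r.
  move=> -> ->; rewrite mulrACA -rmorphM mulfV// mul1r.
  by [].
pose S k := sech2_half_log (hat_eta (eta k) l0 sigma0 sigmaoo).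
have Wm0 : wprod Am id l0%:C != 0.
  by apply: (wprod_neq0 hAm hid) => l Al; apply/eqP => /complexI h; rewrite -h in Al.
have Wp0 : wprod Ap id l0%:C != 0.
  by apply: (wprod_neq0 hAp hid) => l Al; apply/eqP => /complexI h; rewrite -h in Al.
have h0 : abs_summable sigma0 by apply: abs_summableS hAm => l; left.
have hoo : abs_summable sigmaoo by apply: abs_summableS hA => l /sooP[].
have hoo' : abs_summable [set l | sigmaoo (- l)] by apply: abs_summableS hAm => l; right.
have WmE (z : R[i]) : wprod Am id z = wprod sigma0 id z * wprod sigmaoo id (- z).
  have d1 l : sigma0 l -> [set l | sigmaoo (- l)] l -> False.
    by move=> k1 k2; have := (s0P _ k1).2; have := (sooP _ k2).2; lra.
  rewrite (wprodU z hAm hid d1).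
  congr (_ * _); exact: wprod_opp.
(* With [Wm] split over [sigma0] at [z] and [sigmaoo] at [- z], the constant in [hat_eta] is the
   quotient of [Wp] by [Wm] at [l0]; this yields [|hat eta_k| = u / v]. *)
have kappa : (infprod sigma0 (fun l => (l + l0) / (l - l0)) *
    infprod sigmaoo (fun l => (l - l0) / (l + l0)))%:C = wprod Ap id l0%:C / wprod Am id l0%:C :> R[i].
  rewrite rmorphM /= infprod_moebius//; last first.
    move=> l h; split; apply/eqP => e; first by apply: part_l0.1; rewrite -e.
    by have := (s0P l h).2; lra.
  rewrite infprod_moebius_inv//; last first.
    move=> l h; split; apply/eqP => e; first by apply: part_l0.2; rewrite -e.
    by have := (sooP l h).2; lra.
  rewrite (wprod_opp _ hAm hAp Ap_opp) !WmE opprK rmorphN mulf_div.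
  by [].
have SE k : 0 < Normc.normc (fm k l0%:C) / Normc.normc (wprod Am id l0%:C) + Normc.normc (fp k l0%:C) / Normc.normc (wprod Ap id l0%:C) ->
    S k = 4 * (Normc.normc (fm k l0%:C) / Normc.normc (wprod Am id l0%:C)) * (Normc.normc (fp k l0%:C) / Normc.normc (wprod Ap id l0%:C)) /
      (Normc.normc (fm k l0%:C) / Normc.normc (wprod Am id l0%:C) + Normc.normc (fp k l0%:C) / Normc.normc (wprod Ap id l0%:C)) ^+ 2.
  have am0 : 0 < Normc.normc (wprod Am id l0%:C) by rewrite normc_gt0.
  have ap0 : 0 < Normc.normc (wprod Ap id l0%:C) by rewrite normc_gt0.
  have fm_ge := normc_ge0 (fm k l0%:C); have fp_ge := normc_ge0 (fp k l0%:C).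
  (* For an infinite datum [Phi_+] vanishes at [l0] and both sides are 0. For a finite one [Phi_-]
     is a multiple of [Phi_+] at [l0], so [u + v > 0] forces [Phi_+] to be nonzero there. *)
  rewrite /S /hat_eta; have := etaC k _ Al0; case: (eta k l0) => [r|] eC uv; last first.
    by rewrite eC Normc.normc0 mul0r mulr0 mul0r.
  have fp1 : 0 < Normc.normc (fp k l0%:C).
    rewrite lt_def fp_ge andbT; apply/negP => /eqP fz.
    by move: uv; rewrite eC Normc.normcM fz mulr0 !mul0r addr0 ltxx.
  apply: sech2_quotient; [by rewrite divr_ge0// ltW|by rewrite divr_gt0|].
  have kn := congr1 (@Normc.normc R) kappa; rewrite normc_real normcf_div in kn.
  rewrite -mulrA normrM kn eC Normc.normcM normc_real.
  by field; rewrite !gt_eqF.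
move=> z0 z0A; have z0n l : sigma l -> (z0 : R[i]) != l%:C.
  by move=> Al; apply/eqP => h; apply: z0A; exists l.
have [d d0 hd] := isolated_from_set hA z0n.
(* Half the distance from [z0] to [sigma] as radius keeps all of [B] at distance at least [d / 2]
   from the poles. *)
pose B : set (Cplx R) := [set z | Normc.normc (z - z0) < d / 2].
exists B.
  apply/nbhs_normP; exists ((d / 2)%:C : Cplx R) => /=; first by rewrite ltcR; lra.
  by move=> z /=; rewrite distrC Cplx_norm_lt.
apply: uniform_cvgP => e e0.
have d2 : 0 < d / 2 by lra.
have := @coupling_asymptotics R sigma Am Ap l0 fm fp S hA l00 AE dis Ap_opp Aml0 Aml0'
  nm np rm rp QW fm0 fp0 sym SE (d / 2) e (Normc.normc (z0 : R[i]) + d) d2 e0.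
apply: filterS => k hk z [zB _]; rewrite W_wprod//.
rewrite /B /= in zB; apply: hk.
- move=> l Al; have := hd l Al.
  have := le_normcD (l%:C - z) (z - z0 : R[i]); rewrite addrA subrK; lra.
- have := le_normcD (z - z0 : R[i]) z0; rewrite subrK; lra.
Qed.
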